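(* Let $\gamma \in \mathbb{C}$ with $\gamma \neq 0$, let $\psi$ be analytic on an open neighborhood of $\overline{\mathbb{D}}$, and let $\Psi(z)=\gamma\bar{z}+\psi(z)$. Assume that $\Psi$ is sense-reversing on $\overline{\mathbb{D}}$, i.e. $|\gamma| > |\psi'(z)|$ for all $z \in \overline{\mathbb{D}}$. If the Toeplitz operator $T_{\Psi}$ is hypercyclic on $L_A^2(\mathbb{D})$, then $\mathbb{D}\cap\Psi(\mathbb{D}) \neq \emptyset$ and $\hat{\mathbb{D}}\cap\Psi(\mathbb{D}) \neq \emptyset$, where $\hat{\mathbb{D}} = \{z \in \mathbb{C} : |z| \geq 1\}$.
   Context: $\mathbb{D} = \{z \in \mathbb{C} : |z| < 1\}$, $\overline{\mathbb{D}}$ is its closure, and $\hat{\mathbb{D}} = \mathbb{C}\setminus\mathbb{D}$ is the closed exterior of the disc. The Bergman space $L_A^2(\mathbb{D}) = L^2(\mathbb{D}, dA) \cap \mathcal{H}(\mathbb{D})$ consists of the analytic functions on $\mathbb{D}$ that are square-integrable with respect to the normalized area measure $dA(z) = \frac{1}{\pi}\,dx\,dy$; $P : L^2(\mathbb{D}, dA) \to L_A^2(\mathbb{D})$ is the orthogonal (Bergman) projection, $Pf(z)= \int_{\mathbb{D}} \frac{f(\omega)}{(1-\bar{\omega}z)^{2}} \, dA(\omega)$. For $\phi \in L^\infty(\mathbb{D})$, the Toeplitz operator on $L_A^2(\mathbb{D})$ is $T_{\phi}f = P(\phi f)$. A bounded operator $T$ is hypercyclic if there is a vector $x$ whose orbit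 $\{T^n x : n \geq 0\}$ is dense. *)

(* Defs.v *)
From HB Require Import structures.
From mathcomp Require Import all_boot all_order all_algebra.
From mathcomp Require Import all_classical all_reals all_analysis.
From mathcomp Require Import complex.

Set Implicit Arguments.
Unset Strict Implicit.
Unset Printing Implicit Defensive.

Import Order.TTheory GRing.Theory Num.Theory.
Import numFieldNormedType.Exports.
Import ComplexField.Normc.

Local Open Scope classical_set_scope.
Local Open Scope complex_scope.
Local Open Scope ring_scope.

(* The complex numbers over R. The regular-module alias ^o gives access to
   the topology and to the normed-module structure of the field R[i] over
   itself, so that derive1 is the complex derivative. *)
Notation Cplx R := (R[i])^o.

Section BergmanToeplitz.
Variable R : realType.
Local Notation C := (Cplx R).

Definition disc : set C := [set z : C | `|z| < 1].

Definition disc_ext : set C := [set z : C | 1 <= `|z|].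

Definition analytic_at (f : C -> C) (c : C) : Prop :=
  exists (a : nat -> C) (r : R), 0 < r /\
    forall z : C, normc (z - c) < r ->
      series (fun n => a n * (z - c) ^+ n) @ \oo --> f z.

Definition analytic_on (U : set C) (f : C -> C) : Prop :=
  forall c, U c -> analytic_at f c.

(* The library has no Lebesgue measure on R[i]: area integrals are taken over
   the plane R * R through the identification (x, y) |-> x +i* y. *)
Local Notation plane := (measurableTypeR R * measurableTypeR R)%type.

Definition toC (p : plane) : C := (p.1 +i* p.2)%C.

Local Notation lebesgue2 := ((@lebesgue_measure R) \x (@lebesgue_measure R))%E.

Definition disc2 : set plane := toC @^-1` disc.

(* Integral over the disc of a complex function with respect to
   dA = pi^-1 dx dy. *)
Definition disc_integral (g : C -> C) : C :=
  (pi^-1 * (\int[lebesgue2]_(p in disc2) complex.Re (g (toC p))) +i*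
   (pi^-1 * (\int[lebesgue2]_(p in disc2) complex.Im (g (toC p)))))%C.

Definition L2norm (f : C -> C) : \bar R :=
  sqrte ((pi^-1)%:E *
    (\int[lebesgue2]_(p in disc2) ((normc (f (toC p))) ^+ 2)%:E))%E.

(* Only the restriction of f to the disc is relevant in the following
   definitions: elements of L^2 are represented by total functions on C. *)
Definition L2 : set (C -> C) := [set f |
  [/\ measurable_fun disc2 (fun p => complex.Re (f (toC p))),
      measurable_fun disc2 (fun p => complex.Im (f (toC p))) &
      (L2norm f < +oo)%E]].

Definition bergman : set (C -> C) := L2 `&` [set f | analytic_on disc f].

Definition bergman_proj (f : C -> C) : C -> C :=
  fun z => disc_integral (fun w => f w / (1 - w^* * z) ^+ 2).

Definition toeplitz (phi f : C -> C) : C -> C :=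
  bergman_proj (fun w => phi w * f w).

Definition bergman_hypercyclic (T : (C -> C) -> C -> C) : Prop :=
  exists2 f, bergman f &
    forall g, bergman g -> forall e : R, 0 < e ->
      exists n : nat, (L2norm (fun z => iter n T f z - g z)%R < e%:E)%E.

End BergmanToeplitz.

Arguments disc : clear implicits.
Arguments disc_ext : clear implicits.

(* Main.v *)
From HB Require Import structures.
Require Import Defs.
From mathcomp Require Import all_boot all_order all_algebra.
From mathcomp Require Import all_classical all_reals all_analysis.
From mathcomp Require Import measurable_realfun complex ring lra zify.
Import Order.TTheory GRing.Theory Num.Theory.
Import numFieldNormedType.Exports.
Import ComplexField.Normc.
Set Implicit Arguments.
Unset Strict Implicit.
Unset Printing Implicit Defensive.
Local Open Scope classical_set_scope.
Local Open Scope ring_scope.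

(** The squared Bergman norm of sum a_n z^n is sum |a_n|^2 / (n+1), and T_Psi
    acts on Taylor coefficients by
      b_n = gamma (n+1)/(n+2) a_(n+1) + sum_(k <= n) c_k a_(n-k).
    If |Psi| <= 1 on the disc, then T_Psi is a contraction and its orbits are
    bounded.  If |Psi| >= 1 on the disc, then T_Psi does not decrease norms, so
    an orbit that comes arbitrarily close to 0 starts at 0.

    The norm increase is proved for polynomial symbols gamma conj(z) + p with
    |p'| <= kappa |gamma|, kappa < 1, and |symbol| >= delta.  Writing U for the
    primitive of u vanishing at 0, the Hankel part of multiplication by conj(p)
    satisfies |p u|^2 - |p^* u|^2 <= |p' U|^2; hence T is hyponormal and T^* is
    bounded below.  If the infimum m of |T f| / |f| were in ]0, delta[, then for
    T1 = T / m every near-minimiser h has T1^* T1 h close to h, T1 h is again a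
    near-minimiser, and combinations of w^k T1^k h with w unimodular contradict
    that T1^* - w is bounded below.  That the infimum is positive follows by
    deforming the symbol to a nonzero constant through dilations.  Symbols
    analytic past the closed disc are reached by approximation. *)

(** A direct lower bound for T is out of reach: integrating |Psi f|^2 over the disc gives |T f|^2
    plus the Hankel term |gamma|^2 |F|^2, F the primitive of f, and this term has no a priori bound
    by |T f|. For the adjoint, what is lost is the Hankel part of conj(p) f, which sense reversal
    bounds by kappa^2 |gamma|^2 |F|^2; so the adjoint is bounded below at once. The same holds after
    subtracting a constant of modulus less than delta from the symbol, since p' does not change. The
    difficulty is to return from the adjoint to T, because hyponormality compares the two in the
    unfavourable direction. Both operators preserve polynomials, so norms are finite sums and the
    adjoint is explicit. No completion of the space is formed; near-minimisers stand in for the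
    vectors that a limit would provide. Averages over roots of unity of order 2^j replace integrals
    over circles, both for orthogonality in the near-minimiser argument and for Cauchy's
    estimate. *)

Section ComplexScalars.
Variable R : realType.
Local Notation C := R[i].
Implicit Types x y z : C.

Definition cdot x y : R := complex.Re x * complex.Re y + complex.Im x * complex.Im y.
Definition sqn x : R := cdot x x.

Lemma cdotC x y : cdot x y = cdot y x.
Proof. by rewrite /cdot; ring. Qed.

Lemma cdotDl x y z : cdot (x + y) z = cdot x z + cdot y z.
Proof. by case: x y z => [a b] [c d] [e f]; rewrite /cdot /=; ring. Qed.

Lemma cdotDr x y z : cdot x (y + z) = cdot x y + cdot x z.
Proof. by rewrite cdotC cdotDl !(cdotC x). Qed.

Lemma cdot0l y : cdot 0 y = 0.
Proof. by rewrite /cdot /= !mul0r addr0. Qed.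

Lemma cdot0r x : cdot x 0 = 0.
Proof. by rewrite cdotC cdot0l. Qed.

Lemma cdotMl x y z : cdot (x * y) z = cdot y (conjc x * z).
Proof. by case: x y z => [a b] [c d] [e f]; rewrite /cdot /=; ring. Qed.

Lemma cdotRl (r : R) x y : cdot (r%:C%C * x) y = r * cdot x y.
Proof. by case: x y => [c d] [e f]; rewrite /cdot /=; ring. Qed.

Lemma cdotRr (r : R) x y : cdot x (r%:C%C * y) = r * cdot x y.
Proof. by rewrite cdotC cdotRl cdotC. Qed.

Lemma cdot_suml I (s : seq I) (P : pred I) (F : I -> C) y :
  cdot (\sum_(i <- s | P i) F i) y = \sum_(i <- s | P i) cdot (F i) y.
Proof. exact: (big_morph (cdot^~ y) (fun a b => cdotDl a b y) (cdot0l y)). Qed.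

Lemma cdot_sumr I (s : seq I) (P : pred I) (F : I -> C) x :
  cdot x (\sum_(i <- s | P i) F i) = \sum_(i <- s | P i) cdot x (F i).
Proof. exact: (big_morph (cdot x) (cdotDr x) (cdot0r x)). Qed.

Lemma sqn_ge0 x : 0 <= sqn x.
Proof. by rewrite /sqn /cdot -!expr2 addr_ge0 ?sqr_ge0. Qed.

Lemma sqnM x y : sqn (x * y) = sqn x * sqn y.
Proof. by case: x y => [a b] [c d]; rewrite /sqn /cdot /=; ring. Qed.

Lemma sqnD x y : sqn (x + y) = sqn x + 2 * cdot x y + sqn y.
Proof. by rewrite /sqn !(cdotDl, cdotDr) (cdotC y x); ring. Qed.

Lemma sqn0 : sqn 0 = 0.
Proof. exact: cdot0l. Qed.

Lemma sqn1 : sqn 1 = 1.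
Proof. by rewrite /sqn /cdot /= mulr1 mul0r addr0. Qed.

Lemma sqnN x : sqn (- x) = sqn x.
Proof. by case: x => [a b]; rewrite /sqn /cdot /=; ring. Qed.

Lemma sqn_conj x : sqn (conjc x) = sqn x.
Proof. by case: x => [a b]; rewrite /sqn /cdot /=; ring. Qed.

Lemma sqn_real (r : R) : sqn r%:C%C = r ^+ 2.
Proof. by rewrite /sqn /cdot /=; ring. Qed.

Lemma sqnX x n : sqn (x ^+ n) = sqn x ^+ n.
Proof. by elim: n => [|n IH]; rewrite ?expr0 ?sqn1 // !exprS sqnM IH. Qed.

Lemma normc_sqn x : normc x = Num.sqrt (sqn x).
Proof. by case: x => a b; rewrite /normc /sqn /cdot /= !expr2. Qed.

Lemma sqr_normc_sqn x : normc x ^+ 2 = sqn x.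
Proof. by rewrite normc_sqn sqr_sqrtr // sqn_ge0. Qed.

Lemma normc_ge0 x : 0 <= normc x.
Proof. by rewrite normc_sqn sqrtr_ge0. Qed.

Lemma real_natc (n : nat) : (n%:R : R)%:C%C = n%:R :> C.
Proof. by rewrite rmorph_nat. Qed.

Lemma real_invc (r : R) : (r^-1)%:C%C = (r%:C%C)^-1 :> C.
Proof. by rewrite fmorphV. Qed.

End ComplexScalars.

Lemma natr1_neq0 (F : numDomainType) (n : nat) : 1 + n%:R != 0 :> F.
Proof. by rewrite nat1r pnatr_eq0. Qed.

Lemma natr2_neq0 (F : numDomainType) (n : nat) : 2 + n%:R != 0 :> F.
Proof. by rewrite -natrD pnatr_eq0. Qed.

(** * The Bergman norm on polynomials *)

Section BergmanPolynomials.
Variable R : realType.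
Local Notation C := R[i].
Implicit Types (f g h : {poly C}) (c : C).

(** The real part of the Hermitian product of the Bergman space, where z^n has squared norm 1/(n+1).
    Estimates stay in [R], and complex scalars cross the product by conjugation, as in [ipZl]. *)
Definition ip f g : R := \sum_(n < size f) cdot f`_n g`_n / n.+1%:R.
Definition bnorm f : R := ip f f.

Lemma ipE M f g : (size f <= M)%N ->
  ip f g = \sum_(n < M) cdot f`_n g`_n / n.+1%:R.
Proof.
move=> h; rewrite /ip (big_ord_widen M (fun n => cdot f`_n g`_n / n.+1%:R)) //.
rewrite [RHS](bigID (fun i : 'I_M => i < size f)%N) /= [X in _ = _ + X]big1 ?addr0 //.
by move=> i; rewrite -leqNgt => hi; rewrite nth_default // cdot0l mul0r.
Qed.

Lemma ipC f g : ip f g = ip g f.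
Proof.
rewrite (@ipE (maxn (size f) (size g)) f) ?leq_maxl //.
rewrite (@ipE (maxn (size f) (size g)) g) ?leq_maxr //.
by apply: eq_bigr => i _; rewrite cdotC.
Qed.

Lemma ipDl f g h : ip (f + g) h = ip f h + ip g h.
Proof.
set M := maxn (size f) (size g).
rewrite (@ipE M (f + g)) ?size_polyD // (@ipE M f) ?leq_maxl // (@ipE M g) ?leq_maxr //.
by rewrite -big_split /=; apply: eq_bigr => i _; rewrite coefD cdotDl mulrDl.
Qed.

Lemma ipDr f g h : ip f (g + h) = ip f g + ip f h.
Proof. by rewrite ipC ipDl !(ipC f). Qed.

Lemma ipZl c f g : ip (c *: f) g = ip f (conjc c *: g).
Proof.
rewrite (@ipE (size f) (c *: f)) ?size_scale_leq // /ip.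
by apply: eq_bigr => i _; rewrite !coefZ cdotMl.
Qed.

Lemma ipRl (r : R) f g : ip (r%:C%C *: f) g = r * ip f g.
Proof.
rewrite (@ipE (size f) (r%:C%C *: f)) ?size_scale_leq // /ip mulr_sumr.
by apply: eq_bigr => i _; rewrite !coefZ cdotRl mulrA.
Qed.

Lemma ipRr (r : R) f g : ip f (r%:C%C *: g) = r * ip f g.
Proof. by rewrite ipC ipRl ipC. Qed.

Lemma bnormE M f : (size f <= M)%N -> bnorm f = \sum_(n < M) sqn f`_n / n.+1%:R.
Proof. exact: ipE. Qed.

Lemma bnorm_ge0 f : 0 <= bnorm f.
Proof. by apply: sumr_ge0 => i _; rewrite divr_ge0 ?sqn_ge0 ?ler0n. Qed.

Lemma ip0l f : ip 0 f = 0.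
Proof. by rewrite /ip size_poly0 big_ord0. Qed.

Lemma bnorm0 : bnorm 0 = 0.
Proof. exact: ip0l. Qed.

Lemma bnormD f g : bnorm (f + g) = bnorm f + 2 * ip f g + bnorm g.
Proof. by rewrite /bnorm ipDl !ipDr (ipC g f); ring. Qed.

Lemma ipNl f g : ip (- f) g = - ip f g.
Proof.
have -> : - f = (-1 : R)%:C%C *: f by rewrite rmorphN1 scaleN1r.
by rewrite ipRl mulN1r.
Qed.

Lemma bnormN f : bnorm (- f) = bnorm f.
Proof. by rewrite /bnorm ipNl ipC ipNl opprK. Qed.

Lemma bnormB f g : bnorm (f - g) = bnorm f - 2 * ip f g + bnorm g.
Proof. by rewrite bnormD bnormN ipC ipNl (ipC g); ring. Qed.

Lemma bnormZ c f : bnorm (c *: f) = sqn c * bnorm f.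
Proof.
rewrite (@bnormE (size f) (c *: f)) ?size_scale_leq // /bnorm /ip mulr_sumr.
by apply: eq_bigr => i _; rewrite coefZ sqnM mulrA.
Qed.

Lemma bnorm_gt0 f : f != 0 -> 0 < bnorm f.
Proof.
move=> f0; rewrite /bnorm /ip.
have h : (0 < size f)%N by rewrite size_poly_gt0.
case E : (size f) h => [//|n] _.
rewrite big_ord_recr /= ltr_wpDl //.
  by apply: sumr_ge0 => i _; rewrite divr_ge0 ?sqn_ge0 ?ler0n.
rewrite divr_gt0 ?ltr0n // lt_def sqn_ge0 andbT.
have := f0; rewrite -lead_coef_eq0 lead_coefE E /=.
case: (f`_n) => a b; apply: contra; rewrite /sqn /cdot /= -!expr2.
rewrite paddr_eq0 ?sqr_ge0 // !sqrf_eq0 => /andP[/eqP -> /eqP ->].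
by rewrite eq_complex /= !eqxx.
Qed.

(** Expand 0 <= |t f - g|^2 and divide by t. The free weight lets a small perturbation be absorbed
    while the factor on the main term stays as close to 1 as desired. *)
Lemma bnormD_le (t : R) f g : 0 < t ->
  bnorm (f + g) <= (1 + t) * bnorm f + (1 + t^-1) * bnorm g.
Proof.
move=> t0.
have := bnorm_ge0 (t%:C%C *: f - g).
rewrite bnormB bnormZ sqn_real ipRl bnormD => h.
have h2 : 2 * ip f g <= t * bnorm f + t^-1 * bnorm g.
  rewrite -(ler_pM2l t0).
  have -> : t * (t * bnorm f + t^-1 * bnorm g) = t ^+ 2 * bnorm f + bnorm g.
    by field; rewrite gt_eqF.
  by lra.
by lra.
Qed.

Lemma bnormD2 f g : bnorm (f + g) <= 2 * bnorm f + 2 * bnorm g.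
Proof. by have := @bnormD_le 1 f g ltr01; rewrite invr1. Qed.

Lemma bnorm_sum K (F : 'I_K -> {poly C}) :
  bnorm (\sum_(i < K) F i) <= K%:R * \sum_(i < K) bnorm (F i).
Proof.
elim: K F => [|K IH] F; first by rewrite !big_ord0 bnorm0 mul0r.
rewrite !big_ord_recr /=.
case: K IH F => [|K] IH F.
  by rewrite !big_ord0 !add0r mul1r.
set g := \sum_(i < K.+1) F (widen_ord _ i).
have k0 : 0 < K.+1%:R :> R by rewrite ltr0n.
(* With weight 1/(K+1), the induction factor K+1 on the old sum and the factor on the new term both
   become K+2. *)
have := @bnormD_le (K.+1%:R^-1) g (F ord_max).
rewrite invr_gt0 invrK => /(_ k0) h.
have h1 := IH (fun i => F (widen_ord (leqnSn _) i)); rewrite -/g in h1.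
have e : (1 + K.+1%:R^-1) = K.+2%:R / K.+1%:R :> R.
  by rewrite -(natr1 K.+1) mulrDl mul1r divff // gt_eqF.
apply: (le_trans h); rewrite mulrDr e nat1r; apply: lerD => //.
rewrite -mulrA ler_pM2l ?ltr0n // mulrC ler_pdivrMr // mulrC.
exact: h1.
Qed.

End BergmanPolynomials.

(** * Multiplication by polynomials, its adjoint, and Hankel parts *)

Section PolynomialOperators.
Variable R : realType.
Local Notation C := R[i].
Implicit Types (p q f g h u : {poly C}) (c : C).

(** Summing over pairs of exponents whose ranges do not depend on m makes norms of products expand
    into double sums over one fixed index type. *)
Lemma coefM_pairs p q P Q m : (size p <= P)%N -> (size q <= Q)%N ->
  (p * q)`_m = \sum_(i : 'I_P * 'I_Q | (i.1 + i.2 == m)%N) p`_i.1 * q`_i.2.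
Proof.
move=> hP hQ.
rewrite -(pair_big_dep xpredT (fun (a : 'I_P) (n : 'I_Q) => (a + n == m)%N)
  (fun a n => p`_a * q`_n)) /=.
rewrite coefM.
set K := maxn P m.+1.
rewrite (big_ord_widen K (fun j => p`_j * q`_(m - j))); last by rewrite leq_maxr.
rewrite [RHS](big_ord_widen K (fun a => \sum_(j < Q | (a + j == m)%N) p`_a * q`_j));
  last by rewrite leq_maxl.
rewrite big_mkcond [RHS]big_mkcond /=; apply: eq_bigr => i _.
case: (ltnP i P) => hi; last first.
  by rewrite (nth_default _ (leq_trans hP hi)) mul0r; case: ifP.
case: (ltnP i m.+1) => him; last first.
  by rewrite big1 // => j /eqP; lia.
case: (ltnP (m - i) Q) => hj.
  rewrite (big_pred1 (Ordinal hj)) // => j /=.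
  by rewrite -val_eqE /=; apply/eqP/eqP; lia.
rewrite (nth_default _ (leq_trans hQ hj)) mulr0.
by rewrite big1 // => j /eqP; have := ltn_ord j; lia.
Qed.

(** The Bergman projection of conj(p) g: conj(z)^a z^(a+d) projects to (d+1)/(a+d+1) z^d, and
    monomials of negative degree project to 0. [ip_adjp] identifies it as the adjoint of
    multiplication by p. *)
Definition adjp p g : {poly C} :=
  \poly_(d < size g) (d.+1%:R * \sum_(a < size p) conjc p`_a * g`_(a + d) / (a + d).+1%:R).

Lemma coef_adjp p g d : (adjp p g)`_d =
  d.+1%:R * \sum_(a < size p) conjc p`_a * g`_(a + d) / (a + d).+1%:R.
Proof.
rewrite coef_poly; case: ltnP => // hd; rewrite big1 ?mulr0 // => a _.
by rewrite (nth_default _ (leq_trans hd (leq_addl _ _))) mulr0 mul0r.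
Qed.

Lemma size_adjp p g : (size (adjp p g) <= size g)%N.
Proof. exact: size_poly. Qed.

Lemma coef_adjpE P p g d : (size p <= P)%N -> (adjp p g)`_d =
  d.+1%:R * \sum_(a < P) conjc p`_a * g`_(a + d) / (a + d).+1%:R.
Proof.
move=> hP; rewrite coef_adjp; congr (_ * _).
rewrite (big_ord_widen P (fun a => conjc p`_a * g`_(a + d) / (a + d).+1%:R)) //.
rewrite [RHS](bigID (fun i : 'I_P => i < size p)%N) /= [X in _ = _ + X]big1 ?addr0 //.
by move=> i; rewrite -leqNgt => hi; rewrite nth_default // rmorph0 !mul0r.
Qed.

Lemma adjpD p q g : adjp (p + q) g = adjp p g + adjp q g.
Proof.
apply/polyP => d; rewrite coefD.
set P := maxn (size p) (size q).
rewrite !(@coef_adjpE P) ?leq_maxl ?leq_maxr ?size_polyD //.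
rewrite -mulrDr -big_split /=; congr (_ * _); apply: eq_bigr => i _.
by rewrite coefD rmorphD !mulrDl.
Qed.

Lemma adjpC c g : adjp c%:P g = conjc c *: g.
Proof.
apply/polyP => d; rewrite (@coef_adjpE 1) ?size_polyC_leq1 // big_ord1 coefC eqxx coefZ add0n.
rewrite mulrCA divff ?mulr1 //; by rewrite pnatr_eq0.
Qed.

Lemma natrc_neq0 (n : nat) : (n.+1%:R : C) != 0.
Proof. by rewrite pnatr_eq0. Qed.

Lemma cdot_natl (n : nat) (x y : C) : cdot (n%:R * x) y = n%:R * cdot x y.
Proof. by rewrite -real_natc cdotRl. Qed.

Lemma cdot_divnat (n : nat) (x y : C) : cdot (x / n.+1%:R) y = cdot x y / n.+1%:R.
Proof. by rewrite -real_natc -real_invc mulrC cdotRl mulrC. Qed.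

Lemma ip_adjp p f g : ip (p * f) g = ip f (adjp p g).
Proof.
pose P := size p; pose Q := size f; pose M := (P + Q)%N.
have hM : (size (p * f)%R <= M)%N by apply: (leq_trans (size_polyMleq _ _)); rewrite /M; lia.
rewrite (@ipE _ M) // (@ipE _ Q f) //.
transitivity (\sum_(i : 'I_P * 'I_Q) cdot (p`_i.1 * f`_i.2) g`_(i.1 + i.2) / (i.1 + i.2).+1%:R).
  under eq_bigr => m _ do rewrite (@coefM_pairs _ _ P Q) // cdot_suml mulr_suml big_mkcond /=.
  rewrite exchange_big /=; apply: eq_bigr => -[a n] _ /=.
  rewrite -big_mkcond /=.
  have h : (a + n < M)%N by have := ltn_ord a; have := ltn_ord n; rewrite /M; lia.
  by rewrite (big_pred1 (Ordinal h)).
rewrite -(pair_big xpredT xpredT (fun (a : 'I_P) (n : 'I_Q) =>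
   cdot (p`_a * f`_n) g`_(a + n) / (a + n).+1%:R)) /= exchange_big /=.
apply: eq_bigr => n _; rewrite coef_adjp cdotC cdot_natl.
rewrite mulrAC divff ?mul1r; last by rewrite pnatr_eq0.
rewrite cdot_suml; apply: eq_bigr => a _.
by rewrite [RHS]cdot_divnat [in RHS]cdotC cdotMl.
Qed.

Definition primp u : {poly C} := 'X * \poly_(n < size u) (u`_n / n.+1%:R).

Lemma adjpB p c g : adjp (p - c%:P) g = adjp p g - conjc c *: g.
Proof. by rewrite adjpD -polyCN adjpC rmorphN scaleNr. Qed.

(** Once expanded over pairs of indices, square sums graded by a + n and square sums graded by n - a
    can be compared entry by entry. *)
Lemma sqn_pair_sum (I : finType) (M : nat) (w : nat -> R) (e : I -> nat -> bool) (x : I -> C) :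
  \sum_(m < M) w m * sqn (\sum_(i : I | e i m) x i) =
  \sum_(i : I) \sum_(j : I) (\sum_(m < M | e i m && e j m) w m) * cdot (x i) (x j).
Proof.
transitivity (\sum_(m < M) \sum_(i : I) \sum_(j : I)
   (if e i m && e j m then w m * cdot (x i) (x j) else 0)).
  apply: eq_bigr => m _; rewrite /sqn cdot_suml mulr_sumr big_mkcond; apply: eq_bigr => i _.
  case: ifP => hi /=; last by rewrite big1.
  by rewrite cdot_sumr mulr_sumr big_mkcond.
rewrite exchange_big; apply: eq_bigr => i _ /=.
rewrite exchange_big; apply: eq_bigr => j _ /=.
by rewrite -big_mkcond mulr_suml.
Qed.

Lemma bnorm_primp u : bnorm (primp u) = \sum_(n < size u) sqn u`_n / (n.+1%:R ^+ 2 * n.+2%:R).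
Proof.
rewrite (@bnormE _ (size u).+1); last first.
  apply: (leq_trans (size_polyMleq _ _)); rewrite size_polyX /=; exact: size_poly.
rewrite big_ord_recl /primp coefXM /= sqn0 mul0r add0r; apply: eq_bigr => i _.
rewrite coefXM /= /bump /= add1n coef_poly ltn_ord.
rewrite sqnM -real_natc -real_invc sqn_real.
by field; rewrite ?natr1_neq0 ?natr2_neq0.
Qed.

Lemma bnorm_mulX u : bnorm ('X * u) = \sum_(n < size u) sqn u`_n / n.+2%:R.
Proof.
rewrite (@bnormE _ (size u).+1); last first.
  by apply: (leq_trans (size_polyMleq _ _)); rewrite size_polyX.
rewrite big_ord_recl coefXM /= sqn0 mul0r add0r; apply: eq_bigr => i _.
by rewrite coefXM.
Qed.

Lemma bnorm_adjX u : bnorm (adjp 'X u) = \sum_(n < size u) sqn u`_n * (n%:R / n.+1%:R ^+ 2).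
Proof.
rewrite (@bnormE _ (size u)) ?size_adjp //.
have E d : (adjp 'X u)`_d = d.+1%:R / d.+2%:R * u`_d.+1.
  rewrite (@coef_adjpE 2) ?size_polyX // big_ord_recl big_ord1 !coefX.
  rewrite conjc0 conjc1 /= add1n.
  by rewrite !mul0r add0r mul1r mulrA mulrAC.
have -> : \sum_(n < size u) sqn (adjp 'X u)`_n / n.+1%:R
        = \sum_(n < size u) sqn u`_n.+1 * (n.+1%:R / n.+2%:R ^+ 2).
  apply: eq_bigr => n _; rewrite E -!real_natc -real_invc -rmorphM sqnM sqn_real.
  by field; rewrite ?natr1_neq0 ?natr2_neq0.
case E2 : (size u) => [|s]; first by rewrite !big_ord0.
rewrite big_ord_recr [RHS]big_ord_recl /= mul0r mulr0 add0r.
by rewrite nth_default ?E2 // sqn0 mul0r addr0.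
Qed.

(** Coefficientwise, 1/(n+2) - n/(n+1)^2 = 1/((n+1)^2 (n+2)). The left side is the squared norm of
    the part of conj(z) u orthogonal to analytic functions, because |z u| = |conj(z) u|. *)
Lemma bnormX_primp u : bnorm ('X * u) - bnorm (adjp 'X u) = bnorm (primp u).
Proof.
rewrite bnorm_mulX bnorm_adjX bnorm_primp -sumrB; apply: eq_bigr => i _.
by rewrite -mulrBr; congr (_ * _); field; rewrite ?natr1_neq0 ?natr2_neq0.
Qed.

Lemma cdot_swap (a b x y : C) :
  cdot (conjc b * x) (conjc a * y) = cdot (a * x) (b * y).
Proof. by case: a b x y => [? ?] [? ?] [? ?] [? ?]; rewrite /cdot /=; ring. Qed.

(* The defect bnorm (p' U) - bnorm (p u) + bnorm (adjp p u) equals the weighted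
   square sum of the coefficients of conj(p) u that have negative degree; this
   reduces to 1/(a+n+1) - ab/((n+1)(k+1)(a+n+1)) = (n-b+1)/((n+1)(k+1))
   whenever a + n = b + k. *)
Lemma bnorm_hankel_le p u :
  bnorm (p * u) - bnorm (adjp p u) <= bnorm (p^`() * primp u).
Proof.
pose P := size p; pose Q := size u; pose M := (P + Q)%N.
pose I := ('I_P * 'I_Q)%type.
pose x (i : I) : C := p`_i.1 * u`_i.2.
have hM : (size (p * u)%R <= M)%N by apply: (leq_trans (size_polyMleq _ _)); rewrite /M; lia.
have E1 : bnorm (p * u) = \sum_(i : I) \sum_(j : I)
   (\sum_(m < M | (i.1 + i.2 == m)%N && (j.1 + j.2 == m)%N) m.+1%:R^-1) * cdot (x i) (x j).
  rewrite (@bnormE _ M) // -(@sqn_pair_sum I M (fun m => m.+1%:R^-1) (fun i m => (i.1 + i.2 == m)%N) x).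
  by apply: eq_bigr => m _; rewrite (@coefM_pairs _ _ P Q) // mulrC.
pose y (i : I) : C := (i.1%:R / i.2.+1%:R) * x i.
have E2 : bnorm (p^`() * primp u) = \sum_(i : I) \sum_(j : I)
   (\sum_(m < M | (i.1 + i.2 == m)%N && (j.1 + j.2 == m)%N) m.+1%:R^-1) * cdot (y i) (y j).
  set V := \poly_(n < size u) (u`_n / n.+1%:R).
  have e : p^`() * primp u = ('X * p^`()) * V by rewrite /primp mulrCA mulrA.
  have s1 : (size ('X * p^`())%R <= P)%N.
    have [->|p0] := eqVneq p 0; first by rewrite deriv0 mulr0 size_poly0.
    apply: (leq_trans (size_polyMleq _ _)); rewrite size_polyX /=.
    exact: lt_size_deriv.
  have s2 : (size V <= Q)%N by exact: size_poly.
  have hM2 : (size (p^`() * primp u)%R <= M)%N.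
    by rewrite e; apply: (leq_trans (size_polyMleq _ _)); rewrite /M; lia.
  rewrite (@bnormE _ M) // -(@sqn_pair_sum I M (fun m => m.+1%:R^-1) (fun i m => (i.1 + i.2 == m)%N) y).
  apply: eq_bigr => m _; rewrite e (@coefM_pairs _ _ P Q) // mulrC; congr (_ * sqn _).
  apply: eq_bigr => -[a n] _ /=.
  rewrite coefXM coef_deriv coef_poly ltn_ord /y /x /=.
  case: (val a) => [|a'] /=; first by rewrite !mul0r.
  by rewrite -mulr_natl; ring.
pose z (i : I) : C := conjc p`_i.1 * u`_i.2 / i.2.+1%:R.
have E3 : bnorm (adjp p u) = \sum_(i : I) \sum_(j : I)
   (\sum_(m < M | (i.2 == i.1 + m :> nat)%N && (j.2 == j.1 + m :> nat)%N) m.+1%:R) * cdot (z i) (z j).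
  rewrite (@bnormE _ M); last by apply: (leq_trans (size_adjp _ _)); rewrite /M leq_addl.
  rewrite -(@sqn_pair_sum I M (fun m => m.+1%:R) (fun i m => (i.2 == i.1 + m :> nat)%N) z).
  apply: eq_bigr => m _; rewrite coef_adjp.
  rewrite -real_natc sqnM sqn_real.
  rewrite -(pair_big_dep xpredT (fun (a : 'I_P) (n : 'I_Q) => (n == a + m :> nat)%N)
     (fun a n => conjc p`_a * u`_n / n.+1%:R)) /=.
  have -> : \sum_(a < P) \sum_(n < Q | (n == a + m :> nat)%N) conjc p`_a * u`_n / n.+1%:R
     = \sum_(a < size p) conjc p`_a * u`_(a + m) / (a + m).+1%:R.
    apply: eq_bigr => a _.
    case: (ltnP (a + m) Q) => h; first by rewrite (big_pred1 (Ordinal h)).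
    rewrite (nth_default _ h) mulr0 mul0r big1 // => n /eqP hn.
    by have := ltn_ord n; rewrite hn; lia.
  by field; rewrite natr1_neq0.
(* These are the terms of degree -(m+2), with weight m+1. Degree -1 would carry weight 0 and is left
   out. *)
have E4 : 0 <= \sum_(i : I) \sum_(j : I)
   (\sum_(m < M | (i.1 == i.2 + m.+2 :> nat)%N && (j.1 == j.2 + m.+2 :> nat)%N) m.+1%:R)
     * cdot (z i) (z j).
  rewrite -(@sqn_pair_sum I M (fun m => m.+1%:R) (fun i m => (i.1 == i.2 + m.+2 :> nat)%N) z).
  by apply: sumr_ge0 => m _; rewrite mulr_ge0 ?ler0n ?sqn_ge0.
rewrite -subr_ge0; set RHS := (X in _ <= X); suff -> : RHS = \sum_(i : I) \sum_(j : I)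
   (\sum_(m < M | (i.1 == i.2 + m.+2 :> nat)%N && (j.1 == j.2 + m.+2 :> nat)%N) m.+1%:R)
     * cdot (z i) (z j) by [].
rewrite /RHS {RHS} opprB E1 E2 E3.
rewrite addrCA addrC; apply/eqP; rewrite eq_sym -subr_eq eq_sym; apply/eqP.
have pairI (F : I -> I -> R) : \sum_(i : I) \sum_(j : I) F i j = \sum_(t : I * I) F t.1 t.2.
  by rewrite pair_big.
rewrite -!sumrB.
under eq_bigr => i _ do rewrite -sumrB.
under [RHS]eq_bigr => i _ do rewrite -sumrB.
rewrite !pairI.
(* Exchanging the exponents of p between the two pairs moves the conjugations: it turns the products
   from conj(p) u into the products from p u, and the condition of equal degree n - a into equality
   of a + n and b + k. *)
pose h (t : I * I) : I * I := ((t.2.1, t.1.2), (t.1.1, t.2.2)).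
have hK : involutive h by case=> [[a n] [b k]].
rewrite [RHS](reindex_inj (inv_inj hK)) /=.
apply: eq_bigr => -[[a n] [b k]] _ /=.
have ez : cdot (z (b, n)) (z (a, k)) = cdot (x (a, n)) (x (b, k)) / (n.+1%:R * k.+1%:R).
  rewrite /z /x /= cdot_divnat cdotC cdot_divnat cdotC -mulrA -invfM; congr (_ / _).
    exact: cdot_swap.
  by rewrite mulrC.
have ey : cdot (y (a, n)) (y (b, k)) =
   a%:R * b%:R / (n.+1%:R * k.+1%:R) * cdot (x (a, n)) (x (b, k)).
  rewrite /y /= -!real_natc -!real_invc -!rmorphM cdotRl cdotRr.
  by field; rewrite ?natr1_neq0 ?natr2_neq0.
rewrite ez ey; set X := cdot _ _.
have ha := ltn_ord a; have hn := ltn_ord n; have hb := ltn_ord b; have hk := ltn_ord k.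
have -> : \sum_(m < M | (a + n == m)%N && (b + k == m)%N) m.+1%:R^-1 =
   (if (a + n == b + k)%N then (a + n).+1%:R^-1 else 0) :> R.
  case: eqP => e; last by rewrite big1 // => m /andP[/eqP h1 /eqP h2]; lia.
  have h1 : (a + n < M)%N by rewrite /M; lia.
  by rewrite (big_pred1 (Ordinal h1)) // => m /=; rewrite -e andbb [RHS]eq_sym.
have -> : \sum_(m < M | (b == n + m.+2 :> nat)%N && (a == k + m.+2 :> nat)%N) m.+1%:R =
   (if (a + n == b + k)%N && (n.+2 <= b)%N then (b - n).-1%:R else 0) :> R.
  case: ifP => [/andP[/eqP e hle]|hle]; last first.
    rewrite big1 // => m /andP[/eqP h1 /eqP h2]; move: hle => /negP[].
    by apply/andP; split; [apply/eqP|]; lia.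
  have h1 : (b - n.+2 < M)%N by rewrite /M; lia.
  rewrite (big_pred1 (Ordinal h1)); first by congr _%:R; rewrite /=; lia.
  move=> m; rewrite /= -(inj_eq val_inj) /=; apply/andP/eqP => [[/eqP h2 /eqP h3]|h2]; first by lia.
  by split; apply/eqP; lia.
have -> : \sum_(m < M | (n == b + m :> nat)%N && (k == a + m :> nat)%N) m.+1%:R =
   (if (a + n == b + k)%N && (b <= n)%N then (n - b).+1%:R else 0) :> R.
  case: ifP => [/andP[/eqP e hle]|hle]; last first.
    rewrite big1 // => m /andP[/eqP h1 /eqP h2]; move: hle => /negP[].
    by apply/andP; split; [apply/eqP|]; lia.
  have h1 : (n - b < M)%N by rewrite /M; lia.
  rewrite (big_pred1 (Ordinal h1)) // => m.
  rewrite /= -(inj_eq val_inj) /=; apply/andP/eqP => [[/eqP h2 /eqP h3]|h2]; first by lia.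
  by split; apply/eqP; lia.
case: eqP => [e|_] /=; last by rewrite !mul0r subrr.
have eR : b%:R = a%:R + n%:R - k%:R :> R by rewrite -natrD e natrD addrK.
rewrite -mulrBl.
(* The two truncated weights join into one linear expression; at b = n+1 neither applies and the
   expression is 0. *)
have -> : ((if (n.+2 <= b)%N then (b - n).-1%:R else 0)
   - (if (b <= n)%N then (n - b).+1%:R else 0) : R) = b%:R - n%:R - 1.
  case: ifP => h1; case: ifP => h2; first by lia.
  - by rewrite subr0 -subn1 !natrB; [|lia..].
  - by rewrite sub0r -natr1 natrB //; ring.
  - have -> : nat_of_ord b = n.+1 by lia.
    by rewrite -natr1; ring.
rewrite eR -!natr1 natrD; field.
rewrite -natrD addrC; by rewrite !(addrC _ 1) !natr1_neq0.
Qed.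
End PolynomialOperators.

(** * Averages over roots of unity *)

Section Parseval.
Variable R : realType.
Local Notation C := R[i].

Lemma sum_even_odd (V : nmodType) n (F : nat -> V) :
  \sum_(k < n.*2) F k = \sum_(k < n) F k.*2 + \sum_(k < n) F k.*2.+1.
Proof.
elim: n => [|n IH]; first by rewrite !big_ord0 addr0.
rewrite doubleS !big_ord_recr /= IH -!addrA; congr (_ + _).
by rewrite !addrA; congr (_ + _); rewrite addrC.
Qed.

(** [Om] lists the roots of unity of order 2^j, obtained by adjoining both square roots of each
    element. After splitting the sum by the parity of k, the cross terms belonging to the two
    opposite square roots cancel. *)
Lemma unimodular_parseval j : exists Om : seq C,
  [/\ size Om = (2 ^ j)%N, {in Om, forall w, sqn w = 1} &
   forall x : nat -> C, \sum_(w <- Om) sqn (\sum_(k < 2 ^ j) x k * w ^+ k) =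
     (2 ^ j)%:R * \sum_(k < 2 ^ j) sqn (x k)].
Proof.
elim: j => [|j [Om [sz h1 h2]]].
  exists [:: 1]; split => //; first by move=> w; rewrite inE => /eqP ->; rewrite sqn1.
  by move=> x; rewrite big_seq1 expn0 !big_ord1 expr0 mulr1 mul1r.
pose sq (w : C) : C := sqrtc w.
have sqE (w : C) : sq w ^+ 2 = w by exact: sqr_sqrtc.
exists ([seq sq w | w <- Om] ++ [seq - sq w | w <- Om]).
have h (w : C) : w \in Om -> sqn (sq w) = 1.
  move=> /h1; rewrite -{1}(sqE w) sqnX => /eqP.
  by rewrite sqrf_eq1 => /orP[/eqP //|/eqP e]; have := sqn_ge0 (sq w); rewrite e; lra.
split.
- by rewrite size_cat !size_map sz expnS mul2n addnn.
- by move=> w; rewrite mem_cat => /orP[] /mapP[v /h hv ->]; rewrite ?sqnN.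
move=> x; rewrite big_cat /= !big_map -big_split /=.
rewrite expnS mul2n.
pose E w := \sum_(k < 2 ^ j) x k.*2 * w ^+ k.
pose O w := \sum_(k < 2 ^ j) x k.*2.+1 * w ^+ k.
transitivity (\sum_(w <- Om) 2 * (sqn (E w) + sqn (O w))).
  rewrite !big_seq; apply: eq_bigr => w hw.
  have split2 (v : C) : v ^+ 2 = w ->
      \sum_(k < (2 ^ j).*2) x k * v ^+ k = E w + v * O w.
    move=> hv; rewrite (sum_even_odd _ (fun k => x k * v ^+ k)); congr (_ + _).
      by apply: eq_bigr => k _; rewrite -mul2n exprM hv.
    rewrite mulr_sumr; apply: eq_bigr => k _.
    by rewrite exprS -mul2n exprM hv; ring.
  rewrite (split2 (sq w)) // (split2 (- sq w)) ?sqrrN //.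
  rewrite !sqnD mulNr sqnN sqnM (h _ hw) mul1r.
  have -> : cdot (E w) (- (sq w * O w)) = - cdot (E w) (sq w * O w).
    by case: (E w) (sq w * O w) => [a b] [c d]; rewrite /cdot /=; ring.
  by ring.
rewrite -mulr_sumr big_split /= (h2 (fun k => x k.*2)) (h2 (fun k => x k.*2.+1)).
rewrite (sum_even_odd _ (fun k => sqn (x k))) -mulrDr mulrA -natrM mul2n.
by [].
Qed.

Lemma exists_ge_average (T : eqType) (s : seq T) (F : T -> R) (c : R) : s != [::] ->
  (size s)%:R * c <= \sum_(w <- s) F w -> exists2 w, w \in s & c <= F w.
Proof.
elim: s => [//|w s IH] _; rewrite big_cons /= -natr1 mulrDl mul1r => h.
have [hw|hw] := leP c (F w); first by exists w; rewrite ?mem_head.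
have [s0|s0] := eqVneq s [::].
  by move: h; rewrite s0 big_nil /= mul0r; lra.
have [|v vs hv] := IH s0; first by lra.
by exists v; rewrite ?inE ?vs ?orbT.
Qed.

(** Parseval in each coefficient makes the average over [Om] equal to the sum of the squared norms,
    so some w reaches it. Choosing w takes the place of orthogonality of the y_k. *)
Lemma exists_unimodular_bnorm_ge j (y : nat -> {poly C}) : exists2 w : C, sqn w = 1 &
  \sum_(k < 2 ^ j) bnorm (y k) <= bnorm (\sum_(k < 2 ^ j) w ^+ k *: y k).
Proof.
have [Om [sz h1 h2]] := unimodular_parseval j.
pose M := \max_(k < 2 ^ j) size (y k).
have hM (k : 'I_(2 ^ j)) : (size (y k) <= M)%N by apply: (@leq_bigmax _ (fun k : 'I_(2 ^ j) => size (y k)) k).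
have E : \sum_(w <- Om) bnorm (\sum_(k < 2 ^ j) w ^+ k *: y k) =
   (2 ^ j)%:R * \sum_(k < 2 ^ j) bnorm (y k).
  have e1 w : bnorm (\sum_(k < 2 ^ j) w ^+ k *: y k) =
     \sum_(n < M) sqn (\sum_(k < 2 ^ j) (y k)`_n * w ^+ k) / n.+1%:R.
    rewrite (@bnormE _ M); last first.
      apply: (leq_trans (size_sum _ _ _)); apply/bigmax_leqP => k _.
      exact: (leq_trans (size_scale_leq _ _)).
    apply: eq_bigr => n _; congr (sqn _ / _); rewrite coef_sum.
    by apply: eq_bigr => k _; rewrite coefZ mulrC.
  under eq_bigr => w _ do rewrite e1.
  under [in RHS]eq_bigr => k _ do rewrite (@bnormE _ M) //.
  rewrite exchange_big [in RHS]exchange_big /= mulr_sumr; apply: eq_bigr => n _.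
  by rewrite -!mulr_suml (h2 (fun k => (y k)`_n)) mulrA.
have Om0 : Om != [::] by rewrite -size_eq0 sz -lt0n expn_gt0.
have [|w wO hw] := exists_ge_average Om0 (F := fun w => bnorm (\sum_(k < 2 ^ j) w ^+ k *: y k))
  (c := \sum_(k < 2 ^ j) bnorm (y k)); first by rewrite E sz.
by exists w => //; exact: h1.
Qed.

End Parseval.

(** * Near-minimisers of expansive hyponormal operators *)

Section NearIsometry.
Variable R : realType.
Local Notation C := R[i].
Variables (T A : {linear {poly C} -> {poly C}}) (M c : R).
Hypothesis TA : forall f g, ip (T f) g = ip f (A g).
Hypothesis leTA : forall f, bnorm (T f) <= bnorm (A f).
Hypothesis M_gt0 : 0 < M.
Hypothesis leA : forall f, bnorm (A f) <= M * bnorm f.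
Hypothesis c_gt0 : 0 < c.
Hypothesis lowA : forall w f, sqn w = 1 -> c * bnorm f <= bnorm (A f - w *: f).
Hypothesis ge1T : forall f, bnorm f <= bnorm (T f).

(** A positive self-adjoint operator; its quadratic form |T f|^2 - |f|^2 measures how far T is from
    isometric at f. *)
Let Q f := A (T f) - f.

Let ATE f : A (T f) = f + Q f. Proof. by rewrite /Q addrC subrK. Qed.

Let QD f g : Q (f + g) = Q f + Q g.
Proof. by rewrite /Q !linearD addrACA. Qed.

Let QR (r : R) f : Q (r%:C%C *: f) = r%:C%C *: Q f.
Proof. by rewrite /Q !linearZ /= -scalerDr. Qed.

Let ipQC f g : ip (Q f) g = ip f (Q g).
Proof. by rewrite /Q ipDl ipNl ipDr ipC -TA ipC TA (ipC f (- g)) ipNl (ipC g). Qed.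

Let ipQ f : ip (Q f) f = bnorm (T f) - bnorm f.
Proof. by rewrite ipQC /Q ipDr -TA (ipC f (- f)) ipNl. Qed.

(** A form with 0 <= Q <= M satisfies Q^2 <= M Q: test positivity on f - Q f / M. The upper bound Q
    <= M comes from [leTA] and [leA]. *)
Let bnormQ f : bnorm (Q f) <= M * (bnorm (T f) - bnorm f).
Proof.
pose t := - M^-1; pose g := f + t%:C%C *: Q f.
have g0 : 0 <= ip (Q g) g by rewrite ipQ subr_ge0.
have h : ip (Q (Q f)) (Q f) <= M * bnorm (Q f).
  rewrite ipQ lerBlDr (le_trans (leTA _)) // (le_trans (leA _)) //.
  by rewrite lerDl bnorm_ge0.
have e : ip (Q g) g = ip (Q f) f + 2 * t * bnorm (Q f) + t ^+ 2 * ip (Q (Q f)) (Q f).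
  have e0 : ip (Q (Q f)) f = bnorm (Q f) by rewrite ipQC.
  by rewrite /g QD QR (ipDl (Q f)) !(ipDr _ f) !(ipRl, ipRr) e0 -!/(bnorm (Q f)); ring.
move: g0; rewrite e -ipQ => g0.
have h2 : t ^+ 2 * ip (Q (Q f)) (Q f) <= t ^+ 2 * (M * bnorm (Q f)).
  by rewrite ler_wpM2l ?sqr_ge0.
have h3 : t ^+ 2 * (M * bnorm (Q f)) = M^-1 * bnorm (Q f).
  by rewrite /t; field; rewrite gt_eqF.
rewrite -ler_pdivrMl // mulrC; move: g0 h2; rewrite h3 /t; lra.
Qed.

Let near (e : R) h := bnorm (T h) <= (1 + e) * bnorm h.

(** For a near-minimiser, A T h = h + Q h with Q h small. Hyponormality at T h bounds |T T h| by |A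
    T h|, which is close to |h| and so at most slightly above |T h|. *)
Let near_step (e : R) : 0 < e -> exists2 d : R, 0 < d & forall h, near d h -> near e (T h).
Proof.
move=> e0.
have e2 : 0 < e / 2 by rewrite divr_gt0.
have k0 : 0 < (1 + (e / 2)^-1) * M by rewrite mulr_gt0 // addr_gt0 ?invr_gt0.
have [d d0 dE] : exists2 d : R, 0 < d & (1 + (e / 2)^-1) * M * d = e / 2.
  exists (e / 2 / ((1 + (e / 2)^-1) * M)); first by rewrite divr_gt0.
  by rewrite mulrC divfK // gt_eqF.
exists d => // h hh; rewrite /near.
apply: (le_trans (leTA _)); rewrite ATE.
apply: (le_trans (bnormD_le _ _ e2)).
have h1 : bnorm (Q h) <= M * (d * bnorm h).
  apply: (le_trans (bnormQ _)); apply: ler_wpM2l; first exact: ltW.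
  by move: hh; rewrite /near; lra.
apply: (@le_trans _ _ ((1 + e) * bnorm h)); last first.
  by rewrite ler_wpM2l // ?ge1T // addr_ge0 // ltW.
have h2 : (1 + (e / 2)^-1) * bnorm (Q h) <= (1 + (e / 2)^-1) * (M * (d * bnorm h)).
  by rewrite ler_wpM2l // addr_ge0 // invr_ge0 ltW.
have h3 : (1 + (e / 2)^-1) * (M * (d * bnorm h)) = e / 2 * bnorm h.
  by rewrite !mulrA dE.
by move: h2; rewrite h3; lra.
Qed.

Let near_iter K (e : R) : 0 < e -> exists2 d : R, 0 < d &
  forall h, near d h -> forall k, (k <= K)%N -> near e (iter k T h).
Proof.
elim: K e => [|K IH] e e0.
  by exists e => // h hh k; rewrite leqn0 => /eqP ->.
have [d d0 hd] := near_step e0.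
have [|d' d'0 hd'] := IH (Num.min d e); first by rewrite lt_min d0 e0.
have le_near a b h : a <= b -> near a h -> near b h.
  by move=> ab; rewrite /near => /le_trans; apply; rewrite ler_wpM2r ?bnorm_ge0 // lerD2l.
exists d' => // h hh k; rewrite leq_eqVlt => /orP[/eqP ->|].
  by rewrite iterS; apply: hd; apply: le_near (hd' h hh K (leqnn _)); rewrite ge_min lexx.
by rewrite ltnS => /(hd' h hh); apply: le_near; rewrite ge_min lexx orbT.
Qed.

(** Let u be the sum of w^k T^k h for k <= K. Up to small defects A lowers each power by one, so A u
    - w u telescopes to two boundary terms whose size does not depend on K. A suitable w gives |u|^2
    >= (K+1) |h|^2, which contradicts [lowA] for large K. *)
Lemma near_isometry_absurd :
  (forall e : R, 0 < e -> exists2 h, h != 0 & bnorm (T h) <= (1 + e) * bnorm h) -> False.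
Proof.
move=> inf1.
(* In units of |h|^2, the boundary terms contribute 4 M + 8 and the accumulated defects 2. *)
pose B := 4 * M + 10.
have [j hj] : exists j, B < c * (2 ^ j)%:R.
  exists (Num.truncn (B / c)).+1.
  rewrite mulrC -ltr_pdivrMr //; apply: (lt_le_trans (truncnS_gt _)).
  by rewrite ler_nat ltnW // ltn_expl.
case E : (2 ^ j)%N => [|K]; first by have := expn_gt0 2 j; rewrite E.
(* Two needs are met: 2 e <= 1/(K+1) lets the squared norm at most double over K+1 steps, and 2 M e
   (K+1)^2 <= 1 keeps the sum of the defects below |h|^2. *)
pose e : R := (2 * (M + 1) * K.+1%:R ^+ 2)^-1.
have e0 : 0 < e by rewrite invr_gt0 !mulr_gt0 ?exprn_gt0 // addr_gt0.
have [d d0 hd] := near_iter K e0.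
have [h h0 hh] := inf1 d d0.
have {}hd := hd h hh.
pose b := bnorm h; have b0 : 0 < b by exact: bnorm_gt0.
pose y k := iter k T h.
have k0 : 0 < K.+1%:R :> R by rewrite ltr0n.
have k1 : 1 <= K.+1%:R :> R by rewrite ler1n.
have eM : 2 * M * e * K.+1%:R ^+ 2 <= 1.
  rewrite /e -[leRHS](divff (_ : (M + 1) != 0)); last by rewrite gt_eqF // addr_gt0.
  have -> : 2 * M * (2 * (M + 1) * K.+1%:R ^+ 2)^-1 * K.+1%:R ^+ 2 = M / (M + 1).
    by field; rewrite natr1_neq0 gt_eqF // addr_gt0.
  by rewrite ler_pM2r ?invr_gt0 ?addr_gt0 // lerDl.
have eK : 2 * e <= K.+1%:R^-1.
  rewrite /e.
  have -> : 2 * (2 * (M + 1) * K.+1%:R ^+ 2)^-1 = K.+1%:R^-1 * ((M + 1) * K.+1%:R)^-1.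
    by field; rewrite natr1_neq0 gt_eqF // addr_gt0.
  apply: ler_piMr; first by rewrite invr_ge0 ler0n.
  rewrite invf_le1 ?mulr_gt0 ?addr_gt0 //.
  by apply: mulr_ege1 => //; rewrite lerDr ltW.
clearbody e.
have yb k : (k <= K.+1)%N -> bnorm (y k) <= (1 + k%:R / K.+1%:R) * b.
  elim: k => [|k IH] hk; first by rewrite mul0r addr0 mul1r.
  have := hd k hk; rewrite /near -iterS -!/(y _) => /le_trans; apply.
  have h1 : bnorm (y k) <= 2 * b.
    apply: (le_trans (IH (ltnW hk))); apply: ler_wpM2r; first exact: ltW.
    by rewrite -lerBrDl ler_pdivrMr // -[2 - 1](_ : 1 = _) ?mul1r ?ler_nat ?(ltnW hk) //; ring.
  have h2 : e * bnorm (y k) <= e * (2 * b) by apply: ler_wpM2l => //; exact: ltW.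
  have h3 : 2 * e * b <= K.+1%:R^-1 * b by apply: ler_wpM2r => //; exact: ltW.
  have := IH (ltnW hk); rewrite -(natr1 k) (mulrDl k%:R) mul1r; set x := k%:R / _; set z := K.+1%:R^-1 in h3 *; clearbody x z; lra.
have yb2 k : (k <= K.+1)%N -> bnorm (y k) <= 2 * b.
  move=> hk; apply: (le_trans (yb _ hk)); apply: ler_wpM2r; first exact: ltW.
  by rewrite -lerBrDl ler_pdivrMr // -[2 - 1](_ : 1 = _) ?mul1r ?ler_nat ?hk //; ring.
have by_ k : b <= bnorm (y k).
  by elim: k => [|k IH] //; rewrite (le_trans IH) // /y iterS ge1T.
have [w w1 hw] := exists_unimodular_bnorm_ge j y.
rewrite E in hj hw; set u := \sum_(k < K.+1) w ^+ k *: y k in hw.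
pose s := \sum_(k < K) w ^+ k *: Q (y k).
have Au : A u - w *: u = (A h - w ^+ K.+1 *: y K) + w *: s.
  have -> : A u = A h + w *: (\sum_(k < K) w ^+ k *: y k) + w *: s.
    rewrite /u big_ord_recl /= expr0 scale1r linearD /= -/(y 0%N) -addrA; congr (_ + _).
    rewrite -scalerDr /s -big_split /= linear_sum scaler_sumr; apply: eq_bigr => k _ /=.
    by rewrite linearZ /= /bump /= add1n exprS -scalerA -scalerDr ATE.
  rewrite /u big_ord_recr /= scalerDr scalerA -exprS opprD addrACA.
  by rewrite addrK (addrC (w *: s)) addrA.
have bQ k : (k < K)%N -> bnorm (Q (y k)) <= 2 * M * e * b.
  move=> hk; apply: (le_trans (bnormQ _)).
  have h1 : bnorm (T (y k)) - bnorm (y k) <= e * bnorm (y k).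
    by have := hd k (ltnW hk); rewrite /near -/(y k); lra.
  have h2 : e * bnorm (y k) <= e * (2 * b) by apply: ler_wpM2l; [exact: ltW|apply: yb2; exact: leqW (ltnW hk)].
  have -> : 2 * M * e * b = M * (e * (2 * b)) by ring.
  by apply: ler_wpM2l; [exact: ltW|lra].
have bs : bnorm (w *: s) <= b.
  rewrite bnormZ w1 mul1r /s.
  apply: (le_trans (bnorm_sum _)).
  have -> : \sum_(k < K) bnorm (w ^+ k *: Q (y k)) = \sum_(k < K) bnorm (Q (y k)).
    by apply: eq_bigr => k _; rewrite bnormZ sqnX w1 expr1n mul1r.
  apply: (@le_trans _ _ (K%:R * (\sum_(k < K) 2 * M * e * b))).
    by rewrite ler_wpM2l ?ler0n // ler_sum // => k _; exact: bQ.
  rewrite sumr_const card_ord -(mulr_natl (2 * M * e * b)) mulrA.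
  have hKK : K%:R * K%:R <= K.+1%:R ^+ 2 :> R by rewrite expr2 -!natrM ler_nat leq_mul.
  apply: (@le_trans _ _ (K.+1%:R ^+ 2 * (2 * M * e * b))).
    by rewrite ler_wpM2r // !mulr_ge0 ?ltW.
  have -> : K.+1%:R ^+ 2 * (2 * M * e * b) = 2 * M * e * K.+1%:R ^+ 2 * b by ring.
  by rewrite ler_piMl // ltW.
have h1 : c * (K.+1%:R * b) <= B * b.
  apply: (@le_trans _ _ (bnorm (A u - w *: u))).
    apply: (le_trans _ (lowA _ w1)); apply: ler_wpM2l; [exact: ltW|apply: le_trans hw].
    rewrite mulr_natl -[X in b *+ X]card_ord -sumr_const.
    by apply: ler_sum => k _; exact: by_.
  rewrite Au; apply: (le_trans (bnormD2 _ _)).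
  have := bnormD2 (A h) (- (w ^+ K.+1 *: y K)); rewrite bnormN (bnormZ (w ^+ K.+1)) sqnX w1 expr1n mul1r.
  by have := leA h; have := yb2 K (leqnSn _); rewrite -/b /B; lra.
by move: h1; rewrite mulrA ler_pM2r // leNgt hj.
Qed.

End NearIsometry.

Section NormcLemmas.
Variable R : realType.
Local Notation C := R[i].
Implicit Types x y z : C.

Lemma normc_le_sqn x (r : R) : 0 <= r -> (normc x <= r) = (sqn x <= r ^+ 2).
Proof. by move=> r0; rewrite -sqr_normc_sqn ler_sqr // nnegrE normc_ge0. Qed.

Lemma normc_lt_sqn x (r : R) : 0 <= r -> (normc x < r) = (sqn x < r ^+ 2).
Proof. by move=> r0; rewrite -sqr_normc_sqn ltr_sqr // nnegrE normc_ge0. Qed.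

Lemma normc_ge_sqn x (r : R) : 0 <= r -> (r <= normc x) = (r ^+ 2 <= sqn x).
Proof. by move=> r0; rewrite -sqr_normc_sqn ler_sqr // nnegrE normc_ge0. Qed.

Lemma normcB_ge x y : normc x - normc y <= normc (x - y).
Proof. by rewrite lerBlDr -{1}(subrK y x) le_normcD. Qed.

Lemma normc_real (r : R) : normc r%:C%C = `|r|.
Proof. by rewrite normc_sqn sqn_real sqrtr_sqr. Qed.

Lemma normc_conj x : normc (conjc x) = normc x.
Proof. by rewrite !normc_sqn sqn_conj. Qed.

Lemma normc_sum I (s : seq I) (P : pred I) (F : I -> C) :
  normc (\sum_(i <- s | P i) F i) <= \sum_(i <- s | P i) normc (F i).
Proof.
apply: (big_ind2 (fun (a : C) (b : R) => normc a <= b)) => //; first by rewrite normc0.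
by move=> a b c d h1 h2; rewrite (le_trans (le_normcD _ _)) // lerD.
Qed.

Lemma normcX x n : normc (x ^+ n) = normc x ^+ n.
Proof. by elim: n => [|n IH]; rewrite ?expr0 ?normc1 // !exprS normcM IH. Qed.

Lemma disc_scale (s : R) z : 0 <= s <= 1 -> sqn z < 1 -> sqn (s%:C%C * z) < 1.
Proof.
move=> /andP[s0 s1] z1; rewrite sqnM sqn_real (le_lt_trans _ z1) //.
by rewrite ler_piMl ?sqn_ge0 // expr_le1.
Qed.

End NormcLemmas.

Lemma Re_sum (R : realType) I (s : seq I) (Q : pred I) (f : I -> R[i]) :
  complex.Re (\sum_(i <- s | Q i) f i) = \sum_(i <- s | Q i) complex.Re (f i).
Proof. by apply: (big_morph (@complex.Re R)) => // -[? ?] []. Qed.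

Lemma Im_sum (R : realType) I (s : seq I) (Q : pred I) (f : I -> R[i]) :
  complex.Im (\sum_(i <- s | Q i) f i) = \sum_(i <- s | Q i) complex.Im (f i).
Proof. by apply: (big_morph (@complex.Im R)) => // -[? ?] []. Qed.

Lemma Re_sub (R : realType) (x y : R[i]) : complex.Re (x - y) = complex.Re x - complex.Re y.
Proof. by case: x y => [? ?] []. Qed.

Lemma Im_sub (R : realType) (x y : R[i]) : complex.Im (x - y) = complex.Im x - complex.Im y.
Proof. by case: x y => [? ?] []. Qed.

(** * Complex integrals and moments of the disc *)

Section ComplexIntegral.
Context d (T : measurableType d) (R : realType).
Variable mu : {measure set T -> \bar R}.
Local Notation C := R[i].
Implicit Types (D : set T) (F G : T -> C).

Definition cmeasurable D F :=
  measurable_fun D (fun x => complex.Re (F x)) /\ measurable_fun D (fun x => complex.Im (F x)).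

Definition cintegrable D F :=
  mu.-integrable D (fun x => (complex.Re (F x))%:E) /\
  mu.-integrable D (fun x => (complex.Im (F x))%:E).

Definition cint D F : C :=
  (Rintegral mu D (fun x => complex.Re (F x)) +i* Rintegral mu D (fun x => complex.Im (F x)))%C.

Lemma normr_Re_le (x : C) : `|complex.Re x| <= normc x.
Proof.
by case: x => a b; rewrite normc_sqn /sqn /cdot /= -sqrtr_sqr ler_wsqrtr // -!expr2 lerDl sqr_ge0.
Qed.

Lemma normr_Im_le (x : C) : `|complex.Im x| <= normc x.
Proof.
by case: x => a b; rewrite normc_sqn /sqn /cdot /= -sqrtr_sqr ler_wsqrtr // -!expr2 lerDr sqr_ge0.
Qed.

Lemma normc_le_ReIm (x : C) : normc x <= `|complex.Re x| + `|complex.Im x|.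
Proof.
rewrite normc_le_sqn ?addr_ge0 // /sqn /cdot -!expr2 sqrrD !real_normK ?num_real //.
have : 0 <= `|complex.Re x| * `|complex.Im x| by rewrite mulr_ge0.
by lra.
Qed.

Lemma cmeasurable_cst D c : cmeasurable D (fun=> c).
Proof. by split; exact: measurable_cst. Qed.

Lemma cmeasurableD D F G : cmeasurable D F -> cmeasurable D G ->
  cmeasurable D (fun x => F x + G x).
Proof.
move=> [f1 f2] [g1 g2]; split.
- rewrite (_ : (fun x => _) = (fun x => complex.Re (F x) + complex.Re (G x))).
    exact: measurable_funD.
  by apply/funext => x; case: (F x) (G x) => [? ?] [].
- rewrite (_ : (fun x => _) = (fun x => complex.Im (F x) + complex.Im (G x))).
    exact: measurable_funD.
  by apply/funext => x; case: (F x) (G x) => [? ?] [].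
Qed.

Lemma cmeasurableM D F G : cmeasurable D F -> cmeasurable D G ->
  cmeasurable D (fun x => F x * G x).
Proof.
move=> [f1 f2] [g1 g2]; split.
- rewrite (_ : (fun x => _) = (fun x => complex.Re (F x) * complex.Re (G x) - complex.Im (F x) * complex.Im (G x))).
    by apply: measurable_funB; apply: measurable_funM.
  by apply/funext => x; case: (F x) (G x) => [? ?] [].
- rewrite (_ : (fun x => _) = (fun x => complex.Re (F x) * complex.Im (G x) + complex.Im (F x) * complex.Re (G x))).
    by apply: measurable_funD; apply: measurable_funM.
  by apply/funext => x; case: (F x) (G x) => [? ?] [].
Qed.

Lemma cmeasurable_conj D F : cmeasurable D F -> cmeasurable D (fun x => conjc (F x)).
Proof.
move=> [f1 f2]; split.
- by rewrite (_ : (fun x => _) = (fun x => complex.Re (F x))) //; apply/funext => x; case: (F x).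
- rewrite (_ : (fun x => _) = (fun x => - complex.Im (F x))); first exact: measurable_funN.
  by apply/funext => x; case: (F x).
Qed.

Lemma measurable_sqn D F : cmeasurable D F -> measurable_fun D (fun x => sqn (F x)).
Proof.
move=> [f1 f2]; rewrite /sqn /cdot.
by apply: measurable_funD; apply: measurable_funM.
Qed.

Lemma measurable_normc D F : cmeasurable D F -> measurable_fun D (fun x => normc (F x)).
Proof.
move=> mF; rewrite (_ : (fun x => _) = Num.sqrt \o (fun x => sqn (F x))).
  by apply: measurableT_comp; [apply: continuous_measurable_fun; exact: sqrt_continuous|exact: measurable_sqn].
by apply/funext => x; rewrite /= normc_sqn.
Qed.

Lemma cintegrable_normc D F : measurable D -> cmeasurable D F ->
  mu.-integrable D (fun x => (normc (F x))%:E) -> cintegrable D F.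
Proof.
move=> mD [f1 f2] iF; split; apply: le_integrable iF => //.
- exact/measurable_EFinP.
- by move=> x _; rewrite /= lee_fin [leRHS]ger0_norm ?normc_ge0 // normr_Re_le.
- exact/measurable_EFinP.
- by move=> x _; rewrite /= lee_fin [leRHS]ger0_norm ?normc_ge0 // normr_Im_le.
Qed.

Lemma integrable_normc D F : measurable D -> cintegrable D F ->
  mu.-integrable D (fun x => (normc (F x))%:E).
Proof.
move=> mD [iR iI].
have mF : cmeasurable D F.
  by split; apply/measurable_EFinP; [case/integrableP : iR|case/integrableP : iI].
have := integrableD mD (integrable_abse iR) (integrable_abse iI).
apply: le_integrable => //; first by apply/measurable_EFinP; exact: measurable_normc.
move=> x _ /=; rewrite lee_fin [leLHS]ger0_norm ?normc_ge0 // ger0_norm ?addr_ge0 //.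
exact: normc_le_ReIm.
Qed.

Lemma cintegrable_bounded D F (M : R) : measurable D -> (mu D < +oo)%E -> cmeasurable D F ->
  (forall x, D x -> normc (F x) <= M) -> cintegrable D F.
Proof.
move=> mD fD [f1 f2] hM; split; apply: measurable_bounded_integrable => //.
- exists M; split; rewrite ?num_real // => y My x Dx; apply: (le_trans (normr_Re_le _)).
  exact: le_trans (hM _ Dx) (ltW My).
- exists M; split; rewrite ?num_real // => y My x Dx; apply: (le_trans (normr_Im_le _)).
  exact: le_trans (hM _ Dx) (ltW My).
Qed.

Lemma eq_cint D F G : (forall x, D x -> F x = G x) -> cint D F = cint D G.
Proof.
move=> e; congr Complex; apply: eq_Rintegral => x /set_mem Dx; by rewrite e.
Qed.

Lemma cintegrableD D F G : measurable D -> cintegrable D F -> cintegrable D G ->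
  cintegrable D (fun x => F x + G x).
Proof.
move=> mD [f1 f2] [g1 g2]; split.
- rewrite (_ : (fun x => _) = (fun x => (complex.Re (F x))%:E + (complex.Re (G x))%:E)%E).
    exact: integrableD.
  by apply/funext => x; case: (F x) (G x) => [? ?] [].
- rewrite (_ : (fun x => _) = (fun x => (complex.Im (F x))%:E + (complex.Im (G x))%:E)%E).
    exact: integrableD.
  by apply/funext => x; case: (F x) (G x) => [? ?] [].
Qed.

Lemma cintD D F G : measurable D -> cintegrable D F -> cintegrable D G ->
  cint D (fun x => F x + G x) = cint D F + cint D G.
Proof.
move=> mD [f1 f2] [g1 g2]; rewrite /cint.
have -> : (fun x => complex.Re (F x + G x)) = (fun x => complex.Re (F x) + complex.Re (G x)).
  by apply/funext => x; case: (F x) (G x) => [? ?] [].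
have -> : (fun x => complex.Im (F x + G x)) = (fun x => complex.Im (F x) + complex.Im (G x)).
  by apply/funext => x; case: (F x) (G x) => [? ?] [].
by rewrite !RintegralD.
Qed.

Lemma cintegrableZ D F c : measurable D -> cintegrable D F -> cintegrable D (fun x => c * F x).
Proof.
move=> mD iF; have iN := integrable_normc mD iF.
have mF : cmeasurable D F.
  by case: iF => iR iI; split; apply/measurable_EFinP; [case/integrableP : iR|case/integrableP : iI].
apply: cintegrable_normc => //; first by apply: cmeasurableM => //; exact: cmeasurable_cst.
rewrite (_ : (fun x => _) = (fun x => ((normc c)%:E * (normc (F x))%:E)%E)).
  exact: integrableZl.
by apply/funext => x; rewrite normcM EFinM.
Qed.

Lemma cintZ D F c : measurable D -> cintegrable D F -> cint D (fun x => c * F x) = c * cint D F.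
Proof.
move=> mD [iR iI]; case: c => a b; rewrite /cint /=.
have iR' (r : R) : mu.-integrable D (EFin \o (fun x => r * complex.Re (F x))).
  by rewrite (_ : _ \o _ = (fun x => (r%:E * (complex.Re (F x))%:E)%E)) //; exact: integrableZl.
have iI' (r : R) : mu.-integrable D (EFin \o (fun x => r * complex.Im (F x))).
  by rewrite (_ : _ \o _ = (fun x => (r%:E * (complex.Im (F x))%:E)%E)) //; exact: integrableZl.
have -> : (fun x => complex.Re ((a +i* b)%C * F x)) =
    (fun x => a * complex.Re (F x) - b * complex.Im (F x)).
  by apply/funext => x; case: (F x).
have -> : (fun x => complex.Im ((a +i* b)%C * F x)) =
    (fun x => a * complex.Im (F x) + b * complex.Re (F x)).
  by apply/funext => x; case: (F x).
by rewrite RintegralB // RintegralD // !RintegralZl.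
Qed.

Lemma cint0 D : cint D (fun=> 0) = 0.
Proof. by rewrite /cint /Rintegral !integral0. Qed.

Lemma cintegrable0 D : cintegrable D (fun=> 0).
Proof. by split; exact: integrable0. Qed.

Lemma cintegrable_sum D n (F : nat -> T -> C) : measurable D ->
  (forall i, cintegrable D (F i)) -> cintegrable D (fun x => \sum_(i < n) F i x).
Proof.
move=> mD mF; elim: n => [|n IH].
  rewrite (_ : (fun x => _) = (fun=> 0)); first exact: cintegrable0.
  by apply/funext => x; rewrite big_ord0.
rewrite (_ : (fun x => _) = (fun x => \sum_(i < n) F i x + F n x)); first exact: cintegrableD.
by apply/funext => x; rewrite big_ord_recr.
Qed.

Lemma cint_sum D n (F : nat -> T -> C) : measurable D ->
  (forall i, cintegrable D (F i)) ->
  cint D (fun x => \sum_(i < n) F i x) = \sum_(i < n) cint D (F i).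
Proof.
move=> mD iF; elim: n => [|n IH].
  by rewrite big_ord0 -[RHS](cint0 D); apply: eq_cint => x _; rewrite big_ord0.
rewrite big_ord_recr /= -IH -cintD //; last exact: cintegrable_sum.
by apply: eq_cint => x _; rewrite big_ord_recr.
Qed.

(** Real and imaginary parts are bounded separately, whence the factor 2. The estimate only serves
    limits, where a constant factor is harmless. *)
Lemma normc_cint_le D F : measurable D -> cintegrable D F ->
  normc (cint D F) <= 2 * Rintegral mu D (fun x => normc (F x)).
Proof.
move=> mD iF; have iN := integrable_normc mD iF; case: iF => iR iI.
apply: (le_trans (normc_le_ReIm _)); rewrite /= mulr_natl mulr2n lerD //.
- apply: (le_trans (le_normr_Rintegral mD iR)).
  by apply: le_Rintegral => //; [exact: integrable_norm|move=> x _; exact: normr_Re_le].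
- apply: (le_trans (le_normr_Rintegral mD iI)).
  by apply: le_Rintegral => //; [exact: integrable_norm|move=> x _; exact: normr_Im_le].
Qed.

End ComplexIntegral.

(** * Integration over discs centred at 0 *)

Section DiscMoments.
Variable R : realType.
Local Notation C := R[i].
Local Notation mu := (@lebesgue_measure R).
Local Notation plane := (measurableTypeR R * measurableTypeR R)%type.
Local Notation lam2 := ((@lebesgue_measure R) \x (@lebesgue_measure R))%E.
Implicit Types (F G : plane -> C) (r : R).

Definition drad r : set plane := [set p | p.1 ^+ 2 + p.2 ^+ 2 < r ^+ 2].

Lemma sqn_toC (p : plane) : sqn (toC p : C) = p.1 ^+ 2 + p.2 ^+ 2.
Proof. by rewrite /sqn /cdot /= -!expr2. Qed.

Lemma measurable_drad r : measurable (drad r).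
Proof.
rewrite (_ : drad r = setT `&` (fun p : plane => p.1 ^+ 2 + p.2 ^+ 2) @^-1` `]-oo, (r ^+ 2)[%classic).
  apply: (_ : measurable_fun setT _) => //.
  by apply: measurable_funD; apply: measurable_funX; [exact: measurable_fst|exact: measurable_snd].
by rewrite setTI; apply/seteqP; split => p /=; rewrite in_itv.
Qed.

Lemma drad_lty r : (lam2 (drad r) < +oo)%E.
Proof.
pose I := `[- `|r|, `|r|]%classic : set (measurableTypeR R).
apply: (@le_lt_trans _ _ (lam2 (I `*` I))).
  apply: le_measure; rewrite ?inE; first exact: measurable_drad.
    by apply: measurableX; exact: measurable_itv.
  move=> p; rewrite /drad /= => h.
  have h1 := sqr_ge0 p.1; have h2 := sqr_ge0 p.2.
  split; rewrite /I /= in_itv /= -ler_norml -ler_sqr ?nnegrE // !real_normK ?num_real //; lra.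
rewrite product_measure1E; try exact: measurable_itv.
have fI : (mu I < +oo)%E.
  rewrite /I lebesgue_measure_itv /=; case: ifP => // _.
  by rewrite -EFinB ltry.
by apply: lte_mul_pinfty => //; rewrite ge0_fin_numE.
Qed.

Lemma cmeasurable_toC (D : set plane) : cmeasurable D (@toC R : plane -> C).
Proof.
split; apply: measurable_funTS; [exact: measurable_fst|exact: measurable_snd].
Qed.

(** Bounded measurable functions form an algebra stable under conjugation, and on a disc they are
    integrable without further argument. *)
Definition bmf r F := cmeasurable (drad r) F /\
  exists M : R, forall p, drad r p -> normc (F p) <= M.

Lemma bmf_cintegrable r F : bmf r F -> cintegrable lam2 (drad r) F.
Proof.
move=> [mF [M hM]]; apply: (cintegrable_bounded _ _ mF hM); first exact: measurable_drad.
exact: drad_lty.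
Qed.

Lemma bmfD r F G : bmf r F -> bmf r G -> bmf r (fun p => F p + G p).
Proof.
move=> [mF [M hM]] [mG [N hN]]; split; first exact: cmeasurableD.
by exists (M + N) => p Dp; rewrite (le_trans (le_normcD _ _)) // lerD ?hM ?hN.
Qed.

Lemma bmfM r F G : bmf r F -> bmf r G -> bmf r (fun p => F p * G p).
Proof.
move=> [mF [M hM]] [mG [N hN]]; split; first exact: cmeasurableM.
by exists (M * N) => p Dp; rewrite normcM ler_pM ?normc_ge0 ?hM ?hN.
Qed.

Lemma bmf_cst r c : bmf r (fun=> c).
Proof. by split; [exact: cmeasurable_cst|exists (normc c)]. Qed.

Lemma bmfX r F n : bmf r F -> bmf r (fun p => F p ^+ n).
Proof.
move=> bF; elim: n => [|n IH].
  by rewrite (_ : (fun p => _) = (fun=> 1)); [exact: bmf_cst|apply/funext => p; rewrite expr0].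
rewrite (_ : (fun p => _) = (fun p => F p * F p ^+ n)); first exact: bmfM.
by apply/funext => p; rewrite exprS.
Qed.

Lemma bmf_toC r : bmf r (@toC R : plane -> C).
Proof.
split; first exact: cmeasurable_toC.
exists `|r| => p Dp; rewrite normc_le_sqn // real_normK ?num_real // sqn_toC.
exact: ltW.
Qed.

Lemma bmf_conj r F : bmf r F -> bmf r (fun p => conjc (F p)).
Proof.
move=> [mF [M hM]]; split; first exact: cmeasurable_conj.
by exists M => p Dp; rewrite normc_conj hM.
Qed.

(** On the real line it gives the real part of P, which makes the real fundamental theorem of
    calculus available for complex polynomials. *)
Definition repoly (P : {poly C}) : {poly R} := \poly_(i < size P) complex.Re P`_i.

Lemma horner_repoly P x : (repoly P).[x] = complex.Re P.[x%:C%C].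
Proof.
rewrite horner_poly horner_coef Re_sum; apply: eq_bigr => i _.
by rewrite -rmorphXn; case: (P`_i) => a b /=; rewrite mulr0 subr0.
Qed.

Lemma coef_repoly P i : (repoly P)`_i = complex.Re P`_i.
Proof. by rewrite coef_poly; case: ltnP => // h; rewrite nth_default. Qed.

Lemma deriv_repoly P : (repoly P)^`() = repoly P^`().
Proof.
apply/polyP => i; rewrite coef_deriv !coef_repoly coef_deriv.
move: (P`_i.+1) => c; move: (i.+1) => n; elim: n => [|n IH]; rewrite ?mulr0n // !mulrS IH.
by case: c (c *+ n) {IH} => [? ?] [].
Qed.

Lemma integral_deriv_repoly P (w : R) : 0 < w ->
  (\int[mu]_(x in `](- w)%R, w[) (complex.Re P^`().[x%:C%C])%R%:E =
   (complex.Re P.[w%:C%C] - complex.Re P.[(- w)%:C%C])%R%:E)%E.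
Proof.
move=> w0.
rewrite -(@integral_itv_bndoo _ (- w) w (fun x => (complex.Re P^`().[x%:C%C])%:E) true false).
  rewrite -!horner_repoly EFinB -(@continuous_FTC2 _ (fun x => complex.Re P^`().[x%:C%C])
    (horner (repoly P))) //; first by lra.
  - rewrite (_ : (fun x => _) = horner (repoly P^`())); last first.
      by apply/funext => x; rewrite horner_repoly.
    by apply: continuous_subspaceT; exact: continuous_horner.
  - split => [x _||]; first exact: derivable_horner.
      by apply: cvg_at_right_filter; exact: continuous_horner.
    by apply: cvg_at_left_filter; exact: continuous_horner.
  - by move=> x _; rewrite -derivE deriv_repoly horner_repoly.
apply/measurable_EFinP; apply: measurable_funTS.
rewrite (_ : (fun x => _) = horner (repoly P^`())); last first.
  by apply/funext => x; rewrite horner_repoly.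
by apply: continuous_measurable_fun; exact: continuous_horner.
Qed.

End DiscMoments.

(** * A recursion for the moments of the disc *)

Section DiscMomentRecursion.
Variable R : realType.
Local Notation C := R[i].
Local Notation mu := (@lebesgue_measure R).
Local Notation plane := (measurableTypeR R * measurableTypeR R)%type.
Local Notation lam2 := ((@lebesgue_measure R) \x (@lebesgue_measure R))%E.
Implicit Types (F G : plane -> C) (r : R).

Lemma section_drad r (w y x : R) : 0 < w -> w ^+ 2 = r ^+ 2 - y ^+ 2 ->
  (x ^+ 2 + y ^+ 2 < r ^+ 2) = (- w < x < w).
Proof.
move=> w0 e; rewrite -ltr_norml -[RHS]ltr_sqr ?nnegrE ?(ltW w0) // real_normK ?num_real // e.
by rewrite ltrBrDr.
Qed.

Lemma patch_drad_x r (w y : R) (f : plane -> \bar R) : 0 < w -> w ^+ 2 = r ^+ 2 - y ^+ 2 ->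
  (fun x => (f \_ (drad r)) (x, y)) = ((fun x => f (x, y)) \_ `](- w), w[%classic).
Proof.
move=> w0 e; apply/funext => x; rewrite !patchE; congr (if _ then _ else _).
by apply/idP/idP; rewrite !inE /drad /= in_itv /= (section_drad _ w0 e).
Qed.

Lemma patch_drad_y r (w x : R) (f : plane -> \bar R) : 0 < w -> w ^+ 2 = r ^+ 2 - x ^+ 2 ->
  (fun y => (f \_ (drad r)) (x, y)) = ((fun y => f (x, y)) \_ `](- w), w[%classic).
Proof.
move=> w0 e; apply/funext => y; rewrite !patchE; congr (if _ then _ else _).
by apply/idP/idP; rewrite !inE /drad /= in_itv /= addrC (section_drad _ w0 e).
Qed.

Lemma drad_section_empty r (x y : R) : (r ^+ 2 <= y ^+ 2) -> (x ^+ 2 + y ^+ 2 < r ^+ 2) = false.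
Proof. by move=> h; apply/negbTE; rewrite -leNgt (le_trans h) // lerDr sqr_ge0. Qed.

(** By Fubini, since a horizontal line meets the disc in a chord |x| < w or not at all. *)
Lemma Rintegral_drad_eq0_x r (g : plane -> R) :
  lam2.-integrable (drad r) (EFin \o g) ->
  (forall y w, 0 < w -> w ^+ 2 = r ^+ 2 - y ^+ 2 ->
     (\int[mu]_(x in `](- w)%R, w[) (g (x, y))%:E = 0)%E) ->
  Rintegral lam2 (drad r) g = 0.
Proof.
move=> ig h; rewrite /Rintegral integral_mkcond.
have ig' : lam2.-integrable setT ((EFin \o g) \_ (drad r)).
  by apply/(integrable_mkcond (EFin \o g) (measurable_drad r)).
rewrite -(integral21_prod_meas1 ig') integral0_eq // => y _.
rewrite /fubini_G; have [hy|hy] := ltP (y ^+ 2) (r ^+ 2).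
  have w0 : 0 < Num.sqrt (r ^+ 2 - y ^+ 2) by rewrite sqrtr_gt0 subr_gt0.
  have w2 : Num.sqrt (r ^+ 2 - y ^+ 2) ^+ 2 = r ^+ 2 - y ^+ 2.
    by rewrite sqr_sqrtr // subr_ge0 ltW.
  by rewrite (patch_drad_x _ w0 w2) -integral_mkcond; exact: h.
rewrite integral0_eq // => x _; rewrite patchE ifF //.
by apply/negbTE/negP; rewrite inE /drad /= drad_section_empty.
Qed.

Lemma Rintegral_drad_eq0_y r (g : plane -> R) :
  lam2.-integrable (drad r) (EFin \o g) ->
  (forall x w, 0 < w -> w ^+ 2 = r ^+ 2 - x ^+ 2 ->
     (\int[mu]_(y in `](- w)%R, w[) (g (x, y))%:E = 0)%E) ->
  Rintegral lam2 (drad r) g = 0.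
Proof.
move=> ig h; rewrite /Rintegral integral_mkcond.
have ig' : lam2.-integrable setT ((EFin \o g) \_ (drad r)).
  by apply/(integrable_mkcond (EFin \o g) (measurable_drad r)).
rewrite -(integral12_prod_meas1 ig') integral0_eq // => x _.
rewrite /fubini_F; have [hy|hy] := ltP (x ^+ 2) (r ^+ 2).
  have w0 : 0 < Num.sqrt (r ^+ 2 - x ^+ 2) by rewrite sqrtr_gt0 subr_gt0.
  have w2 : Num.sqrt (r ^+ 2 - x ^+ 2) ^+ 2 = r ^+ 2 - x ^+ 2.
    by rewrite sqr_sqrtr // subr_ge0 ltW.
  by rewrite (patch_drad_y _ w0 w2) -integral_mkcond; exact: h.
rewrite integral0_eq // => y _; rewrite patchE ifF //.
by apply/negbTE/negP; rewrite inE /drad /= addrC drad_section_empty.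
Qed.

Lemma ReNi (c : C) : complex.Re (- 'i%C * c) = complex.Im c.
Proof. by case: c => a b /=; ring. Qed.

(** On every horizontal chord G is the derivative of a polynomial in x that vanishes at both ends.
    The imaginary part of G is handled as the real part of -i G. *)
Lemma cint_deriv_eq0_x r (P : R -> {poly C}) G : bmf r G ->
  (forall x y : R, G (x, y) = (P y)^`().[x%:C%C]) ->
  (forall x y : R, x ^+ 2 + y ^+ 2 = r ^+ 2 -> (P y).[x%:C%C] = 0) ->
  cint lam2 (drad r) G = 0.
Proof.
move=> bG eG hP; have [i1 i2] := bmf_cintegrable bG.
have e0 (w y : R) : w ^+ 2 = r ^+ 2 - y ^+ 2 -> (P y).[w%:C%C] = 0 /\ (P y).[(- w)%:C%C] = 0.
  by move=> e; split; apply: hP; rewrite ?sqrrN e subrK.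
rewrite /cint (Rintegral_drad_eq0_x i1) ?(Rintegral_drad_eq0_x i2) // => y w w0 w2.
  under eq_integral => x _ do rewrite /= eG -ReNi -hornerZ -derivZ.
  have [e1 e2] := e0 w y w2.
  by rewrite (integral_deriv_repoly _ w0) !hornerZ e1 e2 mulr0 subrr.
under eq_integral => x _ do rewrite /= eG.
have [e1 e2] := e0 w y w2.
by rewrite (integral_deriv_repoly _ w0) e1 e2 subrr.
Qed.

Lemma cint_deriv_eq0_y r (P : R -> {poly C}) G : bmf r G ->
  (forall x y : R, G (x, y) = (P x)^`().[y%:C%C]) ->
  (forall x y : R, x ^+ 2 + y ^+ 2 = r ^+ 2 -> (P x).[y%:C%C] = 0) ->
  cint lam2 (drad r) G = 0.
Proof.
move=> bG eG hP; have [i1 i2] := bmf_cintegrable bG.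
have e0 (w x : R) : w ^+ 2 = r ^+ 2 - x ^+ 2 -> (P x).[w%:C%C] = 0 /\ (P x).[(- w)%:C%C] = 0.
  by move=> e; split; apply: hP; rewrite ?sqrrN e addrC subrK.
rewrite /cint (Rintegral_drad_eq0_y i1) ?(Rintegral_drad_eq0_y i2) // => x w w0 w2.
  under eq_integral => y _ do rewrite /= eG -ReNi -hornerZ -derivZ.
  have [e1 e2] := e0 w x w2.
  by rewrite (integral_deriv_repoly _ w0) !hornerZ e1 e2 mulr0 subrr.
under eq_integral => y _ do rewrite /= eG.
have [e1 e2] := e0 w x w2.
by rewrite (integral_deriv_repoly _ w0) e1 e2 subrr.
Qed.

Definition zmon (a b : nat) (p : plane) : C := (toC p : C) ^+ a * conjc (toC p : C) ^+ b.

Lemma bmf_zmon r a b : bmf r (zmon a b).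
Proof.
apply: bmfM; apply: bmfX; [exact: bmf_toC|apply: bmf_conj; exact: bmf_toC].
Qed.

Lemma toC_xE (x y : R) : (toC (x, y) : C) = x%:C%C + 'i%C * y%:C%C.
Proof. by rewrite /toC /=; apply/eqP; rewrite eq_complex /=; apply/andP; split; apply/eqP; ring. Qed.

Lemma conj_toC_xE (x y : R) : conjc (toC (x, y) : C) = x%:C%C - 'i%C * y%:C%C.
Proof. by rewrite /toC /=; apply/eqP; rewrite eq_complex /=; apply/andP; split; apply/eqP; ring. Qed.

(* The derivative of (|z|^2 - r^2) z^a conj(z)^b along the direction in which
   z moves by c1 and conj(z) by c2. *)
Definition dzmon (c1 c2 : C) r a b p : C :=
  (c1 * conjc (toC p : C) + c2 * (toC p : C)) * zmon a b p +
  ((toC p : C) * conjc (toC p : C) - (r ^+ 2)%:C%C) *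
   (c1 * (a%:R * zmon a.-1 b p) + c2 * (b%:R * zmon a b.-1 p)).

Lemma bmf_dzmon c1 c2 r a b : bmf r (dzmon c1 c2 r a b).
Proof.
have b1 := bmf_toC r; have b2 := bmf_conj b1.
have bZ c F : bmf r F -> bmf r (fun p => c * F p).
  by move=> bF; apply: bmfM => //; exact: bmf_cst.
apply: bmfD; apply: bmfM.
- by apply: bmfD; apply: bZ.
- exact: bmf_zmon.
- by apply: bmfD; [exact: bmfM|exact: bmf_cst].
- by apply: bmfD; apply: (bZ); apply: (bZ); exact: bmf_zmon.
Qed.

Lemma horner_deriv_zmon (u v : {poly C}) (c1 c2 : C) (s : C) a b (t : C) :
  u^`() = c1%:P -> v^`() = c2%:P ->
  ((u * v - s%:P) * (u ^+ a * v ^+ b))^`().[t] =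
  (c1 * v.[t] + c2 * u.[t]) * (u.[t] ^+ a * v.[t] ^+ b) +
  (u.[t] * v.[t] - s) * (c1 * (a%:R * (u.[t] ^+ a.-1 * v.[t] ^+ b)) +
     c2 * (b%:R * (u.[t] ^+ a * v.[t] ^+ b.-1))).
Proof.
move=> du dv; rewrite !(derivM, derivB, derivC, deriv_exp) du dv.
rewrite !(hornerD, hornerM, hornerC, horner_exp, hornerN, hornerMn).
rewrite -(mulr_natl (c1 * _)) -(mulr_natl (c2 * _)).
move: (u.[t] ^+ a) (v.[t] ^+ b) (u.[t] ^+ a.-1) (v.[t] ^+ b.-1) (a%:R : C) (b%:R : C) => x1 x2 x3 x4 x5 x6.
ring.
Qed.

Lemma sqn_toC_mulJ (x y r : R) : x ^+ 2 + y ^+ 2 = r ^+ 2 ->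
  (toC (x, y) : C) * conjc (toC (x, y) : C) = (r ^+ 2)%:C%C.
Proof.
move=> <-; apply/eqP; rewrite eq_complex /=; apply/andP; split; apply/eqP; ring.
Qed.

Lemma cint_dzmon_x r a b : cint lam2 (drad r) (dzmon 1 1 r a b) = 0.
Proof.
pose u (y : R) : {poly C} := 'X + ('i%C * y%:C%C)%:P.
pose v (y : R) : {poly C} := 'X - ('i%C * y%:C%C)%:P.
have hu x y : (u y).[x%:C%C] = toC (x, y) by rewrite hornerD hornerX hornerC -toC_xE.
have hv x y : (v y).[x%:C%C] = conjc (toC (x, y) : C).
  by rewrite hornerD hornerN hornerX hornerC -conj_toC_xE.
have du y : (u y)^`() = 1%:P by rewrite derivD derivX derivC addr0.
have dv y : (v y)^`() = 1%:P by rewrite derivB derivX derivC subr0.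
apply: (@cint_deriv_eq0_x r (fun y => (u y * v y - (r ^+ 2)%:C%C%:P) * (u y ^+ a * v y ^+ b))).
- exact: bmf_dzmon.
- by move=> x y; rewrite (horner_deriv_zmon _ _ _ _ (du y) (dv y)) hu hv.
- move=> x y e; rewrite hornerM (_ : (u y * v y - _).[_] = 0) ?mul0r //.
  by rewrite hornerD hornerN hornerM hornerC hu hv (sqn_toC_mulJ e) subrr.
Qed.

Lemma cint_dzmon_y r a b : cint lam2 (drad r) (dzmon 'i%C (- 'i%C) r a b) = 0.
Proof.
pose u (x : R) : {poly C} := 'i%C *: 'X + (x%:C%C)%:P.
pose v (x : R) : {poly C} := - 'i%C *: 'X + (x%:C%C)%:P.
have hu x y : (u x).[y%:C%C] = toC (x, y) by rewrite hornerD hornerZ hornerX hornerC addrC -toC_xE.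
have hv x y : (v x).[y%:C%C] = conjc (toC (x, y) : C).
  by rewrite hornerD hornerZ hornerX hornerC addrC mulNr -conj_toC_xE.
have du x : (u x)^`() = 'i%C%:P by rewrite derivD derivZ derivX derivC addr0 alg_polyC.
have dv x : (v x)^`() = (- 'i%C)%:P by rewrite derivD derivZ derivX derivC addr0 alg_polyC.
apply: (@cint_deriv_eq0_y r (fun x => (u x * v x - (r ^+ 2)%:C%C%:P) * (u x ^+ a * v x ^+ b))).
- exact: bmf_dzmon.
- by move=> x y; rewrite (horner_deriv_zmon _ _ _ _ (du x) (dv x)) hu hv.
- move=> x y e; rewrite hornerM (_ : (u x * v x - _).[_] = 0) ?mul0r //.
  by rewrite hornerD hornerN hornerM hornerC hu hv (sqn_toC_mulJ e) subrr.
Qed.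

(** Here I is the imaginary unit, and the operator is d/dx - i d/dy = 2 d/dz. Z1 stands for z^(a-1)
    and A for a; the second hypothesis also holds at a = 0, where the predecessor is truncated but A
    vanishes. *)
Lemma dzmon_algebra (I z w s Z Z1 W W1 A B : C) : I * I = -1 -> A * Z = A * (z * Z1) ->
  (1 * w + 1 * z) * (Z * W) + (z * w - s) * (1 * (A * (Z1 * W)) + 1 * (B * (Z * W1))) +
    - I * ((I * w + - I * z) * (Z * W) + (z * w - s) * (I * (A * (Z1 * W)) + - I * (B * (Z * W1))))
  = 2 * (1 + A) * (Z * (w * W)) + - 2 * s * A * (Z1 * W).
Proof.
move=> hI hA.
transitivity (2 * (w * Z * W) + 2 * ((z * w - s) * (A * (Z1 * W))) +
  (I * I + 1) * (- (w - z) * (Z * W) - (z * w - s) * (A * (Z1 * W)) + (z * w - s) * (B * (Z * W1)))).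
  by ring.
rewrite hI addNr mul0r addr0.
transitivity (2 * (w * Z * W) + 2 * w * W * (A * (z * Z1)) - 2 * s * (A * (Z1 * W))); first by ring.
by rewrite -hA; ring.
Qed.

(* The Wirtinger derivative d/dz of (|z|^2 - r^2) z^a conj(z)^b integrates to 0,
   since that function vanishes on the circle. *)
Lemma moment_rec r a b :
  a.+1%:R * cint lam2 (drad r) (zmon a b.+1) =
  (r ^+ 2)%:C%C * (a%:R * cint lam2 (drad r) (zmon a.-1 b)).
Proof.
have mD := @measurable_drad R r.
have iz a' b' := bmf_cintegrable (bmf_zmon r a' b').
have id c1 c2 := bmf_cintegrable (bmf_dzmon c1 c2 r a b).
have : cint lam2 (drad r) (fun p => dzmon 1 1 r a b p + (- 'i%C) * dzmon 'i%C (- 'i%C) r a b p) = 0.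
  by rewrite cintD ?cintZ ?cint_dzmon_x ?cint_dzmon_y ?mulr0 ?addr0 //; exact: cintegrableZ.
rewrite (@eq_cint _ _ _ _ _ _ (fun p => (2 * a.+1%:R) * zmon a b.+1 p +
    (- 2 * (r ^+ 2)%:C%C * a%:R) * zmon a.-1 b p)); last first.
  move=> p _; rewrite /dzmon /zmon.
  rewrite (exprS _ b) -(nat1r a); apply: dzmon_algebra; first by rewrite -expr2 sqr_i.
  by case: (a) => [|a'] /=; rewrite ?mul0r ?exprS.
rewrite cintD; [|exact: mD|exact: cintegrableZ|exact: cintegrableZ].
rewrite !cintZ // => /eqP h.
have two0 : (2 : C) != 0 by rewrite pnatr_eq0.
apply: (mulfI two0); apply/eqP; rewrite -subr_eq0 -[X in _ == X](eqP h).
apply/eqP; ring.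
Qed.

End DiscMomentRecursion.

(** * The area of a disc *)

Section DiscArea.
Variable R : realType.
Local Notation C := R[i].
Local Notation mu := (@lebesgue_measure R).
Local Notation plane := (measurableTypeR R * measurableTypeR R)%type.
Implicit Types (F G : plane -> C) (r : R).

Lemma continuous_sqrt_chord r : continuous (fun x : R => 2 * Num.sqrt (r ^+ 2 - x ^+ 2)).
Proof.
move=> x; apply: cvgM; first exact: cvg_cst.
apply: continuous_comp; last exact: sqrt_continuous.
by apply: cvgB; [exact: cvg_cst|exact: exprn_continuous].
Qed.

(** The substitution x = r sin t turns the integrand into 2 (r cos t)^2, which has the primitive r^2
    (t + sin t cos t). *)
Lemma integral_chord r : 0 < r ->
  (\int[mu]_(x in `](- r)%R, r[) (2 * Num.sqrt (r ^+ 2 - x ^+ 2))%R%:E = (pi * r ^+ 2)%R%:E)%E.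
Proof.
move=> r0.
pose F t : R := r * sin t; pose G x : R := 2 * Num.sqrt (r ^+ 2 - x ^+ 2).
have cG : continuous G by exact: continuous_sqrt_chord.
have Fr : F (pi / 2) = r by rewrite /F sin_pihalf mulr1.
have FNr : F (- (pi / 2)) = - r by rewrite /F sinN sin_pihalf mulrN1.
have pi0 : 0 < pi :> R by exact: pi_gt0.
have ab : - (pi / 2) < pi / 2 :> R by lra.
rewrite -(@integral_itv_bndoo _ (- r) r (EFin \o G) true false); last first.
  apply/measurable_EFinP; apply: measurable_funTS; exact: continuous_measurable_fun.
have dF (t : R) : is_derive t 1 F (r * cos t).
  by rewrite /F; apply: is_derive_eq.
have F'E : F^`()%classic = (fun t => r * cos t).
  by apply/funext => t; rewrite derive1E derive_val.
have cF' : continuous (fun t : R => r * cos t).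
  by move=> t; apply: cvgM; [exact: cvg_cst|exact: continuous_cos].
have contF : continuous F.
  by move=> t; apply: cvgM; [exact: cvg_cst|exact: continuous_sin].
have -> : `[(- r)%R, r]%classic = `[F (- (pi / 2)), F (pi / 2)]%classic by rewrite Fr FNr.
rewrite (@integration_by_substitution_increasing _ F G) ?(ltW ab) //; last 6 first.
- move=> x y hx hy xy; rewrite /F ltr_pM2l //.
  by rewrite ltr_sin.
- by rewrite F'E => t _; exact: cF'.
- by rewrite F'E; apply/cvg_ex; exists (r * cos (- (pi / 2))); apply: cvg_at_right_filter; exact: cF'.
- by rewrite F'E; apply/cvg_ex; exists (r * cos (pi / 2)); apply: cvg_at_left_filter; exact: cF'.
- split => [x _||]; first exact: ex_derive.
    by apply: cvg_at_right_filter; exact: contF.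
  by apply: cvg_at_left_filter; exact: contF.
- by apply: continuous_subspaceT.
pose H t : R := r ^+ 2 * (t + sin t * cos t).
have dH (t : R) : is_derive t 1 H (2 * (r * cos t) ^+ 2).
  rewrite /H; apply: is_derive_eq.
  rewrite /GRing.scale /= exprMn.
  have := cos2Dsin2 t => h.
  have -> : 1 + (sin t * - sin t + cos t * cos t) = 2 * cos t ^+ 2 by rewrite -[X in X + _]h; ring.
  by ring.
transitivity (\int[mu]_(x in `[(- (pi / 2))%R, (pi / 2)%R]) (2 * (r * cos x) ^+ 2)%R%:E)%E.
  apply: eq_integral => t; rewrite inE /= in_itv /= => /andP[t1 t2].
  transitivity (2 * Num.sqrt (r ^+ 2 - (r * sin t) ^+ 2) * (r * cos t))%:E; first by rewrite F'E.
  congr (EFin _).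
  have c0 : 0 <= cos t by rewrite cos_ge0_pihalf // t1.
  have -> : r ^+ 2 - (r * sin t) ^+ 2 = (r * cos t) ^+ 2 by rewrite !exprMn cos2sin2; ring.
  by rewrite sqrtr_sqr ger0_norm ?mulr_ge0 ?(ltW r0) // expr2 mulrA.
rewrite (@continuous_FTC2 _ _ H) //.
- rewrite /H sinN cosN cos_pihalf !mulr0 !addr0 -EFinB; congr EFin; lra.
- apply: continuous_subspaceT => t; apply: cvgM; first exact: cvg_cst.
  rewrite (_ : (fun x => _) = (fun x => (r * cos x) * (r * cos x))); last first.
    by apply/funext => x; rewrite expr2.
  by apply: cvgM; exact: cF'.
- split => [x _||]; first exact: ex_derive.
    apply: cvg_at_right_filter; apply: differentiable_continuous.
    by apply/derivable1_diffP; exact: ex_derive.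
  apply: cvg_at_left_filter; apply: differentiable_continuous.
  by apply/derivable1_diffP; exact: ex_derive.
- by move=> x _; rewrite derive1E derive_val.
Qed.
End DiscArea.

(** * Moments and norms of polynomials on a disc *)

Section DiscNorms.
Variable R : realType.
Local Notation C := R[i].
Local Notation plane := (measurableTypeR R * measurableTypeR R)%type.
Local Notation lam2 := ((@lebesgue_measure R) \x (@lebesgue_measure R))%E.
Implicit Types (F : plane -> C) (r : R).

Lemma Rintegral_drad_cst1 r : 0 < r -> Rintegral lam2 (drad r) (fun=> 1) = pi * r ^+ 2.
Proof.
move=> r0; rewrite /Rintegral integral_mkcond.
have ig : lam2.-integrable setT ((EFin \o (fun=> 1 : R)) \_ (drad r)).
  apply/(integrable_mkcond (EFin \o (fun=> 1 : R)) (measurable_drad r)).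
  by case: (bmf_cintegrable (bmf_cst r 1)).
rewrite -(integral12_prod_meas1 ig).
rewrite -[RHS]/(fine (pi * r ^+ 2)%:E) -(integral_chord r0) [in RHS]integral_mkcond.
congr fine; apply: eq_integral => x _.
rewrite /fubini_F patchE.
have xE : (x \in `](- r), r[%classic) = (x ^+ 2 < r ^+ 2).
  apply/idP/idP; rewrite inE /= in_itv /= -ltr_norml => h.
    by rewrite -[x ^+ 2]real_normK ?num_real // ltr_sqr ?nnegrE ?(ltW r0).
  by rewrite -ltr_sqr ?nnegrE ?(ltW r0) // real_normK ?num_real.
rewrite xE; have [hx|hx] := ltP (x ^+ 2) (r ^+ 2).
  have w0 : 0 < Num.sqrt (r ^+ 2 - x ^+ 2) by rewrite sqrtr_gt0 subr_gt0.
  have w2 : Num.sqrt (r ^+ 2 - x ^+ 2) ^+ 2 = r ^+ 2 - x ^+ 2.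
    by rewrite sqr_sqrtr // subr_ge0 ltW.
  rewrite (patch_drad_y _ w0 w2) -integral_mkcond integral_cst ?measurable_itv //=.
  rewrite mul1e lebesgue_measure_itv /= lte_fin ifT; last by lra.
  by rewrite -EFinB; congr EFin; ring.
rewrite integral0_eq // => y _; rewrite patchE ifF //.
by apply/negbTE/negP; rewrite inE /drad /= addrC drad_section_empty.
Qed.

Lemma cint_conj r F : bmf r F ->
  cint lam2 (drad r) (fun p => conjc (F p)) = conjc (cint lam2 (drad r) F).
Proof.
move=> bF; have [iR iI] := bmf_cintegrable bF; have mD := @measurable_drad R r.
rewrite /cint /=; congr Complex.
  by apply: eq_Rintegral => p _; case: (F p).
rewrite -mulN1r -RintegralZl //; apply: eq_Rintegral => p _.
by rewrite mulN1r; case: (F p).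
Qed.

(** [moment_rec] lowers both exponents by one. Its factor a kills the moments with a = 0 < b,
    conjugation settles b = 0 < a, and the area of the disc starts the diagonal. *)
Lemma moment_eq r a b : 0 < r ->
  cint lam2 (drad r) (zmon a b) = if a == b then (pi * r ^+ a.+1.*2 / a.+1%:R)%:C%C else 0.
Proof.
move=> r0.
have m0 b' : cint lam2 (drad r) (zmon 0 b'.+1) = 0.
  by have := moment_rec r 0 b'; rewrite mul0r mulr0 mul1r.
elim: a b => [|a IH] [|b].
- have -> : zmon 0 0 = (fun=> 1) :> (plane -> C).
    by apply/funext => p; rewrite /zmon !expr0 mul1r.
  apply/eqP; rewrite eq_complex; apply/andP; split; apply/eqP.
    by rewrite /= divr1 -[1.*2]/2%N -Rintegral_drad_cst1.
  by rewrite /= Rintegral_cst ?mul0r //; exact: measurable_drad.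
- by rewrite m0.
- rewrite (@eq_cint _ _ _ _ _ _ (fun p => conjc (zmon 0 a.+1 p))).
    by rewrite cint_conj ?m0 ?conjc0 //; exact: bmf_zmon.
  by move=> p _; rewrite /zmon !expr0 mulr1 mul1r (rmorphXn (@conjc R)); congr (_ ^+ _); exact: esym (conjcK _).
- have := moment_rec r a.+1 b; rewrite /= IH eqSS.
  case: eqP => [->|_].
    move=> h; apply: (mulfI (natrc_neq0 R b.+1)); rewrite h.
    rewrite -!real_natc -!rmorphM; congr (_%:C)%C.
    rewrite !doubleS !exprS; field; by rewrite ?natr1_neq0 ?natr2_neq0.
  by rewrite !mulr0 => /eqP; rewrite mulf_eq0 (negbTE (natrc_neq0 R _)) => /eqP.
Qed.

Lemma bmf_horner r (f : {poly C}) : bmf r (fun p => f.[toC p : C]).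
Proof.
elim/poly_ind: f => [|f c IH].
  by rewrite (_ : (fun p => _) = (fun=> 0)); [exact: bmf_cst|apply/funext => p; rewrite horner0].
rewrite (_ : (fun p => _) = (fun p => f.[toC p : C] * (toC p : C) + c)).
  by apply: bmfD; [apply: bmfM => //; exact: bmf_toC|exact: bmf_cst].
by apply/funext => p; rewrite hornerMXaddC.
Qed.

Lemma cint_horner_zbar r (f : {poly C}) n : 0 < r ->
  cint lam2 (drad r) (fun p => f.[toC p : C] * conjc (toC p : C) ^+ n) =
  f`_n * (pi * r ^+ n.+1.*2 / n.+1%:R)%:C%C.
Proof.
move=> r0; have mD := @measurable_drad R r.
pose t i p := f`_i * zmon i n p.
have it i : cintegrable lam2 (drad r) (t i).
  by apply: cintegrableZ => //; apply: bmf_cintegrable; exact: bmf_zmon.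
rewrite (@eq_cint _ _ _ _ _ _ (fun p => \sum_(i < size f) t i p)); last first.
  by move=> p _; rewrite horner_coef mulr_suml; apply: eq_bigr => i _; rewrite /t /zmon mulrA.
rewrite cint_sum //.
have e i : cint lam2 (drad r) (t i) = if i == n then f`_n * (pi * r ^+ n.+1.*2 / n.+1%:R)%:C%C else 0.
  rewrite /t cintZ //; last by apply: bmf_cintegrable; exact: bmf_zmon.
  by rewrite moment_eq //; case: eqP => [->|_] //; rewrite mulr0.
under eq_bigr => i _ do rewrite e.
rewrite -big_mkcond /=.
case: (ltnP n (size f)) => h; last first.
  by rewrite nth_default // mul0r big1.
by rewrite (big_pred1 (Ordinal h)).
Qed.

Lemma Rintegral_sqn_horner r (f : {poly C}) : 0 < r ->
  Rintegral lam2 (drad r) (fun p => sqn f.[toC p : C]) =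
  \sum_(n < size f) sqn f`_n * (pi * r ^+ n.+1.*2 / n.+1%:R).
Proof.
move=> r0; have mD := @measurable_drad R r.
pose t i p := conjc f`_i * (f.[toC p : C] * conjc (toC p : C) ^+ i).
have b1 i : bmf r (fun p => f.[toC p : C] * conjc (toC p : C) ^+ i).
  apply: bmfM; first exact: bmf_horner.
  by apply: bmfX; apply: bmf_conj; exact: bmf_toC.
have it i : cintegrable lam2 (drad r) (t i).
  by apply: cintegrableZ => //; apply: bmf_cintegrable.
have -> : Rintegral lam2 (drad r) (fun p => sqn f.[toC p : C]) =
   complex.Re (cint lam2 (drad r) (fun p => \sum_(i < size f) t i p)).
  rewrite /=; apply: eq_Rintegral => p _.
  have -> : \sum_(i < size f) t i p = f.[toC p : C] * conjc (f.[toC p : C]).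
    rewrite [in X in _ * X]horner_coef rmorph_sum mulr_sumr; apply: eq_bigr => i _.
    by rewrite /t rmorphM rmorphXn /=; ring.
  by case: (f.[_]) => x y; rewrite /sqn /cdot /=; ring.
rewrite cint_sum // Re_sum; apply: eq_bigr => n _.
rewrite /t cintZ //; last exact: bmf_cintegrable.
rewrite cint_horner_zbar //; case: (f`_n) => x y; rewrite /sqn /cdot /=; ring.
Qed.

Lemma integrable_sqn_horner r (f : {poly C}) :
  lam2.-integrable (drad r) (EFin \o (fun p => sqn f.[toC p : C])).
Proof.
have [iR _] := bmf_cintegrable (bmfM (bmf_horner r f) (bmf_conj (bmf_horner r f))).
rewrite (_ : _ \o _ = (fun p => (complex.Re (f.[toC p : C] * conjc f.[toC p : C]))%:E)) //.
by apply/funext => p /=; case: (f.[_]) => x y; rewrite /sqn /cdot /=; congr EFin; ring.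
Qed.

Lemma Rintegral_sqn_bnorm (f : {poly C}) :
  Rintegral lam2 (drad 1) (fun p => sqn f.[toC p : C]) = pi * bnorm f.
Proof.
rewrite Rintegral_sqn_horner // /bnorm /ip mulr_sumr; apply: eq_bigr => n _.
by rewrite expr1n mulr1 -/(sqn _); ring.
Qed.

(** Integrate over the disc, where each squared modulus contributes pi times a squared norm.
    Pointwise bounds on symbols become operator inequalities through this transfer. *)
Lemma bnorm_positivity (s : seq (R * {poly C})) :
  (forall z : C, sqn z < 1 -> 0 <= \sum_(t <- s) t.1 * sqn t.2.[z]) ->
  0 <= \sum_(t <- s) t.1 * bnorm t.2.
Proof.
move=> h; have mD := @measurable_drad R 1.
have iF (s' : seq (R * {poly C})) : lam2.-integrable (drad 1)
    (EFin \o (fun p => \sum_(t <- s') t.1 * sqn t.2.[toC p : C])).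
  elim: s' => [|t s' IH].
    rewrite (_ : _ \o _ = (fun=> 0%E)); first exact: integrable0.
    by apply/funext => p /=; rewrite big_nil.
  rewrite (_ : _ \o _ = (fun p => (t.1%:E * (sqn t.2.[toC p : C])%:E + (\sum_(t <- s') t.1 * sqn t.2.[toC p : C])%:E)%E)).
    apply: integrableD => //; apply: integrableZl => //; exact: integrable_sqn_horner.
  by apply/funext => p /=; rewrite big_cons EFinD EFinM.
have e (s' : seq (R * {poly C})) : Rintegral lam2 (drad 1)
     (fun p => \sum_(t <- s') t.1 * sqn t.2.[toC p : C]) = pi * \sum_(t <- s') t.1 * bnorm t.2.
  elim: s' => [|t s' IH].
    rewrite big_nil mulr0 (@eq_Rintegral _ _ _ _ _ (fun=> 0)); first by rewrite Rintegral_cst ?mul0r.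
    by move=> p _; rewrite big_nil.
  rewrite big_cons mulrDr -IH mulrCA -Rintegral_sqn_bnorm -RintegralZl //; last exact: integrable_sqn_horner.
  rewrite -RintegralD //.
    by apply: eq_Rintegral => p _; rewrite big_cons.
  rewrite (_ : _ \o _ = (fun p => (t.1%:E * (sqn t.2.[toC p : C])%:E)%E)) //.
  by apply: integrableZl => //; exact: integrable_sqn_horner.
have p0 : 0 < pi :> R by exact: pi_gt0.
rewrite -(pmulr_rge0 _ p0) -e; apply: Rintegral_ge0 => p; rewrite /drad /= expr1n => hp.
by apply: h; rewrite sqn_toC.
Qed.

End DiscNorms.

(** * Toeplitz operators with harmonic polynomial symbols *)

Section PolynomialToeplitz.
Variable R : realType.
Local Notation C := R[i].
Implicit Types (p q f g h u : {poly C}) (c gam : C).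

Lemma adjp_is_linear p : linear (adjp p).
Proof.
move=> c f g; apply/polyP => d; rewrite coefD coefZ !coef_adjp.
rewrite (mulrCA c) -mulrDr; congr (_ * _); rewrite mulr_sumr -big_split /=; apply: eq_bigr => a _.
by rewrite coefD coefZ; ring.
Qed.

HB.instance Definition _ p :=
  GRing.isLinear.Build C {poly C} {poly C} _ (adjp p) (adjp_is_linear p).

Definition ptoep gam p f : {poly C} := gam *: adjp 'X f + p * f.
Definition ptoep_adj gam p f : {poly C} := conjc gam *: ('X * f) + adjp p f.

Lemma ptoep_is_linear gam p : linear (ptoep gam p).
Proof.
move=> c f g; rewrite /ptoep linearP /= mulrDr -scalerAr !scalerDr !scalerA (mulrC c).
by rewrite addrACA.
Qed.

HB.instance Definition _ gam p :=
  GRing.isLinear.Build C {poly C} {poly C} _ (ptoep gam p) (ptoep_is_linear gam p).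

Lemma ptoep_adj_is_linear gam p : linear (ptoep_adj gam p).
Proof.
move=> c f g; rewrite /ptoep_adj linearP /= mulrDr -scalerAr !scalerDr !scalerA (mulrC c).
by rewrite addrACA.
Qed.

HB.instance Definition _ gam p :=
  GRing.isLinear.Build C {poly C} {poly C} _ (ptoep_adj gam p) (ptoep_adj_is_linear gam p).

Lemma ip_ptoep gam p f g : ip (ptoep gam p f) g = ip f (ptoep_adj gam p g).
Proof.
rewrite /ptoep /ptoep_adj ipDl ipDr ip_adjp ipZl; congr (_ + _).
by rewrite ipC -ip_adjp ipC -scalerAr.
Qed.

Lemma bnorm_ptoep gam p f : bnorm (ptoep gam p f) =
  sqn gam * bnorm (adjp 'X f) + 2 * ip f (conjc gam *: ('X * (p * f))) + bnorm (p * f).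
Proof.
rewrite bnormD bnormZ; congr (_ + 2 * _ + _).
by rewrite ipZl ipC -ip_adjp ipC -scalerAr.
Qed.

(** The cross terms of the two expansions agree, so the self-commutator reduces to the Hankel part
    of gamma conj(z) minus that of conj(p). *)
Lemma bnorm_ptoep_adj gam p f : bnorm (ptoep_adj gam p f) - bnorm (ptoep gam p f) =
  sqn gam * bnorm (primp f) - (bnorm (p * f) - bnorm (adjp p f)).
Proof.
rewrite bnorm_ptoep -bnormX_primp /ptoep_adj bnormD bnormZ sqn_conj.
have -> : ip (conjc gam *: ('X * f)) (adjp p f) = ip f (conjc gam *: ('X * (p * f))).
  by rewrite -ip_adjp ipC -scalerAr mulrCA.
ring.
Qed.

Definition symb gam p (z : C) : C := gam * conjc z + p.[z].

Lemma bnormM_le q (K : R) f : (forall z, sqn z < 1 -> sqn q.[z] <= K) ->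
  bnorm (q * f) <= K * bnorm f.
Proof.
move=> hq; have := @bnorm_positivity R [:: (K, f); (-1, q * f)].
rewrite !big_cons !big_nil /= => h; rewrite -subr_ge0.
have -> : K * bnorm f - bnorm (q * f) = K * bnorm f + (-1 * bnorm (q * f) + 0) by ring.
apply: h => z z1; rewrite !big_cons big_nil /= hornerM sqnM addr0 mulN1r subr_ge0.
by rewrite ler_wpM2r ?sqn_ge0 ?hq.
Qed.

(** |symbol|^2 |f|^2 involves conj(z) in its cross term. Polarisation writes this term through f +
    conj(gamma) z p f, so that only squared moduli of polynomials occur and [bnorm_positivity]
    applies. The sign e = 1 serves lower bounds, e = -1 upper bounds. *)
Definition symb_terms gam p f (e d : R) : seq (R * {poly C}) :=
  [:: (e * sqn gam, 'X * f); (e, p * f); (e, f + conjc gam *: ('X * (p * f)));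
      (- e, f); (- e * sqn gam, 'X * (p * f)); (- d, f)].

Lemma symb_terms_horner gam p f (e d : R) z :
  \sum_(t <- symb_terms gam p f e d) t.1 * sqn t.2.[z] =
  (e * sqn (symb gam p z) - d) * sqn f.[z].
Proof.
rewrite !big_cons big_nil /= !(hornerD, hornerZ, hornerM, hornerX) /symb.
case: gam z (p.[z]) (f.[z]) => [a b] [x y] [u v] [s t].
by rewrite /sqn /cdot /=; ring.
Qed.

Lemma symb_terms_bnorm gam p f (e d : R) :
  \sum_(t <- symb_terms gam p f e d) t.1 * bnorm t.2 =
  e * (bnorm (ptoep gam p f) + sqn gam * bnorm (primp f)) - d * bnorm f.
Proof.
rewrite !big_cons big_nil /= bnorm_ptoep -bnormX_primp bnormD bnormZ sqn_conj.
ring.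
Qed.

(** The mean of |symbol|^2 |f|^2 over the disc splits into |T f|^2 and the Hankel term |gamma|^2
    |F|^2, F the primitive of f. This second term is what T loses. *)
Lemma ptoep_lower gam p (d : R) f : (forall z, sqn z < 1 -> d <= sqn (symb gam p z)) ->
  d * bnorm f <= bnorm (ptoep gam p f) + sqn gam * bnorm (primp f).
Proof.
move=> h; have := @bnorm_positivity R (symb_terms gam p f 1 d); rewrite symb_terms_bnorm mul1r subr_ge0.
apply=> z z1; rewrite symb_terms_horner mulr_ge0 ?sqn_ge0 // mul1r subr_ge0; exact: h.
Qed.

Lemma ptoep_upper gam p (d : R) f : (forall z, sqn z < 1 -> sqn (symb gam p z) <= d) ->
  bnorm (ptoep gam p f) <= d * bnorm f.
Proof.
move=> h; have := @bnorm_positivity R (symb_terms gam p f (-1) (- d)); rewrite symb_terms_bnorm.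
have h2 : 0 <= sqn gam * bnorm (primp f) by rewrite mulr_ge0 ?sqn_ge0 ?bnorm_ge0.
move=> h3; suff : 0 <= -1 * (bnorm (ptoep gam p f) + sqn gam * bnorm (primp f)) - - d * bnorm f by lra.
apply: h3 => z z1; rewrite symb_terms_horner mulr_ge0 ?sqn_ge0 //.
by have := h z z1; lra.
Qed.

(** With S for the Hankel term of gamma conj(z), the Hankel part of conj(p) is at most k S. Hence
    the adjoint has squared norm at least |T f|^2 + (1 - k) S, which dominates (1 - k) (|T f|^2 +
    S), and [ptoep_lower] concludes. *)
Lemma ptoep_adj_lower gam p (k d : R) f : 0 <= k < 1 -> 0 <= d ->
  (forall z, sqn z < 1 -> sqn p^`().[z] <= k * sqn gam) ->
  (forall z, sqn z < 1 -> d <= sqn (symb gam p z)) ->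
  (1 - k) * d * bnorm f <= bnorm (ptoep_adj gam p f).
Proof.
move=> /andP[k0 k1] d0 hp hs.
have h1 := ptoep_lower f hs.
have h2 := bnorm_hankel_le p f.
have h3 := bnormM_le (primp f) hp.
have h4 := bnorm_ptoep_adj gam p f.
have h5 : bnorm (ptoep gam p f) >= 0 by exact: bnorm_ge0.
set S := sqn gam * bnorm (primp f) in h1 h4 *.
have h6 : k * sqn gam * bnorm (primp f) = k * S by rewrite mulrA.
rewrite h6 in h3.
have h7 : (1 - k) * (d * bnorm f) <= (1 - k) * (bnorm (ptoep gam p f) + S).
  by rewrite ler_wpM2l // subr_ge0 ltW.
have h8 : 0 <= k * bnorm (ptoep gam p f) by rewrite mulr_ge0.
by rewrite -mulrA; lra.
Qed.

Lemma ptoep_le_adj gam p (k : R) f : 0 <= k < 1 ->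
  (forall z, sqn z < 1 -> sqn p^`().[z] <= k * sqn gam) ->
  bnorm (ptoep gam p f) <= bnorm (ptoep_adj gam p f).
Proof.
move=> /andP[k0 k1] hp.
have h2 := bnorm_hankel_le p f.
have h3 := bnormM_le (primp f) hp.
have h4 := bnorm_ptoep_adj gam p f.
have : 0 <= sqn gam * bnorm (primp f) by rewrite mulr_ge0 ?sqn_ge0 ?bnorm_ge0.
rewrite -mulrA in h3.
move: (sqn gam * bnorm (primp f)) h3 h4 => S h3 h4 S0.
have : 0 <= (1 - k) * S by rewrite mulr_ge0 // subr_ge0 ltW.
by lra.
Qed.

Lemma symb_subC gam p c z : symb gam (p - c%:P) z = symb gam p z - c.
Proof. by rewrite /symb hornerD hornerN hornerC addrA. Qed.

Lemma ptoep_adj_subC gam p c f :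
  ptoep_adj gam (p - c%:P) f = ptoep_adj gam p f - conjc c *: f.
Proof. by rewrite /ptoep_adj adjpB addrA. Qed.

Lemma ptoep_scale (c : C) gam p f : ptoep (c * gam) (c *: p) f = c *: ptoep gam p f.
Proof. by rewrite /ptoep scalerDr scalerA scalerAl. Qed.

Lemma ptoep_adj_scale (c : C) gam p f :
  ptoep_adj (c * gam) (c *: p) f = conjc c *: ptoep_adj gam p f.
Proof.
rewrite /ptoep_adj scalerDr scalerA rmorphM; congr (_ + _).
have -> : c *: p = p * c%:P by rewrite mulrC mul_polyC.
apply/polyP => d; rewrite coefZ !(@coef_adjpE _ (maxn (size p) (size (p * c%:P)%R))) ?leq_maxl ?leq_maxr //.
rewrite [RHS]mulrCA; congr (_ * _); rewrite mulr_sumr; apply: eq_bigr => a _.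
by rewrite coefMC rmorphM; ring.
Qed.

End PolynomialToeplitz.

(** * Norm increase for polynomial symbols *)

Section ExpansivePolynomialToeplitz.
Variable R : realType.
Local Notation C := R[i].
Implicit Types (p f g h : {poly C}) (c gam : C).

Lemma bnorm_mulX_le f : bnorm ('X * f) <= bnorm f.
Proof.
rewrite bnorm_mulX (@bnormE _ (size f)) // ler_sum // => i _.
by rewrite ler_wpM2l ?sqn_ge0 // lef_pV2 ?posrE ?ltr0n // ler_nat.
Qed.

Lemma bnorm_adjX_le f : bnorm (adjp 'X f) <= bnorm f.
Proof.
have := bnormX_primp f; have := bnorm_mulX_le f; have := bnorm_ge0 (primp f); lra.
Qed.

Lemma horner_le_sum p z : sqn z < 1 -> normc p.[z] <= \sum_(i < size p) normc p`_i.
Proof.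
move=> z1; rewrite horner_coef (le_trans (normc_sum _ _ _)) // ler_sum // => i _.
rewrite normcM normcX ler_piMr ?normc_ge0 // exprn_ile1 ?normc_ge0 //.
by rewrite normc_le_sqn // expr1n ltW.
Qed.

Lemma horner_sqn_le p z : sqn z < 1 -> sqn p.[z] <= (\sum_(i < size p) normc p`_i) ^+ 2.
Proof.
move=> z1; rewrite -normc_le_sqn ?horner_le_sum //.
by apply: sumr_ge0 => i _; rewrite normc_ge0.
Qed.

Lemma bnormM_bounded p : exists2 K : R, 0 < K & forall f, bnorm (p * f) <= K * bnorm f.
Proof.
exists ((\sum_(i < size p) normc p`_i) ^+ 2 + 1); first by rewrite ltr_wpDl ?sqr_ge0.
move=> f; apply: bnormM_le => z z1; apply: (le_trans (horner_sqn_le p z1)).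
by rewrite lerDl.
Qed.

Lemma ptoep_bounded gam p : exists2 K : R, 0 < K & forall f, bnorm (ptoep gam p f) <= K * bnorm f.
Proof.
have [K K0 hK] := bnormM_bounded p.
exists (2 * sqn gam + 2 * K); first by rewrite ltr_wpDl ?mulr_ge0 ?sqn_ge0 ?mulr_gt0.
move=> f; apply: (le_trans (bnormD2 _ _)); rewrite bnormZ.
have h1 : sqn gam * bnorm (adjp 'X f) <= sqn gam * bnorm f.
  by rewrite ler_wpM2l ?sqn_ge0 ?bnorm_adjX_le.
by have := hK f; lra.
Qed.

Lemma ip_bounded_adj (K : R) (T A : {poly C} -> {poly C}) : 0 < K ->
  (forall f g, ip (T f) g = ip f (A g)) ->
  (forall f, bnorm (T f) <= K * bnorm f) -> forall f, bnorm (A f) <= K * bnorm f.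
Proof.
move=> K0 hT hK f.
have := bnorm_ge0 (T (A f) - K%:C%C *: f).
rewrite bnormB ipRr bnormZ sqn_real hT -/(bnorm _) => h1.
have h2 := hK (A f).
have h3 : K * bnorm (A f) <= K * (K * bnorm f) by rewrite mulrA -expr2; lra.
by rewrite ler_pM2l in h3.
Qed.

Lemma ptoep_adj_bounded gam p :
  exists2 K : R, 0 < K & forall f, bnorm (ptoep_adj gam p f) <= K * bnorm f.
Proof.
have [K K0 hK] := ptoep_bounded gam p.
exists K => //; exact: ip_bounded_adj K0 (ip_ptoep gam p) hK.
Qed.

Lemma ptoep_expansive_of_bounded_below gam p (k del c : R) : 0 <= k < 1 -> 0 < del -> 0 < c ->
  (forall z, sqn z < 1 -> sqn p^`().[z] <= k * sqn gam) ->
  (forall z, sqn z < 1 -> del <= normc (symb gam p z)) ->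
  (forall f, c * bnorm f <= bnorm (ptoep gam p f)) ->
  forall f, del ^+ 2 * bnorm f <= bnorm (ptoep gam p f).
Proof.
move=> k01 del0 c0 hp hs hc f0; rewrite leNgt; apply/negP => hf0.
have f0n0 : f0 != 0 by apply/eqP => e; move: hf0; rewrite e linear0 bnorm0 mulr0 ltxx.
pose E := [set x : R | exists2 f, f != 0 & x = bnorm (ptoep gam p f) / bnorm f].
have hE : has_inf E.
  split; first by exists (bnorm (ptoep gam p f0) / bnorm f0), f0.
  exists c => x [f fn0 ->]; rewrite ler_pdivlMr ?bnorm_gt0 //; exact: hc.
pose mu := inf E.
have mu0 : 0 < mu.
  apply: (lt_le_trans c0); apply: lb_le_inf; first by case: hE.
  by move=> x [f fn0 ->]; rewrite ler_pdivlMr ?bnorm_gt0 //; exact: hc.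
have mulb f : mu * bnorm f <= bnorm (ptoep gam p f).
  have [->|fn0] := eqVneq f 0; first by rewrite linear0 bnorm0 mulr0.
  rewrite -ler_pdivlMr ?bnorm_gt0 //; apply: ge_inf; first by case: hE.
  by exists f.
have mudel : mu < del ^+ 2.
  rewrite -(@ltr_pM2r _ (bnorm f0)) ?bnorm_gt0 //; exact: le_lt_trans (mulb f0) hf0.
pose m := Num.sqrt mu.
have m0 : 0 < m by rewrite sqrtr_gt0.
have m2 : m ^+ 2 = mu by rewrite sqr_sqrtr // ltW.
have mdel : m < del by rewrite -(@ltr_sqr R) ?nnegrE ?ltW // m2.
pose a : C := (m^-1)%:C%C.
have sa : sqn a = mu^-1 by rewrite /a sqn_real exprVn m2.
have ca : conjc a = a by rewrite /a conjc_real.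
pose T : {linear {poly C} -> {poly C}} := ptoep (a * gam) (a *: p).
pose A : {linear {poly C} -> {poly C}} := ptoep_adj (a * gam) (a *: p).
have TE f : T f = a *: ptoep gam p f by exact: ptoep_scale.
have AE f : A f = a *: ptoep_adj gam p f by have h := ptoep_adj_scale a gam p f; rewrite ca in h; exact: h.
have [M M0 hM] := ptoep_adj_bounded (a * gam) (a *: p).
pose c1 := (1 - k) * (del - m) ^+ 2 / mu.
have k1 : 0 < 1 - k by case/andP: k01 => _; rewrite subr_gt0.
have c10 : 0 < c1 by rewrite divr_gt0 // mulr_gt0 // exprn_gt0 // subr_gt0.
apply: (@near_isometry_absurd R T A M c1) => //.
- by move=> f g; exact: ip_ptoep.
- move=> f; rewrite TE AE !bnormZ ler_wpM2l ?sqn_ge0 //; exact: ptoep_le_adj k01 hp.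
- move=> w f w1; rewrite AE.
  (* Subtracting l from the symbol realises A - w up to the factor 1/m. It leaves p' unchanged, and
     the shifted symbol has modulus at least del - m. *)
  pose l := m%:C%C * conjc w.
  have -> : a *: ptoep_adj gam p f - w *: f = a *: ptoep_adj gam (p - l%:P) f.
    have cl : conjc l = m%:C%C * w.
      by rewrite /l; case: (w) => x y /=; congr Complex; ring.
    rewrite ptoep_adj_subC scalerBr scalerA cl mulrA /a -(rmorphM (@real_complex_def R (Phant R))).
    by rewrite mulVf ?gt_eqF // rmorph1 mul1r.
  rewrite bnormZ sa /c1 mulrAC [leRHS]mulrC ler_pM2r ?invr_gt0 //.
  apply: ptoep_adj_lower => //; first exact: sqr_ge0.
    by move=> z z1; rewrite derivB derivC subr0 hp.
  move=> z z1; rewrite symb_subC -normc_ge_sqn ?subr_ge0 ?(ltW mdel) //.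
  apply: (le_trans _ (normcB_ge _ _)); rewrite lerB ?hs //.
  by rewrite normc_le_sqn ?(ltW m0) // /l sqnM sqn_real sqn_conj w1 mulr1.
- move=> f; rewrite TE bnormZ sa ler_pdivlMl //.
move=> e e0; have [x [f fn0 ->] hx] : exists2 x, E x & x < mu + mu * e.
  by apply: inf_adherent => //; rewrite mulr_gt0.
exists f => //; rewrite TE bnormZ sa ler_pdivrMl // mulrA.
rewrite -ler_pdivrMr ?bnorm_gt0 //; apply: ltW; apply: (lt_le_trans hx).
by rewrite mulrDr mulr1.
Qed.

Definition dilp (s : R) p : {poly C} := p \Po (s%:C%C *: 'X).

Lemma horner_dilp s p z : (dilp s p).[z] = p.[s%:C%C * z].
Proof. by rewrite horner_comp hornerZ hornerX. Qed.

Lemma symb_dilp s gam p z : symb (s%:C%C * gam) (dilp s p) z = symb gam p (s%:C%C * z).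
Proof.
rewrite /symb horner_dilp; congr (_ + _).
by case: gam z => [a b] [x y] /=; congr Complex; ring.
Qed.

Lemma expr_lipschitz (s t : R) n : 0 <= s <= 1 -> 0 <= t <= 1 ->
  `|s ^+ n - t ^+ n| <= n%:R * `|s - t|.
Proof.
move=> /andP[s0 s1] /andP[t0 t1]; elim: n => [|n IH].
  by rewrite !expr0 subrr normr0 mul0r.
have -> : s ^+ n.+1 - t ^+ n.+1 = s * (s ^+ n - t ^+ n) + (s - t) * t ^+ n.
  by rewrite !exprS; ring.
rewrite (le_trans (ler_normD _ _)) // !normrM -natr1 mulrDl mul1r lerD //.
  by rewrite (le_trans _ IH) // ler_piMl // ger0_norm.
by rewrite ler_piMr // ger0_norm ?exprn_ge0 // exprn_ile1.
Qed.

Lemma ptoep_dil_lipschitz gam p : exists2 L : R, 0 < L & forall s t f,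
  0 <= s <= 1 -> 0 <= t <= 1 ->
  bnorm (ptoep (s%:C%C * gam) (dilp s p) f - ptoep (t%:C%C * gam) (dilp t p) f) <=
  (s - t) ^+ 2 * (L * bnorm f).
Proof.
(* A Lipschitz constant for s |-> p(s z), uniform over the disc and over s in [0, 1]. *)
pose S := \sum_(i < size p) normc p`_i * i%:R.
have S0 : 0 <= S by apply: sumr_ge0 => i _; rewrite mulr_ge0 ?normc_ge0.
exists (2 * sqn gam + 2 * S ^+ 2 + 1).
  by rewrite ltr_wpDl // addr_ge0 ?mulr_ge0 ?sqn_ge0 ?sqr_ge0.
move=> s t f s01 t01.
have -> : ptoep (s%:C%C * gam) (dilp s p) f - ptoep (t%:C%C * gam) (dilp t p) f =
   ((s - t)%:C%C * gam) *: adjp 'X f + (dilp s p - dilp t p) * f.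
  by rewrite /ptoep opprD addrACA -scalerBl -!mulrBl rmorphB mulrBl.
apply: (le_trans (bnormD2 _ _)); rewrite bnormZ sqnM sqn_real.
have h1 : bnorm ((dilp s p - dilp t p) * f) <= (S * `|s - t|) ^+ 2 * bnorm f.
  apply: bnormM_le => z z1; rewrite -normc_le_sqn ?mulr_ge0 //.
  rewrite hornerD hornerN !horner_dilp !horner_coef -sumrB.
  rewrite (le_trans (normc_sum _ _ _)) // mulr_suml ler_sum // => i _.
  rewrite !exprMn -mulrBr -mulrBl !normcM -mulrA ler_wpM2l ?normc_ge0 //.
  rewrite -!rmorphXn -rmorphB normc_real (le_trans _ (expr_lipschitz i s01 t01)) //.
  rewrite ler_piMr // normcX exprn_ile1 ?normc_ge0 //.
  by rewrite normc_le_sqn // expr1n ltW.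
have h2 : sqn gam * bnorm (adjp 'X f) <= sqn gam * bnorm f.
  by rewrite ler_wpM2l ?sqn_ge0 ?bnorm_adjX_le.
rewrite exprMn real_normK ?num_real // in h1.
have h3 : (s - t) ^+ 2 * (sqn gam * bnorm (adjp 'X f)) <= (s - t) ^+ 2 * (sqn gam * bnorm f).
  by rewrite ler_wpM2l ?sqr_ge0.
have h4 : 0 <= (s - t) ^+ 2 * bnorm f by rewrite mulr_ge0 ?sqr_ge0 ?bnorm_ge0.
by lra.
Qed.

(* Dilation deforms the symbol to a nonzero constant without ever leaving the
   image of the disc, so bounded-belowness propagates along the deformation. *)
Lemma ptoep_expansive gam p (k del : R) : 0 <= k < 1 -> 0 < del ->
  (forall z, sqn z < 1 -> sqn p^`().[z] <= k * sqn gam) ->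
  (forall z, sqn z < 1 -> del <= normc (symb gam p z)) ->
  forall f, del ^+ 2 * bnorm f <= bnorm (ptoep gam p f).
Proof.
move=> k01 del0 hp hs.
have [L L0 hL] := ptoep_dil_lipschitz gam p.
(* With this mesh, operators at adjacent points j/n differ by at most del/2 in norm. *)
pose n := (Num.truncn (4 * L / del ^+ 2)).+1.
have d20 : 0 < del ^+ 2 by rewrite exprn_gt0.
have n0 : 0 < n%:R :> R by rewrite ltr0n.
have n1 : 1 <= n%:R :> R by rewrite ler1n.
have hn : L * n%:R^-1 ^+ 2 <= del ^+ 2 / 4.
  have h1 : 4 * L < del ^+ 2 * n%:R by rewrite [ltRHS]mulrC -ltr_pdivrMr //; exact: truncnS_gt.
  have h2 : L * n%:R^-1 ^+ 2 <= L * n%:R^-1.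
    by rewrite ler_wpM2l ?(ltW L0) // expr2 ler_piMl ?invr_ge0 ?ler0n // invf_le1.
  apply: (le_trans h2); rewrite ler_pdivrMr //; lra.
pose s (j : nat) : R := j%:R / n%:R.
have s01 j : (j <= n)%N -> 0 <= s j <= 1.
  by move=> hj; rewrite divr_ge0 ?ler0n //= ler_pdivrMr // mul1r ler_nat.
have step j : (j <= n)%N -> forall f,
    del ^+ 2 * bnorm f <= bnorm (ptoep ((s j)%:C%C * gam) (dilp (s j) p) f).
  elim: j => [_ f|j IH hj].
    have -> : dilp (s 0%N) p = p.[0]%:P.
      by rewrite /dilp /s mul0r scale0r comp_poly0r horner_coef0.
    rewrite /s !mul0r /ptoep scale0r add0r mul_polyC bnormZ ler_wpM2r ?bnorm_ge0 //.
    have := hs 0; rewrite sqn0 => /(_ ltr01).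
    by rewrite normc_ge_sqn ?(ltW del0) // /symb conjc0 mulr0 add0r.
  have hp' z : sqn z < 1 -> sqn (dilp (s j.+1) p)^`().[z] <= k * sqn ((s j.+1)%:C%C * gam).
    move=> z1; rewrite /dilp deriv_comp derivZ derivX alg_polyC hornerM hornerC.
    rewrite horner_comp hornerZ hornerX !sqnM mulrC mulrCA ler_wpM2l ?sqn_ge0 //.
    by apply: hp; apply: disc_scale => //; exact: s01.
  have hs' z : sqn z < 1 -> del <= normc (symb ((s j.+1)%:C%C * gam) (dilp (s j.+1) p) z).
    by move=> z1; rewrite symb_dilp hs //; apply: disc_scale => //; exact: s01.
  (* The comparison with the preceding operator loses a factor 4; the lemma restores the full
     constant [del ^+ 2], so nothing accumulates over the n steps. *)
  apply: (@ptoep_expansive_of_bounded_below _ _ k del (del ^+ 2 / 4)) => //.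
    by rewrite divr_gt0.
  move=> f; have h1 := IH (ltnW hj) f.
  have h2 := hL _ _ f (s01 _ (ltnW hj)) (s01 _ hj).
  have h3 : (s j - s j.+1) ^+ 2 * (L * bnorm f) <= del ^+ 2 / 4 * bnorm f.
    have -> : (s j - s j.+1) ^+ 2 = n%:R^-1 ^+ 2.
      by rewrite /s -mulrBl -natr1 opprD addrA subrr sub0r mulN1r sqrrN.
    by rewrite mulrA (mulrC _ L) ler_wpM2r ?bnorm_ge0.
  have := bnormD2 (ptoep ((s j)%:C%C * gam) (dilp (s j) p) f -
     ptoep ((s j.+1)%:C%C * gam) (dilp (s j.+1) p) f)
     (ptoep ((s j.+1)%:C%C * gam) (dilp (s j.+1) p) f).
  by rewrite subrK; lra.
move=> f; have := step n (leqnn n) f.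
have -> : s n = 1 by rewrite /s divff // gt_eqF.
by rewrite mul1r /dilp scale1r comp_polyXr.
Qed.
End ExpansivePolynomialToeplitz.

(** * Power series and analytic continuation *)

Section ComplexSequences.
Variable R : realType.
Local Notation C := R[i].
Implicit Types (s x y : nat -> C) (l c h : C).

Definition cvgC s l := forall e : R, 0 < e -> exists N : nat, forall n, (N <= n)%N -> normc (s n - l) < e.

Lemma cvgC_unique s l1 l2 : cvgC s l1 -> cvgC s l2 -> l1 = l2.
Proof.
move=> h1 h2; apply/eqP; rewrite -subr_eq0; apply/eqP/eq0_normc/eqP.
rewrite eq_le normc_ge0 andbT leNgt; apply/negP => p.
have p2 : 0 < normc (l1 - l2) / 2 by rewrite divr_gt0.
have [N hN] := h1 _ p2; have [M hM] := h2 _ p2.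
have a := hN (maxn N M) (leq_maxl _ _); have b := hM (maxn N M) (leq_maxr _ _).
have : normc (l1 - l2) <= normc (s (maxn N M) - l2) + normc (s (maxn N M) - l1).
  rewrite -(normcN (s _ - l1)) (le_trans _ (le_normcD _ _)) // le_eqVlt; apply/orP; left.
  by apply/eqP; congr normc; ring.
by lra.
Qed.

Lemma cvgC_ext s1 s2 l : (forall n, s1 n = s2 n) -> cvgC s1 l -> cvgC s2 l.
Proof. by move=> e h a a0; have [N hN] := h a a0; exists N => n /hN; rewrite e. Qed.

Lemma cvgC_const l : cvgC (fun=> l) l.
Proof. by move=> e e0; exists 0%N => n _; rewrite subrr normc0. Qed.

Lemma cvgC_near_const s l N : (forall n, (N <= n)%N -> s n = l) -> cvgC s l.
Proof. by move=> h e e0; exists N => n /h ->; rewrite subrr normc0. Qed.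

Lemma cvgCM s l c : cvgC s l -> cvgC (fun n => c * s n) (c * l).
Proof.
move=> h e e0; have c0 : 0 < normc c + 1 by rewrite ltr_wpDl ?normc_ge0.
have [N hN] := h (e / (normc c + 1)) (divr_gt0 e0 c0).
exists N => n /hN hn; rewrite -mulrBr normcM.
apply: (@le_lt_trans _ _ ((normc c + 1) * normc (s n - l))).
  by rewrite ler_wpM2r ?normc_ge0 // lerDl.
by rewrite mulrC -ltr_pdivlMr.
Qed.

Lemma cvgCD s1 s2 l1 l2 : cvgC s1 l1 -> cvgC s2 l2 -> cvgC (fun n => s1 n + s2 n) (l1 + l2).
Proof.
move=> h1 h2 e e0; have e2 : 0 < e / 2 by rewrite divr_gt0.
have [N hN] := h1 _ e2; have [M hM] := h2 _ e2; exists (maxn N M) => n.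
rewrite geq_max => /andP[/hN a /hM b]; rewrite opprD addrACA (splitr e).
by rewrite (le_lt_trans (le_normcD _ _)) // ltrD.
Qed.

Lemma cvgC_le s l (M : R) N : cvgC s l -> (forall n, (N <= n)%N -> normc (s n) <= M) -> normc l <= M.
Proof.
move=> h hM; rewrite leNgt; apply/negP => p.
have [N' hN] := h (normc l - M) ltac:(by rewrite subr_gt0).
have a := hN (maxn N N') (leq_maxr _ _); have b := hM (maxn N N') (leq_maxl _ _).
have : normc l - normc (s (maxn N N')) <= normc (l - s (maxn N N')) by exact: normcB_ge.
by rewrite -(normcN (l - _)) opprB; lra.
Qed.

Lemma cvgC_bounded s l : cvgC s l -> exists2 K : R, 0 < K & forall n, normc (s n) <= K.
Proof.
move=> h; have [N hN] := h 1 ltr01.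
pose S := \sum_(i < N) normc (s i).
have S0 : 0 <= S by apply: sumr_ge0 => i _; exact: normc_ge0.
exists (S + (normc l + 1)).
  by rewrite ltr_wpDl // ltr_wpDl ?normc_ge0.
move=> n; case: (ltnP n N) => hn.
  have : normc (s n) <= S.
    rewrite /S (bigD1 (Ordinal hn)) //= lerDl; apply: sumr_ge0 => i _; exact: normc_ge0.
  by have := normc_ge0 l; lra.
have := hN n hn; have := normcB_ge (s n) l; lra.
Qed.

Lemma cvgC_shift s l : cvgC s l -> cvgC (fun n => s n.+1) l.
Proof. by move=> h e e0; have [N hN] := h e e0; exists N => n hn; apply: hN; exact: leqW. Qed.

Lemma cvgC_terms_bounded x l : cvgC (fun n => \sum_(k < n) x k) l ->
  exists2 K : R, 0 < K & forall n, normc (x n) <= K.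
Proof.
move=> h; have [K K0 hK] := cvgC_bounded h.
exists (K + K); first by rewrite addr_gt0.
move=> n; have -> : x n = \sum_(k < n.+1) x k - \sum_(k < n) x k.
  by rewrite big_ord_recr /= addrAC subrr add0r.
by rewrite (le_trans (le_normcD _ _)) // normcN lerD.
Qed.

Lemma expr_small (q e : R) : 0 <= q < 1 -> 0 < e -> exists N : nat, forall n, (N <= n)%N -> q ^+ n < e.
Proof.
move=> /andP[q0 q1] e0.
have h : (fun n => q ^+ n) @ \oo --> (0 : R) by apply: cvg_expr; rewrite ger0_norm.
have /cvgrPdist_lt/(_ e e0) [N _ hN] := h.
exists N => n /hN /=; rewrite sub0r normrN ger0_norm ?exprn_ge0 //.
Qed.

Lemma sum_geom_le (q : R) n m : 0 <= q < 1 -> \sum_(n <= k < n + m) q ^+ k <= q ^+ n / (1 - q).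
Proof.
move=> /andP[q0 q1]; have p : 0 < 1 - q by rewrite subr_gt0.
suff -> : \sum_(n <= k < n + m) q ^+ k = (q ^+ n - q ^+ (n + m)) / (1 - q).
  by rewrite ler_pM2r ?invr_gt0 // lerBlDr lerDl exprn_ge0.
elim: m => [|m IH]; first by rewrite addn0 big_geq // subrr mul0r.
rewrite addnS big_nat_recr ?leq_addr //= IH exprS; field; by rewrite gt_eqF.
Qed.

Definition geom_bounded x (K q : R) := forall n, normc (x n) <= K * q ^+ n.

Lemma geom_tail x K q n m : 0 <= q < 1 -> 0 <= K -> geom_bounded x K q -> (n <= m)%N ->
  normc (\sum_(k < m) x k - \sum_(k < n) x k) <= K * (q ^+ n / (1 - q)).
Proof.
move=> q01 K0 hx nm.
have -> : \sum_(k < m) x k - \sum_(k < n) x k = \sum_(n <= k < m) x k.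
  by rewrite -!(big_mkord xpredT x) (big_cat_nat (leq0n n) nm) /= addrAC subrr add0r.
rewrite (le_trans (normc_sum _ _ _)) //.
apply: (@le_trans _ _ (K * \sum_(n <= k < n + (m - n)) q ^+ k)).
  by rewrite subnKC // mulr_sumr ler_sum // => k _; exact: hx.
by rewrite ler_wpM2l // sum_geom_le.
Qed.

Lemma geom_cvgC x K q : 0 <= q < 1 -> 0 <= K -> geom_bounded x K q ->
  exists2 l, cvgC (fun n => \sum_(k < n) x k) l &
    forall n, normc (l - \sum_(k < n) x k) <= K * (q ^+ n / (1 - q)).
Proof.
move=> q01 K0 hx; have /andP[q0 q1] := q01.
have qn : `|q| < 1 by rewrite ger0_norm.
have cvg_abs (u : nat -> R) : (forall n, `|u n| <= K * q ^+ n) -> cvgn (series u).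
  move=> hu; apply: normed_cvg; apply: (@series_le_cvg _ _ (geometric K q)).
  - by move=> n /=.
  - by move=> n /=; rewrite mulr_ge0 ?exprn_ge0.
  - by move=> n /=; exact: hu.
  - exact: is_cvg_geometric_series.
have [hR hI] : cvgn (series (fun n => complex.Re (x n))) /\ cvgn (series (fun n => complex.Im (x n))).
  split; apply: cvg_abs => n; first exact: le_trans (normr_Re_le _) (hx n).
  exact: le_trans (normr_Im_le _) (hx n).
pose l := (limn (series (fun n => complex.Re (x n))) +i* limn (series (fun n => complex.Im (x n))))%C.
have hl : cvgC (fun n => \sum_(k < n) x k) l.
  move=> e e0; have e2 : 0 < e / 2 by rewrite divr_gt0.
  have /cvgrPdist_lt/(_ _ e2) [N _ hN] := hR.
  have /cvgrPdist_lt/(_ _ e2) [M _ hM] := hI.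
  exists (maxn N M) => n; rewrite geq_max => /andP[/hN a /hM b].
  apply: (le_lt_trans (normc_le_ReIm _)).
  have -> : complex.Re (\sum_(k < n) x k - l) = series (fun n => complex.Re (x n)) n - complex.Re l.
    by rewrite seriesEord /= -Re_sum Re_sub.
  have -> : complex.Im (\sum_(k < n) x k - l) = series (fun n => complex.Im (x n)) n - complex.Im l.
    by rewrite seriesEord /= -Im_sum Im_sub.
  by rewrite (splitr e) ltrD // distrC.
exists l => // n; apply: (@cvgC_le (fun m => \sum_(k < m) x k - \sum_(k < n) x k) _ _ n).
  by apply: cvgCD => //; exact: cvgC_const.
by move=> m nm; exact: geom_tail.
Qed.

(** Divergent series get the default 0; [csumP] gives convergence to this value as soon as some
    limit is known. *)
Definition csum x : C := xget 0 [set l | cvgC (fun n => \sum_(k < n) x k) l].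

Lemma csumP x l : cvgC (fun n => \sum_(k < n) x k) l -> cvgC (fun n => \sum_(k < n) x k) (csum x).
Proof. by move=> h; rewrite /csum; case: xgetP => [y _ //|/(_ l)]. Qed.

Lemma geom_csum x K q : 0 <= q < 1 -> 0 <= K -> geom_bounded x K q ->
  cvgC (fun n => \sum_(k < n) x k) (csum x).
Proof. by move=> a b c; have [l hl _] := geom_cvgC a b c; exact: csumP hl. Qed.

Lemma geom_csum_tail x K q n : 0 <= q < 1 -> 0 <= K -> geom_bounded x K q ->
  normc (csum x - \sum_(k < n) x k) <= K * (q ^+ n / (1 - q)).
Proof.
move=> a b c; have [l hl h] := geom_cvgC a b c.
by rewrite (cvgC_unique (csumP hl) hl).
Qed.

Lemma geom_csum_le x K q : 0 <= q < 1 -> 0 <= K -> geom_bounded x K q ->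
  normc (csum x) <= K / (1 - q).
Proof.
by move=> a b c; have := geom_csum_tail 0 a b c; rewrite big_ord0 subr0 expr0 mul1r.
Qed.

(** The m-th partial sums by rows and by columns both differ from the sum over the m by m square by
    geometrically small tails, so they share their limit. *)
Lemma double_geom_sum (A : nat -> nat -> C) (K q t : R) (r s : nat -> C) l :
  0 <= q < 1 -> 0 <= t < 1 -> 0 <= K ->
  (forall n k, normc (A n k) <= K * q ^+ n * t ^+ k) ->
  (forall n, cvgC (fun m => \sum_(k < m) A n k) (r n)) ->
  (forall k, cvgC (fun m => \sum_(n < m) A n k) (s k)) ->
  cvgC (fun n => \sum_(i < n) r i) l -> cvgC (fun n => \sum_(i < n) s i) l.
Proof.
move=> q01 t01 K0 hA hr hs hl.
have /andP[q0 q1] := q01; have /andP[t0 t1] := t01.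
have q1' : 0 < 1 - q by rewrite subr_gt0.
have t1' : 0 < 1 - t by rewrite subr_gt0.
pose B := K / ((1 - q) * (1 - t)).
have B0 : 0 <= B by rewrite divr_ge0 // mulr_ge0 // ltW.
have tailr n m : normc (r n - \sum_(k < m) A n k) <= K * q ^+ n * (t ^+ m / (1 - t)).
  have h : geom_bounded (A n) (K * q ^+ n) t by move=> k; exact: hA.
  have Kq : 0 <= K * q ^+ n by rewrite mulr_ge0 ?exprn_ge0.
  rewrite (cvgC_unique (hr n) (geom_csum t01 Kq h)); exact: geom_csum_tail.
have tails k m : normc (s k - \sum_(n < m) A n k) <= K * t ^+ k * (q ^+ m / (1 - q)).
  have h : geom_bounded (A ^~ k) (K * t ^+ k) q by move=> n; rewrite mulrAC; exact: hA.
  have Kq : 0 <= K * t ^+ k by rewrite mulr_ge0 ?exprn_ge0.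
  rewrite (cvgC_unique (hs k) (geom_csum q01 Kq h)); exact: geom_csum_tail.
have sumle (v : R) m : 0 <= v < 1 -> \sum_(i < m) v ^+ i <= (1 - v)^-1.
  by move=> v01; have := sum_geom_le 0 m v01; rewrite add0n big_mkord expr0 mul1r.
have diff m : normc (\sum_(i < m) r i - \sum_(i < m) s i) <= B * t ^+ m + B * q ^+ m.
  have -> : \sum_(i < m) r i - \sum_(i < m) s i =
     \sum_(i < m) (r i - \sum_(k < m) A i k) + - \sum_(k < m) (s k - \sum_(n < m) A n k).
    rewrite !sumrB opprB [X in _ = _ - _ + (X - _)]exchange_big /=; ring.
  rewrite (le_trans (le_normcD _ _)) // normcN lerD //.
    rewrite (le_trans (normc_sum _ _ _)) //.
    apply: (@le_trans _ _ (\sum_(i < m) q ^+ i * (K * (t ^+ m / (1 - t))))).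
      by apply: ler_sum => i _; rewrite (le_trans (tailr _ _)) // [leRHS]mulrCA -[leLHS]mulrA.
    rewrite -mulr_suml (le_trans (ler_wpM2r _ (sumle q m q01))) //.
      by rewrite !mulr_ge0 ?exprn_ge0 ?invr_ge0 // ltW.
    rewrite /B le_eqVlt; apply/orP; left; apply/eqP; field.
    by rewrite !gt_eqF.
  rewrite (le_trans (normc_sum _ _ _)) //.
  apply: (@le_trans _ _ (\sum_(i < m) t ^+ i * (K * (q ^+ m / (1 - q))))).
    by apply: ler_sum => i _; rewrite (le_trans (tails _ _)) // [leRHS]mulrCA -[leLHS]mulrA.
  rewrite -mulr_suml (le_trans (ler_wpM2r _ (sumle t m t01))) //.
    by rewrite !mulr_ge0 ?exprn_ge0 ?invr_ge0 // ltW.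
  rewrite /B le_eqVlt; apply/orP; left; apply/eqP; field.
  by rewrite !gt_eqF.
move=> e e0; have e2 : 0 < e / 2 by rewrite divr_gt0.
have e4 : 0 < e / 4 / (B + 1) by rewrite !divr_gt0 // ltr_wpDl.
have [N hN] := hl _ e2.
have [N1 h1] := expr_small q01 e4; have [N2 h2] := expr_small t01 e4.
exists (maxn N (maxn N1 N2)) => n; rewrite !geq_max => /andP[/hN a /andP[/h1 b /h2 d]].
have hB v : v < e / 4 / (B + 1) -> 0 <= v -> B * v <= e / 4.
  move=> hv v0; apply: (@le_trans _ _ ((B + 1) * v)); first by rewrite ler_wpM2r // lerDl.
  by rewrite mulrC -ler_pdivlMr ?ltW // ltr_wpDl.
have := diff n; have := hB _ b (exprn_ge0 _ q0); have := hB _ d (exprn_ge0 _ t0) => u1 u2 u3.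
have : normc (\sum_(i < n) s i - l) <= normc (\sum_(i < n) r i - l) + normc (\sum_(i < n) r i - \sum_(i < n) s i).
  rewrite -(normcN (_ - \sum_(i < n) s i)) (le_trans _ (le_normcD _ _)) // le_eqVlt; apply/orP; left.
  by apply/eqP; congr normc; ring.
by lra.
Qed.

End ComplexSequences.

(** * Re-expansion and Cauchy's estimate for power series *)

Section PowerSeries.
Variable R : realType.
Local Notation C := R[i].
Implicit Types (a b : nat -> C) (l c h : C) (f : C -> C).

Definition pcvg a h l := cvgC (fun n => \sum_(k < n) a k * h ^+ k) l.

Definition hasPS f a c (r : R) := forall h, normc h < r -> pcvg a h (f (c + h)).

Definition pgeom a (t K : R) := forall n, normc (a n) * t ^+ n <= K.

Lemma pcvg_pgeom a h l : pcvg a h l -> exists2 K : R, 0 < K & pgeom a (normc h) K.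
Proof.
move=> ahl; have [K K0 hK] := @cvgC_terms_bounded R (fun k => a k * h ^+ k) l ahl; exists K => // n.
by rewrite -normcX -normcM.
Qed.

Lemma hasPS_pgeom f a c r t : 0 <= t < r -> hasPS f a c r -> exists2 K : R, 0 < K & pgeom a t K.
Proof.
move=> /andP[t0 tr] hf.
have ht : normc t%:C%C = t by rewrite normc_real ger0_norm.
have := hf t%:C%C; rewrite ht => /(_ tr) /pcvg_pgeom; by rewrite ht.
Qed.

Lemma pgeom_geom a (t K : R) h : 0 < t -> pgeom a t K ->
  geom_bounded (fun n => a n * h ^+ n) K (normc h / t).
Proof.
move=> t0 ha n; rewrite normcM normcX expr_div_n mulrA ler_pdivlMr ?exprn_gt0 //.
rewrite mulrAC ler_wpM2r ?exprn_ge0 ?normc_ge0 //; exact: ha.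
Qed.

Lemma pgeom_ge0 a t K : 0 <= t -> pgeom a t K -> 0 <= K.
Proof. by move=> t0 /(_ 0%N); apply: le_trans; rewrite mulr_ge0 ?normc_ge0 ?exprn_ge0. Qed.

Lemma ratio_lt1 (h : C) (t : R) : normc h < t -> 0 <= normc h / t < 1.
Proof.
move=> ht; have t0 : 0 < t by exact: le_lt_trans (normc_ge0 h) ht.
by rewrite divr_ge0 ?normc_ge0 ?(ltW t0) //= ltr_pdivrMr // mul1r.
Qed.

Lemma pgeom_pcvg a (t K : R) h : normc h < t -> pgeom a t K -> exists l, pcvg a h l.
Proof.
move=> ht ha; have t0 : 0 < t by exact: le_lt_trans (normc_ge0 h) ht.
have [l hl _] := geom_cvgC (ratio_lt1 ht) (pgeom_ge0 (ltW t0) ha) (pgeom_geom h t0 ha).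
by exists l.
Qed.

(* Coefficients at c of the function with coefficients a at 0. *)
Definition reexp a c (k : nat) : C := csum (fun n => 'C(n, k)%:R * a n * c ^+ (n - k)).

Lemma binom_geom a (t K d e : R) (n k : nat) c : 0 < t -> pgeom a t K -> 0 <= d -> 0 <= e ->
  normc c <= d -> d + e <= t ->
  normc ('C(n, k)%:R * a n * c ^+ (n - k)) * e ^+ k <= K * ((d + e) / t) ^+ n.
Proof.
move=> t0 ha d0 e0 cd det.
have K0 := pgeom_ge0 (ltW t0) ha.
case: (ltnP n k) => hk.
  rewrite bin_small // !mul0r normc0 mul0r mulr_ge0 ?exprn_ge0 ?divr_ge0 ?addr_ge0 ?(ltW t0) //.
rewrite expr_div_n mulrA ler_pdivlMr ?exprn_gt0 //.
rewrite !normcM normcX -real_natc normc_real normr_nat.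
have h1 : 'C(n, k)%:R * normc c ^+ (n - k) * e ^+ k <= (d + e) ^+ n.
  apply: (@le_trans _ _ ('C(n, k)%:R * d ^+ (n - k) * e ^+ k)).
    rewrite ler_wpM2r ?exprn_ge0 // ler_wpM2l ?ler0n // lerXn2r ?nnegrE ?normc_ge0 //.
  rewrite exprDn (bigD1 (Ordinal (hk : (k < n.+1)%N))) //= -[X in X <= _]addr0 lerD //.
    by rewrite -mulrA mulr_natl.
  by apply: sumr_ge0 => i _; rewrite mulrn_wge0 // mulr_ge0 ?exprn_ge0.
have -> : 'C(n, k)%:R * normc (a n) * normc c ^+ (n - k) * e ^+ k * t ^+ n =
  (normc (a n) * t ^+ n) * ('C(n, k)%:R * normc c ^+ (n - k) * e ^+ k) by ring.
apply: ler_pM; [by rewrite mulr_ge0 ?normc_ge0 ?exprn_ge0 // ltW|by rewrite !mulr_ge0 ?normc_ge0 ?exprn_ge0 ?normc_ge0|exact: ha|exact: h1].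
Qed.

Lemma reexp_cvg a (t K : R) c k : pgeom a t K -> normc c < t ->
  cvgC (fun m => \sum_(n < m) 'C(n, k)%:R * a n * c ^+ (n - k)) (reexp a c k).
Proof.
move=> ha ct; have t0 : 0 < t by exact: le_lt_trans (normc_ge0 c) ct.
pose e := (t - normc c) / 2; have e0 : 0 < e by rewrite divr_gt0 // subr_gt0.
have det : normc c + e < t by rewrite /e; lra.
have de0 : 0 < normc c + e by rewrite ltr_wpDl ?normc_ge0.
apply: (@geom_csum _ _ (K / e ^+ k) ((normc c + e) / t)).
- by rewrite divr_ge0 ?(ltW t0) ?(ltW de0) //= ltr_pdivrMr // mul1r.
- by rewrite divr_ge0 ?exprn_ge0 ?(pgeom_ge0 (ltW t0) ha) ?(ltW e0).
- move=> n; rewrite [leRHS]mulrAC ler_pdivlMr ?exprn_gt0 //.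
  apply: (binom_geom n k t0 ha) => //; rewrite ?normc_ge0 ?(ltW e0) ?(ltW det) //.
Qed.

Lemma reexp_bound a (t K e : R) c k : pgeom a t K -> 0 < e -> normc c + e < t ->
  normc (reexp a c k) * e ^+ k <= K / (1 - (normc c + e) / t).
Proof.
move=> ha e0 det.
have de0 : 0 < normc c + e by rewrite ltr_wpDl ?normc_ge0.
have t0 : 0 < t by exact: lt_trans det.
have K0 := pgeom_ge0 (ltW t0) ha.
rewrite -ler_pdivlMr ?exprn_gt0 // mulrAC.
apply: geom_csum_le.
- by rewrite divr_ge0 ?(ltW t0) ?(ltW de0) //= ltr_pdivrMr // mul1r.
- by rewrite divr_ge0 ?exprn_ge0 ?(ltW e0).
- move=> n; rewrite [leRHS]mulrAC ler_pdivlMr ?exprn_gt0 //.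
  by apply: (binom_geom n k t0 ha) => //; rewrite ?normc_ge0 ?(ltW e0) ?(ltW det).
Qed.

Lemma reexp_pcvg a (t K : R) c h l : pgeom a t K -> normc c + normc h < t ->
  pcvg a (c + h) l -> pcvg (reexp a c) h l.
Proof.
move=> ha cht hl.
have t0 : 0 < t by apply: le_lt_trans cht; rewrite addr_ge0 ?normc_ge0.
have K0 := pgeom_ge0 (ltW t0) ha.
pose e := (normc h + (t - normc c)) / 2.
have e0 : 0 < e by rewrite /e; have := normc_ge0 h; lra.
have he : normc h < e by rewrite /e; lra.
have det : normc c + e < t by rewrite /e; lra.
have de0 : 0 < normc c + e by rewrite ltr_wpDl ?normc_ge0.
pose A n k := ('C(n, k)%:R * a n * c ^+ (n - k)) * h ^+ k.
apply: (@double_geom_sum _ A K ((normc c + e) / t) (normc h / e) (fun n => a n * (c + h) ^+ n) (fun k => reexp a c k * h ^+ k) l) => //.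
- by rewrite divr_ge0 ?(ltW t0) ?(ltW de0) //= ltr_pdivrMr // mul1r.
- exact: ratio_lt1.
- move=> n k; rewrite /A [X in X <= _]normcM normcX (expr_div_n (normc h)) [leRHS]mulrA ler_pdivlMr ?exprn_gt0 //.
  rewrite mulrAC ler_wpM2r ?exprn_ge0 ?normc_ge0 //.
  by apply: (binom_geom n k t0 ha) => //; rewrite ?normc_ge0 ?(ltW e0) ?(ltW det).
- move=> n; apply: (@cvgC_near_const _ _ _ n.+1) => m hm.
  rewrite exprDn mulr_sumr (big_ord_widen m (fun i => a n * (c ^+ (n - i) * h ^+ i *+ 'C(n, i)))) //.
  rewrite [RHS]big_mkcond /=; apply: eq_bigr => i _; case: ifP => hi.
    by rewrite /A -mulr_natl; ring.
  by rewrite /A bin_small ?mul0r //; rewrite ltnS leqNgt in hi; move/negbFE: hi.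
- move=> k; have ct : normc c < t by have := normc_ge0 h; lra.
  rewrite mulrC; apply: cvgC_ext (cvgCM (h ^+ k) (reexp_cvg k ha ct)) => m.
  by rewrite mulr_sumr; apply: eq_bigr => n _; rewrite /A mulrC.
Qed.

(** Roots of unity replace the contour integral: for some w of order 2^j, the partial sum of length
    2^j at rho w has modulus at least |a_k| rho^k, and for large j it is within e of a value bounded
    by M. *)
Lemma cauchy_estimate a (t K rho M : R) k : pgeom a t K -> 0 < rho < t ->
  (forall w, normc w = rho -> exists2 l, pcvg a w l & normc l <= M) ->
  normc (a k) * rho ^+ k <= M.
Proof.
move=> ha /andP[r0 rt] hM.
have t0 : 0 < t by exact: lt_trans rt.
have K0 := pgeom_ge0 (ltW t0) ha.
have M0 : 0 <= M.
  have [|l _] := hM rho%:C%C; first by rewrite normc_real ger0_norm // ltW.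
  exact: le_trans (normc_ge0 _).
have q01 : 0 <= rho / t < 1 by rewrite divr_ge0 ?(ltW r0) ?(ltW t0) //= ltr_pdivrMr // mul1r.
have q1 : 0 < 1 - rho / t by case/andP: q01 => _; rewrite subr_gt0.
apply/ler_addgt0Pr => e e0.
have e1 : 0 < e * (1 - rho / t) / (K + 1) by rewrite divr_gt0 ?mulr_gt0 // ltr_wpDl.
have [N hN] := expr_small q01 e1.
pose j := maxn N k.+1.
have jN : (j <= 2 ^ j)%N by rewrite ltnW // ltn_expl.
(* Constant polynomials carry scalars, whose squared norm is then the squared modulus. *)
have [w w1 hw] := exists_unimodular_bnorm_ge j (fun i => (a i * rho%:C%C ^+ i)%:P).
have hz : normc (rho%:C%C * w) = rho.
  by rewrite normcM normc_real ger0_norm ?(ltW r0) // normc_sqn w1 sqrtr1 mulr1.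
have [l hl lM] := hM _ hz.
pose S := \sum_(i < 2 ^ j) a i * (rho%:C%C * w) ^+ i.
have bC c : bnorm c%:P = sqn c.
  by rewrite (@bnormE _ 1) ?size_polyC_leq1 // big_ord1 coefC /= divr1.
have hS : sqn (a k * rho%:C%C ^+ k) <= sqn S.
  have eS : S%:P = \sum_(i < 2 ^ j) w ^+ i *: (a i * rho%:C%C ^+ i)%:P :> {poly C}.
    rewrite /S raddf_sum; apply: eq_bigr => i _.
    by rewrite -mul_polyC -polyCM exprMn; congr polyC; ring.
  rewrite -(bC S) eS.
  apply: (le_trans _ hw).
  have kj : (k < 2 ^ j)%N by apply: leq_trans jN; rewrite leq_max ltnSn orbT.
  rewrite (bigD1 (Ordinal kj)) //= bC lerDl; apply: sumr_ge0 => i _; exact: bnorm_ge0.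
have hS2 : normc S <= M + e.
  have g : geom_bounded (fun i => a i * (rho%:C%C * w) ^+ i) K (rho / t).
    by have := pgeom_geom (rho%:C%C * w) t0 ha; rewrite hz.
  have := geom_csum_tail (2 ^ j) q01 K0 g; rewrite -/S.
  rewrite (cvgC_unique (geom_csum q01 K0 g) hl) => h1.
  have h2 : K * ((rho / t) ^+ (2 ^ j) / (1 - rho / t)) <= e.
    rewrite mulrA ler_pdivrMr //.
    have h3 := hN (2 ^ j)%N (leq_trans (leq_maxl _ _) jN).
    apply: (@le_trans _ _ ((K + 1) * (rho / t) ^+ (2 ^ j))).
      by rewrite ler_wpM2r ?exprn_ge0 ?lerDl //; case/andP: q01.
    by rewrite mulrC -ler_pdivlMr ?(ltW h3) // ltr_wpDl.
  have h4 := normcB_ge S l; rewrite -(normcN (S - l)) opprB in h4; lra.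
apply: (le_trans _ hS2).
rewrite -(ger0_norm (ltW r0)) -normc_real -normcX -normcM.
by rewrite normc_le_sqn ?normc_ge0 // sqr_normc_sqn.
Qed.

(** Cauchy's estimate with M = 0, applied to the difference of the two series. *)
Lemma pcvg_unique a b (eta : R) : 0 < eta ->
  (forall h, normc h < eta -> exists2 l, pcvg a h l & pcvg b h l) -> forall k, a k = b k.
Proof.
move=> eta0 hab k.
pose d n := a n - b n.
have hd h : normc h < eta -> pcvg d h 0.
  move=> /hab[l ha hb]; have := cvgCD ha (cvgCM (-1) hb); rewrite mulN1r subrr.
  apply: cvgC_ext => n; rewrite mulN1r -sumrB; apply: eq_bigr => i _; by rewrite /d mulrBl.
have e2 : 0 <= eta / 2 < eta by rewrite divr_ge0 ?(ltW eta0) //=; lra.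
have [K K0 hK] : exists2 K : R, 0 < K & pgeom d (eta / 2) K.
  by apply: (@hasPS_pgeom (fun=> 0) d 0 eta) => // h /hd.
have := @cauchy_estimate d (eta / 2) K (eta / 4) 0 k hK.
have -> : 0 < eta / 4 < eta / 2 by apply/andP; split; lra.
have h0 w : normc w = eta / 4 -> exists2 l, pcvg d w l & normc l <= 0.
  by move=> hw; exists 0; [apply: hd; rewrite hw; lra|rewrite normc0].
move=> /(_ isT h0) h1.
have p0 : 0 < (eta / 4) ^+ k by rewrite exprn_gt0 // divr_gt0.
have : normc (d k) = 0.
  apply/eqP; rewrite eq_le normc_ge0 andbT.
  by rewrite -(@ler_pM2r _ ((eta / 4) ^+ k)) // mul0r.
by move/eq0_normc/eqP; rewrite /d subr_eq0 => /eqP.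
Qed.

End PowerSeries.

(** * Enlarging the disc of a Taylor expansion *)

Section PowerSeriesExtension.
Variable R : realType.
Local Notation C := R[i].
Implicit Types (a b : nat -> C) (l c h z : C) (f : C -> C).

Lemma hasPS_sub f a c (r s : R) : s <= r -> hasPS f a c r -> hasPS f a c s.
Proof. by move=> sr hf h hs; apply: hf; exact: lt_le_trans sr. Qed.

Lemma hasPS_reexp f a c0 (t K r : R) c : pgeom a t K -> t <= r -> hasPS f a c0 r -> normc c < t ->
  hasPS f (reexp a c) (c0 + c) (t - normc c).
Proof.
move=> ha tr hf ct h hh; apply: (reexp_pcvg ha); first by rewrite -ltrBrDl.
rewrite -addrA; apply: hf; apply: (le_lt_trans (le_normcD _ _)).
by apply: lt_le_trans tr; rewrite -ltrBrDl.
Qed.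

Lemma hasPS_unique f a b c (r : R) : 0 < r -> hasPS f a c r -> hasPS f b c r -> forall k, a k = b k.
Proof. by move=> r0 ha hb; apply: (pcvg_unique r0) => h hh; exists (f (c + h)); [exact: ha|exact: hb]. Qed.

(** The local expansions on the circle of radius rho' control f^(k)/k! there by M/del^k. Cauchy's
    estimate for w^k f^(k)(w)/k! gives C(n,k) |a_n| rho'^(n-k) del^k <= M, and summation over k with
    weights 2^(-k) gives |a_n| (rho' + del/2)^n <= 2 M. So the series at 0 converges beyond rho, and
    comparison at points of the circle shows that its sum is still f. *)
Lemma hasPS_step f a (rho del M : R) : 0 < rho -> 0 < del ->
  hasPS f a 0 rho ->
  (forall c, normc c < rho -> exists2 b, hasPS f b c del & pgeom b del M) ->
  hasPS f a 0 (rho + del / 4).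
Proof.
move=> rho0 del0 ha hloc.
(* Within del/8 of rho, so that rho' + del/2 exceeds rho + del/4; the alternative rho/2 keeps it
   positive. *)
pose rho' := Num.max (rho - del / 8) (rho / 2).
have rho'0 : 0 < rho' by rewrite lt_max; apply/orP; right; rewrite divr_gt0.
have rho'1 : rho' < rho by rewrite gt_max; apply/andP; split; lra.
have rho'2 : rho - del / 8 <= rho' by rewrite le_max lexx.
clearbody rho'.
pose t := (rho + rho') / 2.
have tt : 0 <= t < rho by apply/andP; split; rewrite /t; lra.
have [K K0 hK] := hasPS_pgeom tt ha.
have [trho t0] : t <= rho /\ rho' < t by split; rewrite /t; lra.
have coef c : normc c = rho' -> forall b, hasPS f b c del -> forall k, reexp a c k = b k.
  move=> hc b hb.
  have h1 := hasPS_reexp hK trho ha (_ : normc c < t); rewrite hc add0r in h1.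
  have m0 : 0 < Num.min (t - rho') del by rewrite lt_min subr_gt0 t0.
  apply: (@hasPS_unique f _ _ c _ m0).
    by apply: hasPS_sub (h1 t0); rewrite ge_min lexx.
  by apply: hasPS_sub hb; rewrite ge_min lexx orbT.
have est n k : (k <= n)%N -> 'C(n, k)%:R * normc (a n) * rho' ^+ (n - k) * del ^+ k <= M.
  move=> kn.
  (* The coefficients of w^k f^(k)(w)/k!, that is, of w^k times the k-th coefficient of the
     re-expansion at w. *)
  pose d i := 'C(i, k)%:R * a i.
  pose e := (t - rho') / 2; have e0 : 0 < e by rewrite /e; lra.
  have dg : pgeom d (rho' + e) (K / e ^+ k * (rho' + e) ^+ k).
    move=> i.
    have t00 : 0 < t by lra.
    case: (ltnP i k) => hi.
      rewrite /d bin_small // mul0r normc0 mul0r !mulr_ge0 ?invr_ge0 ?exprn_ge0 //; lra.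
    have re0 : 0 <= rho' + e by lra.
    have := @binom_geom _ a t K (rho' + e) e i k (rho' + e)%:C%C t00 hK re0 (ltW e0).
    rewrite normc_real (ger0_norm re0) => /(_ (lexx _)).
    have -> : rho' + e + e = t by rewrite /e; lra.
    rewrite divff ?gt_eqF // expr1n mulr1 => /(_ (lexx _)) h.
    rewrite -[in X in X <= _](subnK hi) exprD mulrA ler_wpM2r ?exprn_ge0 //.
    rewrite ler_pdivlMr ?exprn_gt0 //.
    move: h; rewrite (normcM _ (_ ^+ _)) normcX normc_real (ger0_norm re0).
    by rewrite subnK.
  have dM w : normc w = rho' -> exists2 l, pcvg d w l & normc l <= rho' ^+ k * (M / del ^+ k).
    move=> hw; exists (w ^+ k * reexp a w k).
      have wt : normc w < t by rewrite hw.
      apply: cvgC_ext (cvgCM (w ^+ k) (reexp_cvg k hK wt)) => m.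
      rewrite mulr_sumr; apply: eq_bigr => i _; rewrite /d.
      case: (ltnP i k) => hi; first by rewrite bin_small // !mul0r mulr0.
      have -> : w ^+ i = w ^+ (i - k) * w ^+ k by rewrite -exprD subnK.
      by ring.
    have [|b hb hbM] := hloc w; first by rewrite hw.
    rewrite normcM normcX hw ler_wpM2l ?exprn_ge0 ?(ltW rho'0) // (coef _ hw _ hb).
    by rewrite ler_pdivlMr ?exprn_gt0.
  have re : 0 < rho' < rho' + e by apply/andP; split; lra.
  have := cauchy_estimate n dg re dM.
  rewrite /d normcM -real_natc normc_real normr_nat mulrA ler_pdivlMr ?exprn_gt0 //.
  have -> : rho' ^+ n = rho' ^+ (n - k) * rho' ^+ k by rewrite -exprD subnK.
  rewrite [X in _ <= X]mulrC.
  set x := 'C(n, k)%:R * normc (a n).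
  have -> : x * (rho' ^+ (n - k) * rho' ^+ k) * del ^+ k = (x * rho' ^+ (n - k) * del ^+ k) * rho' ^+ k by ring.
  by rewrite ler_pM2r ?exprn_gt0.
have geo : pgeom a (rho' + del / 2) (2 * M).
  move=> n.
  have -> : normc (a n) * (rho' + del / 2) ^+ n =
     \sum_(k < n.+1) ('C(n, k)%:R * normc (a n) * rho' ^+ (n - k) * del ^+ k) * 2^-1 ^+ k.
    rewrite exprDn mulr_sumr; apply: eq_bigr => k _.
    by rewrite exprMn -mulr_natl; ring.
  have M0 : 0 <= M.
    by apply: le_trans (est 0%N 0%N (leqnn _)); rewrite !mulr_ge0 ?normc_ge0.
  apply: (@le_trans _ _ (\sum_(k < n.+1) M * 2^-1 ^+ k)).
    apply: ler_sum => k _; rewrite ler_wpM2r ?exprn_ge0 ?invr_ge0 //.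
    by apply: est; rewrite -ltnS.
  rewrite -mulr_sumr mulrC ler_wpM2r //.
  have h2 : 0 <= (2^-1 : R) < 1 by apply/andP; split; lra.
  have := sum_geom_le 0 n.+1 h2; rewrite add0n big_mkord expr0 mul1r.
  by have -> : (1 - 2^-1)^-1 = 2 :> R by field.
move=> z hz; rewrite add0r.
case: (ltP (normc z) rho) => hzr; first by have := ha z hzr; rewrite add0r.
have z0 : 0 < normc z by exact: lt_le_trans hzr.
(* The radial projection of z to the circle of radius rho'. As |z - c| = |z| - rho' < del, both the
   local expansion and the re-expansion at c converge at z. *)
pose c := (rho' / normc z)%:C%C * z.
have nc : normc c = rho'.
  by rewrite normcM normc_real ger0_norm ?divr_ge0 ?(ltW rho'0) ?(ltW z0) // divfK // gt_eqF.
have nzc : normc (z - c) = normc z - rho'.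
  have -> : z - c = (1 - rho' / normc z)%:C%C * z by rewrite rmorphB mulrBl mul1r.
  rewrite normcM normc_real ger0_norm; last first.
    by rewrite subr_ge0 ler_pdivrMr // mul1r; lra.
  by rewrite mulrBl mul1r divfK // gt_eqF.
have zt : normc z < rho' + del / 2 by lra.
have [l hl] := pgeom_pcvg zt geo.
have [|b hb hbM] := hloc c; first by rewrite nc.
have h1 : pcvg (reexp a c) (z - c) l.
  apply: (reexp_pcvg geo); first by rewrite nc nzc; lra.
  by rewrite addrC subrK.
have h2 : pcvg b (z - c) (f z).
  have -> : f z = f (c + (z - c)) by rewrite addrC subrK.
  by apply: hb; rewrite nzc; lra.
have h3 : pcvg (reexp a c) (z - c) (f z).
  by apply: cvgC_ext h2 => n; apply: eq_bigr => k _; rewrite (coef _ nc _ hb).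
by rewrite -(cvgC_unique h1 h3).
Qed.

(** Each step gains del/4 whatever the current radius, so finitely many steps pass r. *)
Lemma hasPS_extend f a (r0 r del M : R) : 0 < r0 -> 0 < del -> hasPS f a 0 r0 ->
  (forall c, normc c <= r -> exists2 b, hasPS f b c del & pgeom b del M) ->
  exists2 r', r < r' & hasPS f a 0 r'.
Proof.
move=> r00 del0 ha hloc.
have H n : exists2 rho, 0 < rho & hasPS f a 0 rho /\ (r < rho \/ r0 + n%:R * (del / 4) <= rho).
  elim: n => [|n [rho rho0 [h1 h2]]].
    by exists r0 => //; split => //; right; rewrite mul0r addr0.
  case: (ltP r rho) => hr; first by exists rho => //; split => //; left.
  exists (rho + del / 4); first by rewrite addr_gt0 // divr_gt0.
  split.
    apply: (hasPS_step rho0 del0 h1) => c hc; apply: hloc; exact: le_trans (ltW hc) hr.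
  right; case: h2 => [h2|h2]; first by rewrite ltNge hr in h2.
  by rewrite -natr1; lra.
have d4 : 0 < del / 4 by rewrite divr_gt0.
have [rho _ [h1 [h2|h2]]] := H (Num.truncn (`|r| / (del / 4))).+1; exists rho => //.
have h3 : `|r| < (Num.truncn (`|r| / (del / 4))).+1%:R * (del / 4).
  by rewrite -ltr_pdivrMr //; exact: truncnS_gt.
by have := ler_norm r; lra.
Qed.

End PowerSeriesExtension.

(** * From local analyticity to one Taylor series *)

Section AnalyticPowerSeries.
Variable R : realType.
Local Notation C := R[i].
Implicit Types (a b : nat -> C) (l c h z : C) (f : C -> C).

Lemma normc_normr (z : Cplx R) : `|z| = (normc z)%:C%C.
Proof. by []. Qed.

Lemma cvgC_of_cvg (s : nat -> Cplx R) (l : Cplx R) : s @ \oo --> l -> cvgC s l.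
Proof.
move=> /cvgrPdist_lt h e e0.
have e0' : 0 < e%:C%C :> R[i] by rewrite ltcR.
have [N _ hN] := h _ e0'.
exists N => n /hN /=; rewrite normc_normr ltcR -normcN opprB //.
Qed.

Lemma cvg_of_cvgC (s : nat -> Cplx R) (l : Cplx R) : cvgC s l -> s @ \oo --> l.
Proof.
move=> h; apply/cvgrPdist_lt => e e0.
have ee : e = (complex.Re e)%:C%C by rewrite RRe_real // gtr0_real.
have [N hN] := h (complex.Re e) ltac:(by rewrite -ltcR -ee).
exists N => // n /hN /= hn; rewrite ee normc_normr ltcR -normcN opprB //.
Qed.

Lemma analytic_at_hasPS f c : analytic_at f c -> exists a, exists2 r : R, 0 < r & hasPS f a c r.
Proof.
move=> [a [r [r0 h]]]; exists a, r => // z zr; rewrite /pcvg.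
have := h (c + z); rewrite addrAC subrr add0r => /(_ zr) /cvgC_of_cvg.
by apply: cvgC_ext => n; rewrite seriesEord.
Qed.

(** Moving the centre by less than r/8 and keeping the new radius at most r/8 holds the geometric
    ratio at 1/2 or less, which yields the uniform bound 2 K. *)
Lemma hasPS_near f a c0 (r : R) : 0 < r -> hasPS f a c0 r ->
  exists2 t : R, 0 < t & exists M0 : R, forall c del M, normc (c - c0) < t ->
    0 < del -> del <= t -> M0 <= M -> exists2 b, hasPS f b c del & pgeom b del M.
Proof.
move=> r0 hf; pose t := r / 2.
have tr : 0 <= t < r by apply/andP; split; rewrite /t; lra.
have t0 : 0 < t by rewrite /t; lra.
have [K K0 hK] := hasPS_pgeom tr hf.
exists (t / 4); first by rewrite divr_gt0.
exists (2 * K) => c del M ct d0 dt MK.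
have h1 : normc (c - c0) + del < t by lra.
exists (reexp a (c - c0)).
  have ct' : normc (c - c0) < t by lra.
  have := hasPS_reexp hK (ltW (proj2 (andP tr))) hf ct'.
  have -> : c0 + (c - c0) = c by rewrite addrC subrK.
  by apply: hasPS_sub; lra.
move=> k; apply: (le_trans (reexp_bound k hK d0 h1)); apply: le_trans MK.
have h2 : (normc (c - c0) + del) / t <= 1 / 2 by rewrite ler_pdivrMr //; lra.
rewrite mulrC ler_pM2r // invf_ple ?posrE //; lra.
Qed.

Lemma compact_plane_disc (r : R) : compact [set p : R * R | p.1 ^+ 2 + p.2 ^+ 2 <= r ^+ 2].
Proof.
apply: (@subclosed_compact _ _ (`[- `|r|, `|r|]%classic `*` `[- `|r|, `|r|]%classic)).
- apply: (@preimage_closed _ _ (fun p : R * R => p.1 ^+ 2 + p.2 ^+ 2) [set x | x <= r ^+ 2]); last exact: closed_le.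
  move=> p _; apply: cvgD.
    by apply: (@cvg_comp _ _ _ fst (fun x => x ^+ 2) _ _ _ cvg_fst); exact: exprn_continuous.
  by apply: (@cvg_comp _ _ _ snd (fun x => x ^+ 2) _ _ _ cvg_snd); exact: exprn_continuous.
- by apply: compact_setX; exact: segment_compact.
- move=> p /= hp; have h1 := sqr_ge0 p.1; have h2 := sqr_ge0 p.2.
  split; rewrite /= in_itv /= -ler_norml -ler_sqr ?nnegrE // !real_normK ?num_real //; lra.
Qed.

(** Compactness of the closed disc. A single n encodes the radius 1/(n+1) and the bound n together,
    so validity for all large n near each point becomes validity for one n everywhere. *)
Lemma analytic_uniform f (r : R) : 0 <= r -> (forall c, normc c <= r -> analytic_at f c) ->
  exists2 del : R, 0 < del & exists M : R, forall c, normc c <= r ->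
    exists2 b, hasPS f b c del & pgeom b del M.
Proof.
move=> r0 hf.
have := (compact_near_coveringP _).1 (@compact_plane_disc r) => hK.
pose P (n : nat) (p : R * R) := exists2 b, hasPS f b (p.1 +i* p.2)%C (n.+1%:R^-1) & pgeom b n.+1%:R^-1 n%:R.
have [|N _ hN] := hK nat \oo P _.
  move=> p hp; pose c0 : C := (p.1 +i* p.2)%C.
  have /hf/analytic_at_hasPS [a [rho rho0 ha]] : normc c0 <= r.
    by rewrite normc_le_sqn // /sqn /cdot /= -!expr2.
  have [t t0 [M0 ht]] := hasPS_near rho0 ha.
  have tt2 : 0 < t / 2 by rewrite divr_gt0.
  exists (ball p (t / 2), [set n | t^-1 <= n%:R /\ M0 <= n%:R]).
    split; first exact: nbhsx_ballx.
    exists (maxn (Num.truncn t^-1).+1 (Num.truncn M0).+1) => //= n /=; rewrite geq_max => /andP[h1 h2].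
    split; apply: ltW; [apply: (lt_le_trans (truncnS_gt _))|apply: (lt_le_trans (truncnS_gt _))]; by rewrite ler_nat.
  move=> [q n] /= [[b1 b2] [n1 n2]].
  apply: ht => //.
    apply: (le_lt_trans (normc_le_ReIm _)) => /=.
    move: b1 b2; rewrite /ball /= => b1 b2.
    rewrite (splitr t) ltrD // distrC //.
  rewrite -[leRHS]invrK lef_pV2 ?posrE ?invr_gt0 //.
  by rewrite (le_trans n1) // ler_nat.
exists (N.+1%:R^-1); first by rewrite invr_gt0.
exists N%:R => c hc; have := hN N (leqnn N) (complex.Re c, complex.Im c).
rewrite /P /=; case: c hc => x y hc; apply.
by move: hc; rewrite normc_le_sqn // /sqn /cdot /= -!expr2.
Qed.

Lemma analytic_closed_disc_hasPS f (r : R) : 0 <= r -> (forall c, normc c <= r -> analytic_at f c) ->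
  exists a, exists2 r' : R, r < r' & hasPS f a 0 r'.
Proof.
move=> r0 hf; have [del d0 [M hM]] := analytic_uniform r0 hf.
have [|a [r1 r10 ha]] := @analytic_at_hasPS f 0; first by apply: hf; rewrite normc0.
by have [r' rr' ha'] := hasPS_extend r10 d0 ha hM; exists a, r'.
Qed.

Lemma analytic_open_disc_hasPS f (r : R) : 0 < r -> (forall c, normc c < r -> analytic_at f c) ->
  exists a, hasPS f a 0 r.
Proof.
move=> r0 hf.
have [|a [r1 r10 ha]] := @analytic_at_hasPS f 0; first by apply: hf; rewrite normc0.
exists a => h hr.
have [del d0 [M hM]] := analytic_uniform (normc_ge0 h) (fun c hc => hf c (le_lt_trans hc hr)).
by have [r' rr' ha'] := hasPS_extend r10 d0 ha hM; exact: ha'.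
Qed.

End AnalyticPowerSeries.

(** * Bergman functions and their coefficients *)

Section BergmanCoefficients.
Variable R : realType.
Local Notation C := R[i].
Local Notation plane := (measurableTypeR R * measurableTypeR R)%type.
Local Notation lam2 := ((@lebesgue_measure R) \x (@lebesgue_measure R))%E.
Local Notation D := (drad (1 : R)).
Implicit Types (a : nat -> C) (f : C -> C) (F : plane -> C).

Lemma disc2E : @disc2 R = D.
Proof.
apply/seteqP; split => p; rewrite /disc2 /disc /drad /= normc_normr expr1n -sqn_toC.
  by rewrite (ltcR _ 1) normc_lt_sqn ?ler01 // expr1n.
by move=> h; rewrite (ltcR _ 1) normc_lt_sqn ?ler01 // expr1n.
Qed.

Lemma drad_normc (r : R) (p : plane) : 0 <= r -> drad r p = (normc (toC p : C) < r) :> Prop.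
Proof. by move=> r0; rewrite normc_lt_sqn // sqn_toC. Qed.

Lemma disc_integralE (g : C -> C) :
  disc_integral g = (pi^-1)%:C%C * cint lam2 D (fun p => g (toC p)).
Proof.
rewrite /disc_integral disc2E /cint; apply/eqP; rewrite eq_complex /=.
by apply/andP; split; apply/eqP; ring.
Qed.

Definition trunc a N : {poly C} := \poly_(k < N) a k.
(** Partial sums of the squared Bergman norm. A bound uniform in N expresses finiteness of the norm
    without forming the infinite sum. *)
Definition psq a N : R := \sum_(n < N) sqn (a n) / n.+1%:R.

Lemma coef_trunc a N n : (trunc a N)`_n = if (n < N)%N then a n else 0.
Proof. by rewrite coef_poly. Qed.

Lemma size_trunc a N : (size (trunc a N) <= N)%N.
Proof. exact: size_poly. Qed.

Lemma horner_trunc a N z : (trunc a N).[z] = \sum_(k < N) a k * z ^+ k.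
Proof. by rewrite horner_poly. Qed.

Lemma bnorm_trunc a N : bnorm (trunc a N) = psq a N.
Proof.
rewrite (@bnormE _ N) ?size_trunc //; apply: eq_bigr => i _; by rewrite coef_trunc ltn_ord.
Qed.

Lemma psq_ge0 a N : 0 <= psq a N.
Proof. by rewrite -bnorm_trunc bnorm_ge0. Qed.

Lemma psq_le a N M : (N <= M)%N -> psq a N <= psq a M.
Proof.
move=> h; rewrite /psq -!(big_mkord xpredT (fun n => sqn (a n) / n.+1%:R)).
rewrite (big_cat_nat (leq0n N) h) /= lerDl; apply: sumr_ge0 => i _.
by rewrite divr_ge0 ?sqn_ge0 ?ler0n.
Qed.

Lemma hasPS0_disc f a (r : R) z : hasPS f a 0 r -> normc z < r ->
  cvgC (fun N => (trunc a N).[z]) (f z).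
Proof.
move=> hf hz; have := hf z hz; rewrite add0r; apply: cvgC_ext => N.
by rewrite horner_trunc.
Qed.

Lemma cvgC_ReIm (s : nat -> C) (l : C) : cvgC s l ->
  (fun n => complex.Re (s n)) @ \oo --> complex.Re l /\
  (fun n => complex.Im (s n)) @ \oo --> complex.Im l.
Proof.
move=> h; split; apply/cvgrPdist_lt => e e0; have [N hN] := h e e0; exists N => // n /hN /= hn.
  by rewrite distrC -Re_sub (le_lt_trans (normr_Re_le _)).
by rewrite distrC -Im_sub (le_lt_trans (normr_Im_le _)).
Qed.

Lemma cmeasurable_cvg (F_ : nat -> plane -> C) F : (forall n, cmeasurable D (F_ n)) ->
  (forall p, D p -> cvgC (F_ ^~ p) (F p)) -> cmeasurable D F.
Proof.
move=> mF cF; split.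
- apply: (@measurable_fun_cvg _ _ R D (fun n p => complex.Re (F_ n p))) => [n|p Dp].
    by case: (mF n).
  by case: (cvgC_ReIm (cF p Dp)).
- apply: (@measurable_fun_cvg _ _ R D (fun n p => complex.Im (F_ n p))) => [n|p Dp].
    by case: (mF n).
  by case: (cvgC_ReIm (cF p Dp)).
Qed.

Lemma cmeasurable_horner (f : {poly C}) : cmeasurable D (fun p => f.[toC p : C]).
Proof. by case: (bmf_horner 1 f). Qed.

Lemma cmeasurable_hasPS f a : hasPS f a 0 1 -> cmeasurable D (fun p => f (toC p)).
Proof.
move=> hf; apply: (@cmeasurable_cvg (fun N p => (trunc a N).[toC p : C])) => [n|p Dp].
  exact: cmeasurable_horner.
by apply: (hasPS0_disc hf); rewrite -drad_normc.
Qed.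

Lemma cvg_sqn (s : nat -> C) (l : C) : cvgC s l -> (fun n => sqn (s n)) @ \oo --> sqn l.
Proof.
move=> h; have [hR hI] := cvgC_ReIm h; rewrite /sqn /cdot.
by apply: cvgD; apply: cvgM.
Qed.

Lemma sqn_fatou (F_ : nat -> plane -> C) F (B : R) N : (forall n, cmeasurable D (F_ n)) ->
  (forall p, D p -> cvgC (F_ ^~ p) (F p)) ->
  (forall n, (N <= n)%N -> (\int[lam2]_(p in D) (sqn (F_ n p))%:E <= B%:E)%E) ->
  (\int[lam2]_(p in D) (sqn (F p))%:E <= B%:E)%E.
Proof.
move=> mF cF hB.
have mD := @measurable_drad R 1.
pose u n p : \bar R := (sqn (F_ (n + N)%N p))%:E.
have e : (\int[lam2]_(p in D) (sqn (F p))%:E = \int[lam2]_(p in D) limn_einf (u ^~ p))%E.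
  apply: eq_integral => p /set_mem Dp.
  have cu : u ^~ p @ \oo --> (sqn (F p))%:E.
    apply: cvg_EFin; first by near=> n.
    have := cvg_sqn (cF p Dp); rewrite -(cvg_shiftn N); exact.
  by rewrite is_cvg_limn_einfE; [rewrite (cvg_lim _ cu)|apply/cvg_ex; eexists; exact: cu].
rewrite e; apply: (le_trans (fatou lam2 mD _ _)).
- by move=> n; apply/measurable_EFinP; exact: measurable_sqn.
- by move=> n p _; rewrite lee_fin sqn_ge0.
rewrite limn_einf_lim; apply: lime_le; first exact: is_cvg_einfs.
near=> n; apply: (le_trans (ereal_inf_lbound _) (hB (n + N)%N (leq_addl _ _))).
by exists n => //=.
Unshelve. all: by end_near.
Qed.

Lemma integral_sqn_horner (f : {poly C}) :
  (\int[lam2]_(p in D) (sqn f.[toC p : C])%:E = (pi * bnorm f)%:E)%E.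
Proof.
rewrite -Rintegral_sqn_bnorm /Rintegral fineK //.
apply: integrable_fin_num; [exact: measurable_drad|exact: integrable_sqn_horner].
Qed.

(** Fatou along the truncations of f, for which the integral is exactly the coefficient sum. *)
Lemma integral_sqn_tail f a N (B : R) : hasPS f a 0 1 ->
  (forall M, (N <= M)%N -> psq a M - psq a N <= B) ->
  (\int[lam2]_(p in D) (sqn (f (toC p) - (trunc a N).[toC p : C]))%:E <= (pi * B)%:E)%E.
Proof.
move=> hf hB.
apply: (@sqn_fatou (fun M p => (trunc a M - trunc a N).[toC p : C]) _ _ N).
- by move=> n; exact: cmeasurable_horner.
- move=> p Dp; apply: (@cvgC_ext _ (fun M => (trunc a M).[toC p : C] + - (trunc a N).[toC p : C])).
    by move=> M; rewrite hornerD hornerN.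
  apply: cvgCD; last exact: cvgC_const.
  by apply: (hasPS0_disc hf); rewrite -drad_normc.
- move=> M NM; rewrite integral_sqn_horner lee_fin ler_pM2l ?pi_gt0 //.
  apply: le_trans (hB M NM).
  rewrite (@bnormE _ M); last first.
    by rewrite (leq_trans (size_polyD _ _)) // geq_max size_polyN size_trunc (leq_trans (size_trunc _ _)).
  rewrite /psq -(big_mkord xpredT (fun n => sqn (trunc a M - trunc a N)`_n / n.+1%:R)).
  rewrite -!(big_mkord xpredT (fun n => sqn (a n) / n.+1%:R)).
  rewrite !(big_cat_nat (leq0n N) NM) /= big1_seq ?add0r; last first.
    move=> i; rewrite mem_index_iota => /andP[_ /andP[_ hi]].
    by rewrite coefD coefN !coef_trunc hi (leq_trans hi NM) subrr sqn0 mul0r.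
  rewrite addrAC subrr add0r; apply: ler_sum_nat => i /andP[h1 h2].
  by rewrite coefD coefN !coef_trunc h2 ltnNge h1 subr0.
Qed.

Lemma integral_sqn_hasPS f a (B : R) : hasPS f a 0 1 -> (forall N, psq a N <= B) ->
  (\int[lam2]_(p in D) (sqn (f (toC p)))%:E <= (pi * B)%:E)%E.
Proof.
move=> hf hB; have := @integral_sqn_tail f a 0%N B hf.
have -> : trunc a 0 = 0 by rewrite /trunc poly_def big_ord0.
have -> : psq a 0 = 0 by rewrite /psq big_ord0.
move=> h; have := h (fun M _ => _); under eq_integral => p _ do rewrite horner0 subr0.
by apply => M; rewrite subr0.
Qed.

End BergmanCoefficients.

(** * Coefficient bounds from the area integral *)

Section BergmanBessel.
Variable R : realType.
Local Notation C := R[i].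
Local Notation plane := (measurableTypeR R * measurableTypeR R)%type.
Local Notation lam2 := ((@lebesgue_measure R) \x (@lebesgue_measure R))%E.
Local Notation D := (drad (1 : R)).
Implicit Types (a : nat -> C) (f : C -> C).

Lemma trunc_uniform f a (r t K : R) : 0 <= r < t -> pgeom a t K -> hasPS f a 0 t ->
  forall e : R, 0 < e -> exists M : nat, forall N z, (M <= N)%N -> normc z <= r ->
    normc (f z - (trunc a N).[z]) <= e.
Proof.
move=> /andP[r0 rt] ha hf e e0.
have t0 : 0 < t by exact: le_lt_trans rt.
have K0 := pgeom_ge0 (ltW t0) ha.
have q01 : 0 <= r / t < 1 by rewrite divr_ge0 ?(ltW t0) //= ltr_pdivrMr // mul1r.
have q1 : 0 < 1 - r / t by case/andP: q01 => _; rewrite subr_gt0.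
have e1 : 0 < e * (1 - r / t) / (K + 1) by rewrite divr_gt0 ?mulr_gt0 // ltr_wpDl.
have [M hM] := expr_small q01 e1.
exists M => N z MN zr.
have g : geom_bounded (fun i => a i * z ^+ i) K (r / t).
  move=> i; apply: (le_trans (pgeom_geom z t0 ha i)).
  by rewrite ler_wpM2l // lerXn2r ?nnegrE ?divr_ge0 ?normc_ge0 ?(ltW t0) // ler_pM2r ?invr_gt0.
have zt : normc z < t by exact: le_lt_trans rt.
have hz := hf z zt; rewrite add0r in hz.
have := geom_csum_tail N q01 K0 g.
rewrite (cvgC_unique (geom_csum q01 K0 g) hz) horner_trunc => /le_trans; apply.
rewrite mulrA ler_pdivrMr //.
have h3 := hM N MN.
apply: (@le_trans _ _ ((K + 1) * (r / t) ^+ N)).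
  by rewrite ler_wpM2r ?exprn_ge0 ?lerDl //; case/andP: q01.
by rewrite mulrC -ler_pdivlMr ?(ltW h3) // ltr_wpDl.
Qed.

Lemma hasPS_uniform f a (t : R) : 1 < t -> hasPS f a 0 t ->
  forall e : R, 0 < e -> exists M : nat, forall N z, (M <= N)%N -> normc z <= 1 ->
    normc (f z - (trunc a N).[z]) <= e.
Proof.
move=> t1 hf; pose s := (1 + t) / 2.
have [K K0 hK] : exists2 K : R, 0 < K & pgeom a s K.
  by apply: hasPS_pgeom hf; rewrite /s; apply/andP; split; lra.
have hfs : hasPS f a 0 s by apply: hasPS_sub hf; rewrite /s; lra.
by apply: (trunc_uniform _ hK hfs); rewrite ler01 /s; lra.
Qed.

Lemma sqnD_le (tau : R) (x y : C) : 0 < tau -> sqn (x + y) <= (1 + tau) * sqn x + (1 + tau^-1) * sqn y.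
Proof.
move=> t0; have := @bnormD_le R tau x%:P y%:P t0.
have bC c : bnorm c%:P = sqn c :> R.
  by rewrite (@bnormE _ 1) ?size_polyC_leq1 // big_ord1 coefC /= divr1.
by rewrite -polyCD !bC.
Qed.

Lemma drad_subset (r : R) : 0 <= r <= 1 -> @drad R r `<=` D.
Proof.
move=> /andP[r0 r1] p; rewrite !drad_normc // => h; exact: lt_le_trans r1.
Qed.

(** On |z| < r the Taylor polynomials converge uniformly, so their L^2 norms there, known exactly,
    are at most that of f in the limit. *)
Lemma bessel_drad f a (B r : R) N : 0 < r < 1 -> hasPS f a 0 1 ->
  (\int[lam2]_(p in D) (sqn (f (toC p)))%:E <= (pi * B)%:E)%E ->
  \sum_(n < N) sqn (a n) * (r ^+ n.+1.*2 / n.+1%:R) <= B.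
Proof.
move=> /andP[r0 r1] hf hB.
have mD := @measurable_drad R 1; have mr := @measurable_drad R r.
have rD : @drad R r `<=` D by apply: drad_subset; rewrite !ltW.
have pi0 : 0 < pi :> R by exact: pi_gt0.
have mf : measurable_fun D (fun p : plane => sqn (f (toC p))).
  by apply: measurable_sqn; exact: cmeasurable_hasPS hf.
pose I := (\int[lam2]_(p in drad r) (sqn (f (toC p)))%:E)%E.
have hI : (I <= (pi * B)%:E)%E.
  apply: (le_trans _ hB); apply: ge0_subset_integral => //.
    exact/measurable_EFinP.
  by move=> p _; rewrite lee_fin sqn_ge0.
have B0 : 0 <= B.
  rewrite -(pmulr_rge0 _ pi0) -lee_fin; apply: (le_trans _ hB).
  by apply: integral_ge0 => p _; rewrite lee_fin sqn_ge0.
pose t := (1 + r) / 2.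
have rt : 0 <= r < t by apply/andP; split; [exact: ltW|rewrite /t; lra].
have [K K0 hK] : exists2 K : R, 0 < K & pgeom a t K.
  by apply: (hasPS_pgeom _ hf); apply/andP; split; rewrite /t; lra.
have hft : hasPS f a 0 t by apply: hasPS_sub hf; rewrite /t; lra.
suff H tau : 0 < tau -> \sum_(n < N) sqn (a n) * (r ^+ n.+1.*2 / n.+1%:R) <= (1 + tau) * B + tau.
  apply/ler_addgt0Pr => e e0.
  have B1 : 0 < B + 1 by rewrite ltr_wpDl.
  have := H (e / (B + 1)) (divr_gt0 e0 B1).
  have -> : (1 + e / (B + 1)) * B + e / (B + 1) = B + e by field; rewrite gt_eqF.
  by [].
move=> tau0.
(* Makes (1 + 1/tau) times the squared uniform error at most tau. *)
pose eta := tau / (1 + tau^-1).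
have t1 : 0 < 1 + tau^-1 by rewrite addr_gt0 // invr_gt0.
have eta0 : 0 < eta by rewrite divr_gt0.
have se0 : 0 < Num.sqrt eta by rewrite sqrtr_gt0.
have [M hM] := trunc_uniform rt hK hft se0.
pose L := maxn N M.
apply: (@le_trans _ _ (\sum_(n < L) sqn (a n) * (r ^+ n.+1.*2 / n.+1%:R))).
  rewrite -!(big_mkord xpredT (fun n => sqn (a n) * (r ^+ n.+1.*2 / n.+1%:R))).
  rewrite (big_cat_nat (leq0n N) (leq_maxl N M : (N <= L)%N)) /= lerDl; apply: sumr_ge0 => i _.
  by rewrite mulr_ge0 ?sqn_ge0 ?divr_ge0 ?exprn_ge0 ?ler0n ?(ltW r0).
rewrite -(ler_pM2l pi0).
have -> : pi * (\sum_(n < L) sqn (a n) * (r ^+ n.+1.*2 / n.+1%:R)) =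
    Rintegral lam2 (drad r) (fun p => sqn (trunc a L).[toC p : C]).
  rewrite Rintegral_sqn_horner // mulr_sumr.
  rewrite (big_ord_widen L (fun n => sqn (trunc a L)`_n * (pi * r ^+ n.+1.*2 / n.+1%:R))) ?size_trunc //.
  rewrite [RHS]big_mkcond /=; apply: eq_bigr => i _; case: ltnP => hi.
    by rewrite coef_trunc ltn_ord; ring.
  by have := nth_default 0 hi; rewrite coef_trunc ltn_ord => ->; rewrite sqn0 mul0r mulr0.
have fI : I \is a fin_num.
  by rewrite ge0_fin_numE; [exact: le_lt_trans hI (ltry _)|apply: integral_ge0 => p _; rewrite lee_fin sqn_ge0].
have iF : lam2.-integrable (drad r) (EFin \o (fun p : plane => sqn (f (toC p)))).
  apply/integrableP; split; first by apply/measurable_EFinP; exact: measurable_funS mf.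
  under eq_integral => p _ do rewrite /= ger0_norm ?sqn_ge0 //.
  exact: le_lt_trans hI (ltry _).
have ic (c : R) : lam2.-integrable (drad r) (EFin \o (fun _ : plane => c)).
  by have [] := bmf_cintegrable (bmf_cst r (c%:C%C)).
apply: (@le_trans _ _ (Rintegral lam2 (drad r) (fun p => (1 + tau) * sqn (f (toC p)) + tau))).
  apply: le_Rintegral => //; first exact: integrable_sqn_horner.
    rewrite (_ : _ \o _ = (fun p : plane => ((1 + tau)%:E * (sqn (f (toC p)))%:E + tau%:E)%E)); last first.
      by apply/funext => p /=; rewrite EFinD EFinM.
    by apply: integrableD => //; [exact: integrableZl|exact: ic].
  move=> p Dp.
  have pr : normc (toC p : C) <= r by rewrite ltW // -drad_normc // ltW.
  have := hM L _ (leq_maxr _ _) pr.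
  rewrite -normcN opprB normc_le_sqn ?(ltW se0) // sqr_sqrtr ?(ltW eta0) // => h.
  have := sqnD_le (f (toC p)) ((trunc a L).[toC p : C] - f (toC p)) tau0.
  rewrite addrC subrK => /le_trans; apply; rewrite lerD2l.
  apply: (@le_trans _ _ ((1 + tau^-1) * eta)); first by rewrite ler_pM2l.
  by rewrite /eta mulrC divfK // gt_eqF.
have iZ : lam2.-integrable (drad r) (EFin \o (fun p : plane => (1 + tau) * sqn (f (toC p)))).
  rewrite (_ : _ \o _ = (fun p : plane => ((1 + tau)%:E * (sqn (f (toC p)))%:E)%E)) //.
  exact: integrableZl.
rewrite RintegralD // RintegralZl // Rintegral_cst //.
have -> : fine (lam2 (drad r)) = pi * r ^+ 2.
  by rewrite -Rintegral_drad_cst1 // Rintegral_cst // mul1r.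
have h1 : Rintegral lam2 (drad r) (fun p : plane => sqn (f (toC p))) <= pi * B.
  by rewrite /Rintegral -lee_fin fineK.
have h2 : (1 + tau) * Rintegral lam2 (drad r) (fun p : plane => sqn (f (toC p))) <= (1 + tau) * (pi * B).
  by rewrite ler_pM2l // addr_gt0.
have h3 : tau * (pi * r ^+ 2) <= tau * pi.
  rewrite ler_pM2l // ler_piMr ?(ltW pi0) // expr_le1 ?(ltW r0) ?(ltW r1) //.
apply: (le_trans (lerD h2 h3)); move: (pi : R); clear => x.
by rewrite le_eqVlt; apply/orP; left; apply/eqP; ring.
Qed.

Lemma bernoulli_ineq (e : R) m : 0 <= e <= 1 -> 1 - m%:R * e <= (1 - e) ^+ m.
Proof.
move=> /andP[e0 e1]; elim: m => [|m IH]; first by rewrite mul0r subr0 expr0.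
rewrite exprS; apply: (@le_trans _ _ ((1 - e) * (1 - m%:R * e))).
  rewrite -natr1; have : 0 <= m%:R * e ^+ 2 by rewrite mulr_ge0 ?ler0n ?sqr_ge0.
  by rewrite expr2; lra.
by rewrite ler_wpM2l // subr_ge0.
Qed.

(** Let r = 1 - e tend to 1; Bernoulli's inequality gives r^(2(n+1)) >= 1 - 2 N e for every n <
    N. *)
Lemma bessel f a (B : R) : hasPS f a 0 1 ->
  (\int[lam2]_(p in D) (sqn (f (toC p)))%:E <= (pi * B)%:E)%E ->
  forall N, psq a N <= B.
Proof.
move=> hf hB N.
have key (e : R) : 0 < e < 1 -> (1 - N.*2%:R * e) * psq a N <= B.
  move=> /andP[e0 e1].
  have r01 : 0 < 1 - e < 1 by apply/andP; split; lra.
  apply: le_trans (bessel_drad N r01 hf hB).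
  rewrite /psq mulr_sumr; apply: ler_sum => n _.
  have -> : (1 - N.*2%:R * e) * (sqn (a n) / n.+1%:R) = sqn (a n) * ((1 - N.*2%:R * e) / n.+1%:R) by ring.
  rewrite ler_wpM2l ?sqn_ge0 // ler_wpM2r ?invr_ge0 ?ler0n //.
  apply: (@le_trans _ _ ((1 - e) ^+ N.*2)).
    by apply: bernoulli_ineq; rewrite !ltW.
  apply: ler_wiXn2l; [lra|lra|].
  by rewrite leq_double.
apply/ler_addgt0Pr => d d0.
have P0 := psq_ge0 a N.
pose S := N.*2%:R * psq a N.
have S0 : 0 <= S by rewrite mulr_ge0.
pose e := Num.min (1 / 2) (d / (S + 1)).
have S1 : 0 < S + 1 by rewrite ltr_wpDl.
have e0 : 0 < e by rewrite lt_min divr_gt0 //= divr_gt0.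
have e1 : e < 1 by rewrite gt_min; apply/orP; left; lra.
have eS : S * e <= d.
  apply: (@le_trans _ _ (S * (d / (S + 1)))); first by rewrite ler_wpM2l // ge_min lexx orbT.
  rewrite mulrA ler_pdivrMr //; lra.
have := key e; rewrite e0 e1 => /(_ isT).
have -> : (1 - N.*2%:R * e) * psq a N = psq a N - S * e by rewrite /S; ring.
by lra.
Qed.

End BergmanBessel.

(** * Toeplitz operators on Taylor coefficients *)

Section ToeplitzCoefficients.
Variable R : realType.
Local Notation C := R[i].
Local Notation plane := (measurableTypeR R * measurableTypeR R)%type.
Local Notation lam2 := ((@lebesgue_measure R) \x (@lebesgue_measure R))%E.
Local Notation D := (drad (1 : R)).
Implicit Types (a c : nat -> C) (f : C -> C) (u G : plane -> C).

Lemma normc_amgm (e : R) (x : C) : 0 < e -> normc x <= (e + sqn x / e) / 2.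
Proof.
move=> e0; rewrite ler_pdivlMr // -(ler_pM2r e0) mulrDl divfK ?gt_eqF //.
have := sqr_ge0 (normc x - e); rewrite -sqr_normc_sqn !expr2; lra.
Qed.

Lemma square_integrable u (E : R) : cmeasurable D u ->
  (\int[lam2]_(p in D) (sqn (u p))%:E <= E%:E)%E ->
  lam2.-integrable D (EFin \o (fun p => sqn (u p))).
Proof.
move=> mu hE; apply/integrableP; split; first by apply/measurable_EFinP; exact: measurable_sqn.
under eq_integral => p _ do rewrite /= ger0_norm ?sqn_ge0 //.
exact: le_lt_trans hE (ltry _).
Qed.

Lemma integrable_drad_cst (c : R) : lam2.-integrable D (EFin \o (fun _ : plane => c)).
Proof. by have [] := bmf_cintegrable (bmf_cst 1 (c%:C%C)). Qed.

Lemma cintegrable_mul u G (E M : R) : cmeasurable D u ->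
  (\int[lam2]_(p in D) (sqn (u p))%:E <= E%:E)%E ->
  cmeasurable D G -> (forall p, D p -> normc (G p) <= M) ->
  cintegrable lam2 D (fun p => u p * G p).
Proof.
move=> mu hE mG hM; have mD := @measurable_drad R 1.
have mP : cmeasurable D (fun p => u p * G p) by exact: cmeasurableM.
apply: cintegrable_normc => //.
have iS := square_integrable mu hE.
have : lam2.-integrable D (fun p => ((`|M| / 2)%:E * ((1 : R)%:E + (sqn (u p))%:E))%E).
  by apply: integrableZl => //; apply: integrableD => //; exact: integrable_drad_cst.
apply: le_integrable => //; first by apply/measurable_EFinP; exact: measurable_normc.
move=> p Dp /=; rewrite lee_fin [leLHS]ger0_norm ?normc_ge0 // ger0_norm; last first.
  by apply: mulr_ge0; [exact: divr_ge0|apply: addr_ge0 => //; exact: sqn_ge0].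
rewrite normcM mulrC -mulrA; apply: ler_pM; rewrite ?normc_ge0 //.
  exact: le_trans (hM p Dp) (ler_norm _).
by have := normc_amgm (u p) (@ltr01 R); rewrite divr1 mulrC.
Qed.

(** A form of Cauchy-Schwarz: |u| <= (e + |u|^2/e)/2, with e the L^2 size of u, makes the bound
    linear in e. *)
Lemma normc_cint_mul_le u G (e M : R) : 0 < e -> cmeasurable D u ->
  (\int[lam2]_(p in D) (sqn (u p))%:E <= (pi * e ^+ 2)%:E)%E ->
  cmeasurable D G -> (forall p, D p -> normc (G p) <= M) ->
  normc (cint lam2 D (fun p => u p * G p)) <= 2 * pi * `|M| * e.
Proof.
move=> e0 mu hE mG hM; have mD := @measurable_drad R 1.
have iu := cintegrable_mul mu hE mG hM.
apply: (le_trans (normc_cint_le mD iu)).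
have iS := square_integrable mu hE.
pose k := `|M| / 2.
have iD : lam2.-integrable D (EFin \o (fun p : plane => e + e^-1 * sqn (u p))).
  rewrite (_ : _ \o _ = (fun p : plane => (e%:E + (e^-1)%:E * (sqn (u p))%:E)%E)); last first.
    by apply/funext => p /=; rewrite EFinD EFinM.
  by apply: integrableD => //; [exact: integrable_drad_cst|exact: integrableZl].
have h1 : Rintegral lam2 D (fun p => normc (u p * G p)) <=
    Rintegral lam2 D (fun p => k * (e + e^-1 * sqn (u p))).
  apply: le_Rintegral => //; first exact: integrable_normc.
    rewrite (_ : _ \o _ = (fun p : plane => (k%:E * (e + e^-1 * sqn (u p))%:E)%E)) //.
    exact: integrableZl.
  move=> p Dp; rewrite normcM mulrC /k -mulrA; apply: ler_pM; rewrite ?normc_ge0 //.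
    exact: le_trans (hM p Dp) (ler_norm _).
  by rewrite mulrC (mulrC e^-1) normc_amgm.
have h2 : Rintegral lam2 D (fun p => sqn (u p)) <= pi * e ^+ 2.
  rewrite /Rintegral -lee_fin fineK //; exact: integrable_fin_num.
rewrite RintegralZl // RintegralD // in h1; [|exact: integrable_drad_cst|]; last first.
  rewrite (_ : _ \o _ = (fun p : plane => ((e^-1)%:E * (sqn (u p))%:E)%E)) //; exact: integrableZl.
have hc : Rintegral lam2 D (fun _ => e) = pi * e.
  rewrite Rintegral_cst // mulrC; congr (_ * _).
  by have := @Rintegral_drad_cst1 R 1 ltr01; rewrite Rintegral_cst // mul1r expr1n mulr1.
rewrite RintegralZl // hc in h1.
move: h1 h2; set I := Rintegral _ _ _; set J := Rintegral _ _ (fun p => sqn _); clearbody I J.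
have k0 : 0 <= k by rewrite divr_ge0.
have -> : `|M| = 2 * k by rewrite /k mulrC divfK.
move: (pi : R) e0 k0; clear => x e0 k0 h1 h2.
have h3 : e^-1 * J <= x * e.
  by rewrite mulrC ler_pdivrMr // -mulrA -expr2.
have h4 : k * (x * e + e^-1 * J) <= k * (x * e + x * e) by rewrite ler_wpM2l // lerD2l.
have h5 := le_trans h1 h4.
have -> : 2 * x * (2 * k) * e = 2 * (k * (x * e + x * e)) by ring.
by rewrite ler_pM2l.
Qed.

Lemma psq_tail a (B e : R) : (forall N, psq a N <= B) -> 0 < e ->
  exists N : nat, forall M, psq a M - psq a N <= e.
Proof.
move=> hB e0; have hs : has_sup (range (psq a)).
  by split; [exists (psq a 0%N); exists 0%N|exists B => _ [n _ <-]].
have [_ [N _ <-] hN] := sup_adherent e0 hs; exists N => M.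
have := ub_le_sup (proj2 hs) (imageT (psq a) M); lra.
Qed.

Lemma cint_trunc_cvg f a (B M : R) G : hasPS f a 0 1 -> (forall N, psq a N <= B) ->
  cmeasurable D G -> (forall p, D p -> normc (G p) <= M) ->
  cvgC (fun N => cint lam2 D (fun p => (trunc a N).[toC p : C] * G p))
    (cint lam2 D (fun p => f (toC p) * G p)).
Proof.
move=> hf hB mG hM e e0; have mD := @measurable_drad R 1.
have pi0 : 0 < pi :> R by exact: pi_gt0.
pose K := 2 * pi * `|M| + 1.
have K0 : 0 < K by rewrite ltr_wpDl // !mulr_ge0 // ltW.
have d0 : 0 < e / K by rewrite divr_gt0.
have [N hN] := psq_tail hB (exprn_gt0 2 d0).
exists N => n Nn.
have mf := cmeasurable_hasPS hf.
have mt := @cmeasurable_horner R (trunc a n).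
have mu : cmeasurable D (fun p => f (toC p) - (trunc a n).[toC p : C]).
  rewrite (_ : (fun p => _) = (fun p => f (toC p) + (-1) * (trunc a n).[toC p : C])).
    by apply: cmeasurableD => //; apply: cmeasurableM => //; exact: cmeasurable_cst.
  by apply/funext => p; rewrite mulN1r.
have hE : (\int[lam2]_(p in D) (sqn (f (toC p) - (trunc a n).[toC p : C]))%:E <=
   (pi * (e / K) ^+ 2)%:E)%E.
  apply: integral_sqn_tail hf _ => m nm; apply: le_trans (hN m).
  by rewrite lerD2l lerN2 psq_le.
have h := normc_cint_mul_le d0 mu hE mG hM.
have i1 : cintegrable lam2 D (fun p => (trunc a n).[toC p : C] * G p).
  by apply: bmf_cintegrable; apply: bmfM; [exact: bmf_horner|split => //; exists M].
have i2 := cintegrable_mul mu hE mG hM.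
have -> : cint lam2 D (fun p => f (toC p) * G p) =
  cint lam2 D (fun p => (f (toC p) - (trunc a n).[toC p : C]) * G p) +
  cint lam2 D (fun p => (trunc a n).[toC p : C] * G p).
  by rewrite -cintD //; apply: eq_cint => p _; rewrite -mulrDl subrK.
rewrite -normcN opprB addrK; apply: (le_lt_trans h).
rewrite mulrA ltr_pdivrMr // mulrC ltr_pM2l // /K ltrDl //.
Qed.

(** Against conj(z)^m only the coefficient of degree m survives, so the integrals for the
    truncations of f are constant once n > m. *)
Lemma moment_mul f a (B : R) (p : {poly C}) m : hasPS f a 0 1 -> (forall N, psq a N <= B) ->
  cint lam2 D (fun w => f (toC w) * (p.[toC w : C] * conjc (toC w : C) ^+ m)) =
  (\sum_(i < m.+1) p`_i * a (m - i)%N) * (pi / m.+1%:R)%:C%C.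
Proof.
move=> hf hB.
have bG : bmf 1 (fun w => p.[toC w : C] * conjc (toC w : C) ^+ m).
  by apply: bmfM; [exact: bmf_horner|apply: bmfX; apply: bmf_conj; exact: bmf_toC].
have [mG [M hM]] := bG.
apply: (cvgC_unique (cint_trunc_cvg hf hB mG hM)).
apply: (@cvgC_near_const _ _ _ m.+1) => n mn.
rewrite (@eq_cint _ _ _ _ _ _ (fun w => (p * trunc a n).[toC w : C] * conjc (toC w : C) ^+ m)).
  rewrite cint_horner_zbar // expr1n mulr1 coefM; congr (_ * _).
  by apply: eq_bigr => i _; rewrite coef_trunc ifT // (leq_ltn_trans (leq_subr _ _)).
by move=> w _; rewrite hornerM; ring.
Qed.

End ToeplitzCoefficients.

(** * The Taylor series of a Toeplitz image *)

Section ToeplitzSeries.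
Variable R : realType.
Local Notation C := R[i].
Local Notation plane := (measurableTypeR R * measurableTypeR R)%type.
Local Notation lam2 := ((@lebesgue_measure R) \x (@lebesgue_measure R))%E.
Local Notation D := (drad (1 : R)).
Implicit Types (a c : nat -> C) (f psi : C -> C) (G : plane -> C).

Lemma natmul_expr_small (q e : R) : 0 <= q < 1 -> 0 < e ->
  exists N : nat, forall n, (N <= n)%N -> n.+1%:R * q ^+ n < e.
Proof.
move=> /andP[q0 q1] e0; pose s := Num.sqrt q.
have s0 : 0 <= s by exact: sqrtr_ge0.
have s1 : s < 1 by rewrite -[ltRHS](@sqrtr1 R) ltr_sqrt.
have s01 : 0 <= s < 1 by rewrite s0.
have p : 0 < 1 - s by rewrite subr_gt0.
have [N hN] := expr_small s01 (mulr_gt0 e0 p).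
exists N => n /hN h; have -> : q = s * s by rewrite -expr2 sqr_sqrtr.
have hs : n.+1%:R * s ^+ n <= (1 - s)^-1.
  have := sum_geom_le 0 n.+1 s01; rewrite expr0 mul1r => /(le_trans _); apply.
  rewrite add0n big_mkord mulr_natl -[n.+1 in leLHS]card_ord -sumr_const; apply: ler_sum => i _.
  by apply: ler_wiXn2l; rewrite ?(ltW s1) // -ltnS.
rewrite exprMn mulrA; apply: (le_lt_trans (ler_wpM2r (exprn_ge0 _ s0) hs)).
by rewrite mulrC ltr_pdivrMr.
Qed.

Lemma kernel_sum (x : C) M :
  (1 - x) ^+ 2 * (\sum_(n < M) n.+1%:R * x ^+ n) = 1 - M.+1%:R * x ^+ M + M%:R * x ^+ M.+1.
Proof.
elim: M => [|M IH]; first by rewrite big_ord0 mulr0 expr0 mulr1 subrr mul0r addr0.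
rewrite big_ord_recr /= mulrDr IH !exprS -!natr1; ring.
Qed.

Lemma kernel_bound (x : C) (q : R) M : 0 <= q < 1 -> normc x <= q ->
  normc (((1 - x) ^+ 2)^-1 - \sum_(n < M) n.+1%:R * x ^+ n) <= 2 * (M.+1%:R * q ^+ M) / (1 - q) ^+ 2.
Proof.
move=> /andP[q0 q1] xq.
have q1' : 0 < 1 - q by rewrite subr_gt0.
have hx : 1 - q <= normc (1 - x).
  by apply: le_trans (normcB_ge _ _); rewrite normc1 lerD2l lerN2.
have x0 : (1 - x) ^+ 2 != 0.
  rewrite expf_eq0 /=; apply/eqP => e; move: hx; rewrite e normc0; lra.
have -> : ((1 - x) ^+ 2)^-1 - \sum_(n < M) n.+1%:R * x ^+ n =
    (M.+1%:R * x ^+ M - M%:R * x ^+ M.+1) / (1 - x) ^+ 2.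
  apply: (mulfI x0); rewrite mulrBr kernel_sum divff // mulrCA divff // mulr1; ring.
rewrite normcM normcV normcX; apply: ler_pM; rewrite ?normc_ge0 ?invr_ge0 ?exprn_ge0 ?normc_ge0 //.
  apply: (le_trans (le_normcD _ _)); rewrite normcN !normcM !normcX -!real_natc !normc_real !ger0_norm ?ler0n //.
  rewrite mulr_natl [leRHS]mulr2n.
  have hM : normc x ^+ M <= q ^+ M by rewrite lerXn2r ?nnegrE ?normc_ge0.
  apply: lerD; first by rewrite ler_wpM2l ?ler0n.
  apply: ler_pM; rewrite ?ler0n ?exprn_ge0 ?normc_ge0 ?ler_nat //.
  rewrite exprSr; apply: le_trans hM; rewrite ler_piMr ?exprn_ge0 ?normc_ge0 //; lra.
by rewrite lef_pV2 ?posrE ?exprn_gt0 ?(lt_le_trans q1') // lerXn2r ?nnegrE ?normc_ge0 ?(ltW q1').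
Qed.

Definition tcoef (gam : C) c a (n : nat) : C :=
  gam * (n.+1%:R / n.+2%:R * a n.+1) + \sum_(k < n.+1) c k * a (n - k)%N.

Lemma hasPS_bounded f a (t : R) : 1 < t -> hasPS f a 0 t ->
  exists2 S : R, 0 < S & forall z, normc z <= 1 -> normc (f z) <= S.
Proof.
move=> t1 hf; have [M hM] := hasPS_uniform t1 hf ltr01.
exists (1 + \sum_(k < M) normc (a k)).
  by rewrite ltr_wpDr // sumr_ge0 // => i _; rewrite normc_ge0.
move=> z z1; have := hM M z (leqnn _) z1.
have h : normc (trunc a M).[z] <= \sum_(k < M) normc (a k).
  rewrite horner_trunc (le_trans (normc_sum _ _ _)) // ler_sum // => k _.
  by rewrite normcM normcX ler_piMr ?normc_ge0 // exprn_ile1 ?normc_ge0.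
have := le_normcD (f z - (trunc a M).[z]) (trunc a M).[z]; rewrite subrK.
by move=> h1 h2; apply: (le_trans h1); apply: lerD.
Qed.

Lemma cint_uniform_cvg f a (B : R) (G_ : nat -> plane -> C) G (M : R) :
  hasPS f a 0 1 -> (forall N, psq a N <= B) ->
  cmeasurable D G -> (forall p, D p -> normc (G p) <= M) ->
  (forall n, bmf 1 (G_ n)) ->
  (forall e : R, 0 < e -> exists N : nat, forall n p, (N <= n)%N -> D p -> normc (G_ n p - G p) <= e) ->
  cvgC (fun n => cint lam2 D (fun p => f (toC p) * G_ n p)) (cint lam2 D (fun p => f (toC p) * G p)).
Proof.
move=> hf hB mG hM bG hG e e0; have mD := @measurable_drad R 1.
have B0 : 0 <= B by apply: le_trans (hB 0%N); exact: psq_ge0.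
have B1 : 0 < B + 1 by rewrite ltr_wpDl.
pose E := Num.sqrt (B + 1); have E0 : 0 < E by rewrite sqrtr_gt0.
have mf := cmeasurable_hasPS hf.
have hE : (\int[lam2]_(p in D) (sqn (f (toC p)))%:E <= (pi * E ^+ 2)%:E)%E.
  apply: integral_sqn_hasPS hf _ => N; rewrite /E sqr_sqrtr ?(ltW B1) //.
  by apply: (le_trans (hB N)); rewrite lerDl.
have pi0 : 0 < pi :> R by exact: pi_gt0.
pose K := 2 * pi * E.
have K0 : 0 < K by rewrite /K !mulr_gt0.
have d0 : 0 < e / (2 * K) by rewrite divr_gt0 ?mulr_gt0.
have [N hN] := hG _ d0; exists N => n Nn.
have [mGn [Mn hMn]] := bG n.
have i1 := cintegrable_mul mf hE mGn hMn.
have i2 := cintegrable_mul mf hE mG hM.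
have mdf : cmeasurable D (fun p => G_ n p - G p).
  rewrite (_ : (fun p => _) = (fun p => G_ n p + (-1) * G p)).
    by apply: cmeasurableD => //; apply: cmeasurableM => //; exact: cmeasurable_cst.
  by apply/funext => p; rewrite mulN1r.
have hdf p : D p -> normc (G_ n p - G p) <= e / (2 * K) by move=> Dp; exact: hN.
have i3 := cintegrable_mul mf hE mdf hdf.
have -> : cint lam2 D (fun p => f (toC p) * G_ n p) =
  cint lam2 D (fun p => f (toC p) * (G_ n p - G p)) + cint lam2 D (fun p => f (toC p) * G p).
  by rewrite -cintD //; apply: eq_cint => p _; rewrite -mulrDr subrK.
rewrite addrK; apply: (le_lt_trans (normc_cint_mul_le E0 mf hE mdf hdf)).
rewrite gtr0_norm // mulrAC -/K (_ : K * _ = e / 2); last by field; rewrite gt_eqF.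
by rewrite ltr_pdivrMr // ltr_pMr // ltr1n.
Qed.

(** For fixed z, replace psi by its n-th Taylor polynomial and the kernel by its n-th partial sum;
    both converge uniformly over the disc. The integral then equals the n-th partial sum of the
    claimed series, because truncating psi at n leaves the coefficients of degree below n intact. *)
Lemma toeplitz_hasPS (gam : C) c (t B : R) (Psi : C -> C) psi f a :
  1 < t -> hasPS psi c 0 t -> (forall z, Psi z = gam * conjc z + psi z) ->
  hasPS f a 0 1 -> (forall N, psq a N <= B) ->
  hasPS (toeplitz Psi f) (tcoef gam c a) 0 1.
Proof.
move=> t1 hpsi hPsi hf hB z z1; rewrite add0r.
have mD := @measurable_drad R 1.
pose q := normc z; have q01 : 0 <= q < 1 by rewrite normc_ge0.
have q1' : 0 < 1 - q by rewrite subr_gt0.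
pose G (p : plane) : C := Psi (toC p) * ((1 - conjc (toC p : C) * z) ^+ 2)^-1.
pose k_ n (p : plane) : C := \sum_(i < n) i.+1%:R * (conjc (toC p : C) * z) ^+ i.
pose s_ n (p : plane) : C := gam * conjc (toC p : C) + (trunc c n).[toC p : C].
have xq p : D p -> normc (conjc (toC p : C) * z) <= q.
  by rewrite drad_normc // => /ltW h; rewrite normcM normc_conj ler_piMl ?normc_ge0.
have bk n : bmf 1 (k_ n).
  elim: n => [|n IH].
    rewrite (_ : k_ 0%N = (fun=> 0)); first exact: bmf_cst.
    by apply/funext => p; rewrite /k_ big_ord0.
  rewrite (_ : k_ n.+1 = (fun p => k_ n p + n.+1%:R * (conjc (toC p : C) * z) ^+ n)).
    apply: bmfD => //; apply: bmfM; first exact: bmf_cst.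
    apply: bmfX; apply: bmfM; last exact: bmf_cst.
    by apply: bmf_conj; exact: bmf_toC.
  by apply/funext => p; rewrite /k_ big_ord_recr.
have bs n : bmf 1 (s_ n).
  apply: bmfD; last exact: bmf_horner.
  by apply: bmfM; [exact: bmf_cst|apply: bmf_conj; exact: bmf_toC].
have ksm e : 0 < e -> exists N : nat, forall n p, (N <= n)%N -> D p ->
    normc (((1 - conjc (toC p : C) * z) ^+ 2)^-1 - k_ n p) <= e.
  move=> e0; have e1 : 0 < e * (1 - q) ^+ 2 / 2 by rewrite divr_gt0 ?mulr_gt0 ?exprn_gt0.
  have [N hN] := natmul_expr_small q01 e1; exists N => n p Nn Dp.
  apply: (le_trans (kernel_bound n q01 (xq p Dp))).
  rewrite ler_pdivrMr ?exprn_gt0 // mulrC -ler_pdivlMr //; exact: ltW (hN n Nn).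
have mk : cmeasurable D (fun p : plane => ((1 - conjc (toC p : C) * z) ^+ 2)^-1).
  apply: (@cmeasurable_cvg _ k_) => [n|p Dp e e0]; first by case: (bk n).
  have e2 : 0 < e / 2 by rewrite divr_gt0.
  have [N hN] := ksm _ e2; exists N => n Nn.
  rewrite -normcN opprB; apply: (le_lt_trans (hN n p Nn Dp)).
  by rewrite ltr_pdivrMr // ltr_pMr // ltr1n.
pose kb := ((1 - q) ^+ 2)^-1; have kb0 : 0 < kb by rewrite invr_gt0 exprn_gt0.
have hkb p : D p -> normc (((1 - conjc (toC p : C) * z) ^+ 2)^-1) <= kb.
  move=> Dp.
  have hx : 1 - q <= normc (1 - conjc (toC p : C) * z).
    by apply: le_trans (normcB_ge _ _); rewrite normc1 lerD2l lerN2 xq.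
  by rewrite normcV normcX lef_pV2 ?posrE ?exprn_gt0 ?(lt_le_trans q1') // lerXn2r ?nnegrE ?normc_ge0 ?(ltW q1').
have [S S0 hS] := hasPS_bounded t1 hpsi.
have hpsi1 : hasPS psi c 0 1 by apply: hasPS_sub hpsi; exact: ltW.
have mPsi : cmeasurable D (fun p => Psi (toC p)).
  rewrite (_ : (fun p => _) = (fun p => gam * conjc (toC p : C) + psi (toC p))); last first.
    by apply/funext => p.
  apply: cmeasurableD; last exact: cmeasurable_hasPS hpsi1.
  by apply: cmeasurableM; [exact: cmeasurable_cst|apply: cmeasurable_conj; exact: cmeasurable_toC].
pose Sb := normc gam + S; have Sb0 : 0 < Sb by rewrite ltr_wpDl ?normc_ge0.
have hSb p : D p -> normc (Psi (toC p)) <= Sb.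
  rewrite drad_normc // => /ltW h; rewrite hPsi (le_trans (le_normcD _ _)) // lerD ?hS //.
  by rewrite normcM normc_conj ler_piMr ?normc_ge0.
have mG : cmeasurable D G by exact: cmeasurableM.
have hG p : D p -> normc (G p) <= Sb * kb.
  by move=> Dp; rewrite normcM ler_pM ?normc_ge0 ?hSb ?hkb.
have bG n : bmf 1 (fun p => s_ n p * k_ n p) by exact: bmfM.
have hlim := cint_uniform_cvg hf hB mG hG bG.
have -> : toeplitz Psi f z = (pi^-1)%:C%C * cint lam2 D (fun p => f (toC p) * G p).
  rewrite /toeplitz /bergman_proj disc_integralE; congr (_ * _); apply: eq_cint => p _.
  by rewrite /G mulrA (mulrC (f _)).
rewrite /pcvg; apply: (@cvgC_ext _ (fun n => (pi^-1)%:C%C *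
    cint lam2 D (fun p => f (toC p) * (s_ n p * k_ n p)))) => [n|].
  pose A (r : {poly C}) i (p : plane) : C := f (toC p) * (r.[toC p : C] * conjc (toC p : C) ^+ i).
  have iA r i : cintegrable lam2 D (A r i).
    have [mH [M hM]] : bmf 1 (fun p : plane => r.[toC p : C] * conjc (toC p : C) ^+ i).
      by apply: bmfM; [exact: bmf_horner|apply: bmfX; apply: bmf_conj; exact: bmf_toC].
    exact: cintegrable_mul (cmeasurable_hasPS hf) (integral_sqn_hasPS hf hB) mH hM.
  have cA r i := moment_mul r i hf hB.
  (* The factor conj(w) of the symbol raises the power in the kernel to i+1, so the gamma term is a
     moment with the polynomial 1 and produces a_(i+1)/(i+2). *)
  pose T i p := i.+1%:R * z ^+ i * (gam * A 1 i.+1 p + A (trunc c n) i p).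
  have iT' i : cintegrable lam2 D (fun p => gam * A 1 i.+1 p + A (trunc c n) i p).
    by apply: cintegrableD => //; exact: cintegrableZ.
  have iT i : cintegrable lam2 D (T i) by exact: cintegrableZ.
  rewrite (@eq_cint _ _ _ _ _ _ (fun p => \sum_(i < n) T i p)); last first.
    move=> p _; rewrite /k_ !mulr_sumr; apply: eq_bigr => i _.
    by rewrite /T /A /s_ hornerC exprMn exprS; ring.
  rewrite cint_sum // mulr_sumr; apply: eq_bigr => i _.
  rewrite cintZ // cintD //; last exact: cintegrableZ.
  rewrite cintZ // !cA /tcoef.
  have -> : \sum_(k < i.+2) (1 : {poly C})`_k * a (i.+1 - k)%N = a i.+1.
    rewrite big_ord_recl big1 ?addr0 => [|k _]; rewrite coef1 /=; first by rewrite mul1r subn0.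
    by rewrite mul0r.
  have -> : \sum_(k < i.+1) (trunc c n)`_k * a (i - k)%N = \sum_(k < i.+1) c k * a (i - k)%N.
    apply: eq_bigr => k _; rewrite coef_trunc ifT // (leq_trans (ltn_ord k)) //.
  set X := \sum_(k < i.+1) _; set Y := a i.+1.
  have hq m : (pi / m.+1%:R)%:C%C = (pi%:C%C : C) / m.+1%:R by rewrite rmorphM fmorphV rmorph_nat.
  rewrite !hq real_invc.
  have p0 : pi%:C%C != 0 :> C by rewrite eq_complex /= eqxx andbT gt_eqF ?pi_gt0.
  move: p0; set P := (pi%:C)%C; clearbody X Y P; clear => p0.
  field; rewrite p0 /=; by rewrite !nat1r -?natrD ?pnatr_eq0 //= -natrD pnatr_eq0.
apply: cvgCM; apply: hlim => e e0.
have kb1 : 0 < kb + 1 by rewrite ltr_wpDl ?(ltW kb0).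
have e1 : 0 < e / (2 * (kb + 1)) by rewrite divr_gt0 ?mulr_gt0.
have e2 : 0 < Num.min 1 (e / (2 * Sb)) by rewrite lt_min ltr01 divr_gt0 ?mulr_gt0.
have [N1 hN1] := hasPS_uniform t1 hpsi e1.
have [N2 hN2] := ksm _ e2.
exists (maxn N1 N2) => n p; rewrite geq_max => /andP[n1 n2] Dp.
have pz : normc (toC p : C) <= 1 by rewrite ltW // -drad_normc.
have h1 := hN1 n _ n1 pz; have := hN2 n p n2 Dp; rewrite le_min => /andP[h2 h3].
have -> : s_ n p * k_ n p - G p = (- (psi (toC p) - (trunc c n).[toC p : C])) * k_ n p +
    Psi (toC p) * (- (((1 - conjc (toC p : C) * z) ^+ 2)^-1 - k_ n p)).
  by rewrite /s_ /G hPsi; ring.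
apply: (le_trans (le_normcD _ _)); rewrite !normcM !normcN.
have hk : normc (k_ n p) <= kb + 1.
  have := le_normcD (((1 - conjc (toC p : C) * z) ^+ 2)^-1) (- (((1 - conjc (toC p : C) * z) ^+ 2)^-1 - k_ n p)).
  rewrite opprB addrC subrK => /le_trans; apply; apply: lerD; first exact: hkb.
  by rewrite -normcN opprB.
have -> : e = e / (2 * (kb + 1)) * (kb + 1) + Sb * (e / (2 * Sb)).
  by field; rewrite !gt_eqF.
by apply: lerD; apply: ler_pM; rewrite ?normc_ge0 ?hSb.
Qed.

End ToeplitzSeries.

(** * Boundedness on coefficients, and the complex derivative *)

Section ToeplitzNorms.
Variable R : realType.
Local Notation C := R[i].
Implicit Types (a b c : nat -> C) (psi : C -> C) (g : {poly C}).

Lemma le_of_small (x y K : R) : (forall e, 0 < e < 1 -> x <= y + e * K) -> x <= y.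
Proof.
move=> h; apply/ler_addgt0Pr => d d0.
have K1 : 0 < `|K| + 1 by rewrite ltr_wpDl.
pose e := Num.min (1 / 2) (d / (`|K| + 1)).
have e0 : 0 < e by rewrite lt_min divr_gt0 //= divr_gt0.
have e1 : e < 1 by rewrite gt_min; apply/orP; left; lra.
have eK : e * K <= d.
  apply: (@le_trans _ _ (d / (`|K| + 1) * (`|K| + 1))); last by rewrite divfK // gt_eqF.
  apply: (@le_trans _ _ (e * (`|K| + 1))).
    by rewrite ler_pM2l // (le_trans (ler_norm K)) // lerDl.
  by rewrite ler_pM2r // ge_min lexx orbT.
have := h e; rewrite e0 e1 => /(_ isT); lra.
Qed.

Lemma coef_adjX (g : {poly C}) n : (adjp 'X g)`_n = n.+1%:R / n.+2%:R * g`_n.+1.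
Proof.
rewrite (@coef_adjpE _ 2) ?size_polyX // big_ord_recl big_ord1 !coefX.
by rewrite conjc0 conjc1 /= add1n !mul0r add0r mul1r; ring.
Qed.

(** The backward shift makes degree n depend on a_(n+1), so the truncation of a has to reach one
    degree further than that of c. *)
Lemma coef_ptoep_trunc gam c a M N n : (n < M)%N -> (n.+1 < N)%N ->
  (ptoep gam (trunc c M) (trunc a N))`_n = tcoef gam c a n.
Proof.
move=> nM nN; rewrite /ptoep coefD coefZ coef_adjX coef_trunc nN coefM; congr (_ + _).
apply: eq_bigr => i _; rewrite !coef_trunc !ifT //.
  by rewrite (leq_ltn_trans (leq_subr _ _)) // ltnW.
by rewrite (leq_ltn_trans _ nM) // -ltnS.
Qed.

Lemma bnorm_take_poly m g : bnorm (take_poly m g) <= bnorm g.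
Proof.
have hM : (m <= maxn m (size g))%N by exact: leq_maxl.
rewrite (@bnormE _ (maxn m (size g))) ?(leq_trans (size_take_poly _ _)) //.
rewrite (@bnormE _ (maxn m (size g)) g) ?leq_maxr //.
apply: ler_sum => i _; rewrite ler_wpM2r ?invr_ge0 ?ler0n // coef_take_poly.
by case: ltnP; rewrite ?sqn0 ?sqn_ge0.
Qed.

Lemma take_ptoep_trunc gam c a M N m : (m <= M)%N -> (m < N)%N ->
  take_poly m (ptoep gam (trunc c M) (trunc a N)) = trunc (tcoef gam c a) m.
Proof.
move=> mM mN; apply/polyP => i; rewrite coef_take_poly coef_trunc; case: ltnP => // im.
by rewrite coef_ptoep_trunc // (leq_trans im mM, leq_ltn_trans im mN).
Qed.

Lemma bnorm_truncB a L N : (L <= N)%N -> bnorm (trunc a N - trunc a L) = psq a N - psq a L.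
Proof.
move=> LN; rewrite -!bnorm_trunc (@bnormE _ N); last first.
  by rewrite (leq_trans (size_polyD _ _)) // geq_max size_polyN size_trunc (leq_trans (size_trunc _ _)).
rewrite (@bnormE _ N (trunc a N)) ?size_trunc // (@bnormE _ N (trunc a L)); last first.
  by rewrite (leq_trans (size_trunc _ _)).
rewrite -sumrB; apply: eq_bigr => i _; rewrite coefD coefN !coef_trunc ltn_ord.
by case: ltnP => _; rewrite ?subrr ?subr0 sqn0 mul0r ?subr0.
Qed.

(** Low coefficients agree with those of a polynomial symbol within e of the given one, and
    [take_poly] only lowers the norm. The error constant comes from (S + e)^2 <= S^2 + e (2 S + 1)
    for e < 1. *)
Lemma psq_tcoef_le gam c psi (t S B : R) a : 1 < t -> hasPS psi c 0 t -> 0 <= S ->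
  (forall z, normc z < 1 -> normc (gam * conjc z + psi z) <= S) ->
  (forall N, psq a N <= B) -> forall L, psq (tcoef gam c a) L <= S ^+ 2 * B.
Proof.
move=> t1 hpsi S0 hS hB L.
have B0 : 0 <= B by apply: le_trans (hB 0%N); exact: psq_ge0.
apply: (@le_of_small _ _ ((2 * S + 1) * B)) => e /andP[e0 e1].
have [M0 hM] := hasPS_uniform t1 hpsi e0.
pose M := maxn M0 L.
rewrite -bnorm_trunc -(@take_ptoep_trunc _ _ _ M L.+1) ?leq_maxr //.
apply: (le_trans (bnorm_take_poly _ _)).
have h z : sqn z < 1 -> sqn (symb gam (trunc c M) z) <= (S + e) ^+ 2.
  move=> z1; have z1' : normc z < 1 by rewrite normc_lt_sqn ?expr1n.
  rewrite -normc_le_sqn ?addr_ge0 ?(ltW e0) //.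
  have -> : symb gam (trunc c M) z = (gam * conjc z + psi z) - (psi z - (trunc c M).[z]).
    by rewrite /symb; ring.
  apply: (le_trans (le_normcD _ _)); rewrite normcN lerD ?hS ?hM ?leq_maxl //; exact: ltW.
apply: (le_trans (ptoep_upper _ h)).
rewrite bnorm_trunc; apply: (@le_trans _ _ ((S + e) ^+ 2 * B)).
  by rewrite ler_wpM2l ?sqr_ge0.
have : 0 <= e * (1 - e) * B by rewrite !mulr_ge0 ?(ltW e0) // subr_ge0 ltW.
rewrite !expr2; lra.
Qed.

(** For |h| < s/2 the terms of degree at least 2 sum to at most 2 K (|h|/s)^2, which is o(|h|). *)
Lemma hasPS_derive1 (psi : Cplx R -> Cplx R) b (z : Cplx R) (r : R) :
  0 < r -> hasPS psi b z r -> derive1 psi z = b 1%N.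
Proof.
move=> r0 hf; pose s := r / 2.
have s0 : 0 < s by rewrite divr_gt0.
have [K K0 hK] : exists2 K : R, 0 < K & pgeom b s K.
  by apply: hasPS_pgeom hf; rewrite /s; apply/andP; split; lra.
have f0 : psi z = b 0%N.
  have := hf 0; rewrite normc0 addr0 => /(_ r0) h; apply: (cvgC_unique h).
  apply: (@cvgC_near_const _ _ _ 1) => n; case: n => // n _.
  rewrite big_ord_recl big1 ?addr0 => [|i _]; first by rewrite expr0 mulr1.
  by rewrite lift0 exprS mul0r mulr0.
apply: cvg_lim => //; apply/cvgrPdist_lt => e e0.
have ee : e = (complex.Re e)%:C%C by rewrite RRe_real // gtr0_real.
have re0 : 0 < complex.Re e by rewrite -ltcR -ee.
pose d := Num.min (s / 2) (complex.Re e * s ^+ 2 / (4 * K)).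
have d0 : 0 < d.
  by rewrite lt_min divr_gt0 //= divr_gt0 ?mulr_gt0 // exprn_gt0.
have dC : 0 < d%:C%C :> C by rewrite ltcR.
near=> h.
have h0 : h != 0 by near: h; exact: nbhs_dnbhs_neq.
have hd : normc h < d.
  have : `|h| < d%:C%C by near: h; exact: dnbhs0_lt.
  by rewrite normc_normr ltcR.
have nh0 : 0 < normc h by rewrite lt_neqAle normc_ge0 andbT eq_sym; apply: contraNN h0 => /eqP/eq0_normc ->.
have hs2 : normc h < s / 2 by apply: lt_le_trans hd _; rewrite ge_min lexx.
have hs : normc h < s by apply: lt_trans hs2 _; lra.
have hr : normc h < r by apply: lt_trans hs _; rewrite /s; lra.
have q01 := ratio_lt1 hs.
have g := pgeom_geom h s0 hK.
have hh := hf h hr.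
have := geom_csum_tail 2 q01 (ltW K0) g.
rewrite (cvgC_unique (geom_csum q01 (ltW K0) g) hh) big_ord_recl big_ord1 /= expr0 mulr1 -f0 => tl.
rewrite normc_normr ee ltcR.
have -> : b 1%N - h^-1 *: (psi (h + z) - psi z) = - (h^-1 * (psi (z + h) - (psi z + b 1%N * h))).
  rewrite (_ : h^-1 *: (psi (h + z) - psi z) = (h^-1 : C) * (psi (h + z) - psi z)) //.
  rewrite (addrC h); move: (psi (z + h)) (psi z) (b 1%N) => x y w.
  have h0' : (h : C) != 0 by [].
  by field.
rewrite normcN normcM normcV mulrC ltr_pdivrMr //.
apply: (le_lt_trans tl).
have q2 : normc h / s < 1 / 2 by rewrite ltr_pdivrMr // mulrC mulrA mulr1.
have hd2 : normc h < complex.Re e * s ^+ 2 / (4 * K).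
  by apply: lt_le_trans hd _; rewrite ge_min lexx orbT.
have i2 : (1 - normc h / s)^-1 < 2.
  rewrite -[ltRHS]invrK ltf_pV2 ?posrE ?invr_gt0 //; first lra.
  by rewrite subr_gt0; case/andP: q01.
have p2 : 0 < K * (normc h / s) ^+ 2 by rewrite mulr_gt0 ?exprn_gt0 ?divr_gt0.
apply: (@lt_trans _ _ (K * (normc h / s) ^+ 2 * 2)); first by rewrite mulrA ltr_pM2l.
move: hd2; rewrite ltr_pdivlMr ?mulr_gt0 // => hd2.
have -> : K * (normc h / s) ^+ 2 * 2 = (normc h * (4 * K)) * (normc h / (2 * s ^+ 2)) by field; rewrite gt_eqF.
have -> : complex.Re e * normc h = (complex.Re e * s ^+ 2) * (normc h / s ^+ 2) by field; rewrite gt_eqF.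
have s20 : 0 < s ^+ 2 by rewrite exprn_gt0.
apply: ltr_pM; rewrite ?mulr_ge0 ?divr_ge0 ?normc_ge0 ?(ltW K0) ?(ltW s20) //.
  by rewrite invr_ge0 mulr_ge0 // ltW.
by rewrite ltr_pM2l // ltf_pV2 ?posrE ?mulr_gt0 // ltr_pMl // ltr1n.
Unshelve. all: by end_near.
Qed.

Lemma hasPS_deriv psi c (t : R) : hasPS psi c 0 t ->
  hasPS (fun z => derive1 (psi : Cplx R -> Cplx R) z) (fun n => n.+1%:R * c n.+1) 0 t.
Proof.
move=> hf z zt; rewrite add0r.
pose s := (normc z + t) / 2.
have zn := normc_ge0 z.
have [K K0 hK] : exists2 K : R, 0 < K & pgeom c s K.
  by apply: hasPS_pgeom hf; rewrite /s; apply/andP; split; lra.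
have zs : normc z < s by rewrite /s; lra.
have st : s <= t by rewrite /s; lra.
have h1 := hasPS_reexp hK st hf zs.
rewrite add0r in h1.
rewrite (hasPS_derive1 _ h1) ?subr_gt0 //.
have := cvgC_shift (reexp_cvg 1 hK zs).
apply: cvgC_ext => n; rewrite big_ord_recl bin_small // !mul0r add0r.
by apply: eq_bigr => i _; rewrite lift0 bin1 subn1.
Qed.

End ToeplitzNorms.

(** * Norm increase for analytic psi *)

Section ToeplitzExpansive.
Variable R : realType.
Local Notation C := R[i].
Implicit Types (a c : nat -> C) (psi : C -> C) (p g : {poly C}).

Lemma deriv_trunc c M : (trunc c M.+1)^`() = trunc (fun n => n.+1%:R * c n.+1) M.
Proof.
apply/polyP => i; rewrite coef_deriv !coef_trunc ltnS.
by case: ifP => _; rewrite ?mul0rn // mulr_natl.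
Qed.

(** A Taylor polynomial q only satisfies |q'| <= (1 + tau) |gamma|. Multiplying it by 1 - tau gives
    the strict ratio 1 - tau^2, and the change tau |psi| is kept below e/2 by the choice of [tau].
    The symbol moves by at most e, hence the constant 1 - e. *)
Lemma expansive_approx gam c psi (t e : R) : 1 < t -> hasPS psi c 0 t -> gam != 0 ->
  (forall z, normc z < 1 -> normc (derive1 (psi : Cplx R -> Cplx R) z) <= normc gam) ->
  (forall z, normc z < 1 -> 1 <= normc (gam * conjc z + psi z)) -> 0 < e < 1 ->
  exists2 p : {poly C}, (forall z, normc z <= 1 -> normc (psi z - p.[z]) <= e) &
    forall g, (1 - e) ^+ 2 * bnorm g <= bnorm (ptoep gam p g).
Proof.
move=> t1 hpsi gam0 hd hs /andP[e0 e1].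
have g0 : 0 < normc gam.
  by rewrite lt_neqAle normc_ge0 andbT eq_sym; apply: contraNN gam0 => /eqP/eq0_normc ->.
have [S S0 hS] := hasPS_bounded t1 hpsi.
have S1 : 0 < S + 1 by rewrite addr_gt0.
pose tau := Num.min (1 / 2) (e / (2 * (S + 1))).
have tau0 : 0 < tau by rewrite lt_min divr_gt0 //= divr_gt0 ?mulr_gt0.
have tau1 : tau <= 1 / 2 by rewrite ge_min lexx.
have tauS : tau * (S + 1) <= e / 2.
  apply: (@le_trans _ _ (e / (2 * (S + 1)) * (S + 1))).
    by rewrite ler_pM2r // ge_min lexx orbT.
  by rewrite le_eqVlt; apply/orP; left; apply/eqP; field; rewrite gt_eqF.
pose eta := Num.min (e / 2) (tau * normc gam).
have eta0 : 0 < eta by rewrite lt_min divr_gt0 //= mulr_gt0.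
have etae : eta <= e / 2 by rewrite ge_min lexx.
have etag : eta <= tau * normc gam by rewrite ge_min lexx orbT.
have [M1 hM1] := hasPS_uniform t1 hpsi eta0.
have [M2 hM2] := hasPS_uniform t1 (hasPS_deriv hpsi) eta0.
pose M := maxn M1 M2.
pose q := trunc c M.+1.
have hq z : normc z <= 1 -> normc (psi z - q.[z]) <= eta.
  by apply: hM1; rewrite leqW // leq_maxl.
have hq' z : normc z < 1 -> normc q^`().[z] <= (1 + tau) * normc gam.
  move=> z1; have := hM2 M z (leq_maxr _ _) (ltW z1); rewrite -deriv_trunc -/q => h.
  have h2 := hd z z1.
  have := normcB_ge q^`().[z] (derive1 (psi : Cplx R -> Cplx R) z).
  rewrite -[X in _ <= X]normcN opprB; move: h h2 etag; set x := normc _; set y := normc _; lra.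
pose p := (1 - tau)%:C%C *: q.
have hp z : normc z <= 1 -> normc (psi z - p.[z]) <= e.
  move=> z1; have h1 := hq z z1; have h2 := hS z z1.
  have -> : psi z - p.[z] = (1 - tau)%:C%C * (psi z - q.[z]) + tau%:C%C * psi z.
    by rewrite hornerZ rmorphB rmorph1; ring.
  apply: (le_trans (le_normcD _ _)); rewrite !normcM !normc_real !ger0_norm ?(ltW tau0) //; last lra.
  have h3 : (1 - tau) * normc (psi z - q.[z]) <= 1 * (e / 2).
    by apply: ler_pM; rewrite ?normc_ge0 ?(le_trans h1) //; lra.
  have h4 : tau * normc (psi z) <= tau * (S + 1).
    by rewrite ler_wpM2l ?(ltW tau0) // (le_trans h2) // lerDl.
  lra.
exists p => // g; apply: (@ptoep_expansive R gam p ((1 - tau ^+ 2) ^+ 2)).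
- have : tau ^+ 2 <= 1 / 2.
    rewrite expr2; apply: (@le_trans _ _ (1 * (1 / 2))); last by rewrite mul1r.
    by apply: ler_pM; rewrite ?(ltW tau0) // (le_trans tau1) //; lra.
  have : 0 < tau ^+ 2 by rewrite exprn_gt0.
  move=> h1 h2; rewrite sqr_ge0 /= expr_lt1 //; lra.
- lra.
- move=> z z1; have z1' : normc z < 1 by rewrite normc_lt_sqn ?expr1n.
  rewrite -!sqr_normc_sqn -exprMn derivZ hornerZ lerXn2r ?nnegrE ?normc_ge0 ?mulr_ge0 ?normc_ge0 //.
    by rewrite subr_ge0 expr_le1 ?(ltW tau0) // (le_trans tau1) //; lra.
  rewrite normcM normc_real ger0_norm; last lra.
  have -> : (1 - tau ^+ 2) * normc gam = (1 - tau) * ((1 + tau) * normc gam) by ring.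
  by rewrite ler_wpM2l ?hq' //; lra.
- move=> z z1; have z1' : normc z < 1 by rewrite normc_lt_sqn ?expr1n.
  have h1 := hs z z1'; have h2 := hp z (ltW z1').
  have -> : symb gam p z = (gam * conjc z + psi z) - (psi z - p.[z]) by rewrite /symb; ring.
  by apply: le_trans (normcB_ge _ _); apply: lerB.
Qed.

(** The expansive polynomial symbol p acts on a truncation of a. The result differs from the
    truncated image sequence by the effect of a tail of a and of the passage from psi to p, each of
    squared norm O(e^2); the weight e in [bnormD_le] turns this into an error O(e). *)
Lemma psq_le_tcoef gam c psi (t B B' : R) a : 1 < t -> hasPS psi c 0 t -> gam != 0 ->
  (forall z, normc z < 1 -> normc (derive1 (psi : Cplx R -> Cplx R) z) <= normc gam) ->
  (forall z, normc z < 1 -> 1 <= normc (gam * conjc z + psi z)) ->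
  (forall N, psq a N <= B) -> (forall N, psq (tcoef gam c a) N <= B') ->
  forall N, psq a N <= B'.
Proof.
move=> t1 hpsi gam0 hd hs hB hB' L0.
have B0 : 0 <= B by apply: le_trans (hB 0%N); exact: psq_ge0.
have B'0 : 0 <= B' by apply: le_trans (hB' 0%N); exact: psq_ge0.
have [S S0 hS] := hasPS_bounded t1 hpsi.
pose S' := (normc gam + S + 1) ^+ 2.
have S'0 : 0 <= S' by exact: sqr_ge0.
(* The summands come from (1 - e)^2 >= 1 - 2 e, from the factor 1 + e on B', and from (e^2 + e) (2
   S' + 8 B) <= 2 e (2 S' + 8 B). *)
apply: (@le_of_small _ _ _ (2 * B + B' + 2 * (2 * S' + 8 * B))) => e e01.
have /andP[e0 e1] := e01.
have [p hp hpg] := expansive_approx t1 hpsi gam0 hd hs e01.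
have [L1 hL1] := psq_tail hB (exprn_gt0 2 e0).
pose L := maxn L0 L1.
have hL N : psq a N - psq a L <= e ^+ 2.
  by apply: le_trans (hL1 N); rewrite lerD2l lerN2 psq_le // leq_maxr.
have [M hM] := hasPS_uniform t1 hpsi e0.
pose P := ptoep gam p (trunc a L).
(* Chosen after [p] and [P], so that cutting at degree N leaves [P] unchanged. *)
pose N := maxn M (maxn L (size P)).
have MN : (M <= N)%N by exact: leq_maxl.
have LN : (L <= N)%N by rewrite /N (leq_trans (leq_maxl L (size P))) // leq_maxr.
have PN : (size P <= N)%N by rewrite /N (leq_trans (leq_maxr L (size P))) // leq_maxr.
pose q := trunc c N.
pose T := ptoep gam q.
pose d := trunc a N.+1 - trunc a L.
have eP : P = trunc (tcoef gam c a) N - take_poly N (T d + (q - p) * trunc a L).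
  rewrite -(@take_ptoep_trunc _ _ _ _ N N.+1) // -/q -/T -raddfB /=.
  rewrite -[LHS](take_poly_id PN); congr (take_poly N _).
  have -> : T d = T (trunc a N.+1) - T (trunc a L) by exact: raddfB.
  move: (T (trunc a N.+1)) => x.
  by rewrite opprD opprB addrA addrCA subrr addr0 /P /T /ptoep mulrBl opprB addrA addrAC addrK.
have hd1 : bnorm d <= e ^+ 2 by rewrite bnorm_truncB ?leqW.
have hTd : bnorm (T d) <= S' * bnorm d.
  apply: (ptoep_upper) => z z1.
  have z1' : normc z <= 1 by rewrite normc_le_sqn ?expr1n // ltW.
  rewrite -normc_le_sqn ?addr_ge0 ?normc_ge0 ?(ltW S0) //.
  have -> : symb gam q z = (gam * conjc z + psi z) - (psi z - q.[z]) by rewrite /symb; ring.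
  apply: (le_trans (le_normcD _ _)); rewrite normcN; apply: lerD; last first.
    by rewrite (le_trans (hM N z MN z1')) // ltW.
  apply: (le_trans (le_normcD _ _)); rewrite normcM normc_conj; apply: lerD; last exact: hS.
  by rewrite ler_piMr ?normc_ge0.
have hqp : bnorm ((q - p) * trunc a L) <= (2 * e) ^+ 2 * bnorm (trunc a L).
  apply: (bnormM_le) => z z1.
  have z1' : normc z <= 1 by rewrite normc_le_sqn ?expr1n // ltW.
  rewrite -normc_le_sqn ?mulr_ge0 ?(ltW e0) // hornerD hornerN.
  have -> : q.[z] - p.[z] = (psi z - p.[z]) - (psi z - q.[z]) by ring.
  apply: (le_trans (le_normcD _ _)); rewrite normcN mulr_natl mulr2n.
  by apply: lerD; [exact: hp|exact: hM].
have h1 := hpg (trunc a L).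
have h2 := bnormD_le (trunc (tcoef gam c a) N) (- take_poly N (T d + (q - p) * trunc a L)) e0.
rewrite -eP bnormN in h2.
have h3 := bnorm_take_poly N (T d + (q - p) * trunc a L).
have h4 := bnormD2 (T d) ((q - p) * trunc a L).
set X := bnorm (take_poly N _) in h2 h3; clearbody X.
rewrite !bnorm_trunc -/P in h1 h2 hqp.
have h6 := hB L.
have h7 : psq a L0 <= psq a L by apply: psq_le; exact: leq_maxl.
have h8 : S' * bnorm d <= S' * e ^+ 2 by rewrite ler_wpM2l.
have h9 : (2 * e) ^+ 2 * psq a L <= 4 * e ^+ 2 * B.
  have -> : (2 * e) ^+ 2 = 4 * e ^+ 2 by rewrite exprMn -natrX.
  by rewrite ler_wpM2l // mulr_ge0 ?sqr_ge0.
have hX : X <= e ^+ 2 * (2 * S' + 8 * B).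
  move: h3 h4 hTd hqp h8 h9; set u := bnorm _; set v := bnorm _; set w := bnorm _; set x := bnorm d.
  by clear; lra.
have hX2 : (1 + e^-1) * X <= (1 + e^-1) * (e ^+ 2 * (2 * S' + 8 * B)).
  by rewrite ler_pM2l // addr_gt0 // invr_gt0.
have eX : (1 + e^-1) * (e ^+ 2 * (2 * S' + 8 * B)) = (e ^+ 2 + e) * (2 * S' + 8 * B).
  by field; rewrite gt_eqF.
rewrite eX in hX2.
have h10 : (1 + e) * psq (tcoef gam c a) N <= (1 + e) * B' by rewrite ler_pM2l // addr_gt0.
have h11 : 0 <= (e - e ^+ 2) * (2 * S' + 8 * B).
  apply: mulr_ge0; last by apply: addr_ge0; apply: mulr_ge0.
  by rewrite expr2 -{1}(mulr1 e) -mulrBr mulr_ge0 ?(ltW e0) // subr_ge0 ltW.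
have h12 : (1 - 2 * e) * psq a L <= (1 - e) ^+ 2 * psq a L.
  rewrite ler_wpM2r ?psq_ge0 //; have := sqr_ge0 e; rewrite !expr2; lra.
have h13 : e * psq a L <= e * B by rewrite ler_pM2l.
move: h1 h2 hX2 h7 h10 h11 h12 h13.
move: (psq a L) (psq a L0) (psq (tcoef gam c a) N) (bnorm P) ((1 - e) ^+ 2 * psq a L) ((1 + e^-1) * X).
move: (2 * S' + 8 * B) => Q; rewrite !expr2 => x x0 y z u w; clear; lra.
Qed.

End ToeplitzExpansive.

(** * Orbits *)

Section BergmanOrbits.
Variable R : realType.
Local Notation C := R[i].
Local Notation lam2 := ((@lebesgue_measure R) \x (@lebesgue_measure R))%E.
Local Notation D := (drad (1 : R)).
Implicit Types (a c : nat -> C) (f psi : C -> C).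

Lemma psq_of_L2norm f a (e : R) : hasPS f a 0 1 -> 0 <= e -> (L2norm f <= e%:E)%E ->
  forall N, psq a N <= e ^+ 2.
Proof.
move=> hf e0 he; apply: (bessel hf).
move: he; rewrite /L2norm disc2E.
under eq_integral => p _ do rewrite sqr_normc_sqn.
have I0 : (0 <= \int[lam2]_(p in D) (sqn (f (toC p)))%:E)%E.
  by apply: integral_ge0 => p _; rewrite lee_fin sqn_ge0.
move: I0; move: (\int[lam2]_(p in D) _)%E => [r| |] //=.
  rewrite !lee_fin => r0 h; rewrite mulrC -ler_pdivrMr ?pi_gt0 // mulrC.
  have x0 : 0 <= pi^-1 * r by rewrite mulr_ge0 ?invr_ge0 ?pi_ge0.
  by rewrite -(sqr_sqrtr x0) lerXn2r ?nnegrE ?sqrtr_ge0.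
by rewrite gt0_muley ?lte_fin ?invr_gt0 ?pi_gt0.
Qed.

Lemma bergman_psq f : bergman f -> exists2 a, hasPS f a 0 1 & exists B : R, forall N, psq a N <= B.
Proof.
move=> [[_ _ hL] hA].
have [|a ha] := @analytic_open_disc_hasPS R f 1 ltr01.
  by move=> c c1; apply: hA; rewrite /disc /= normc_normr (ltcR _ 1).
exists a => //.
have [e e0 he] : exists2 e : R, 0 <= e & (L2norm f <= e%:E)%E.
  move: hL; have : (0 <= L2norm f)%E by exact: sqrte_ge0.
  by case: (L2norm f) => // e e0 _; exists e.
by exists (e ^+ 2); exact: psq_of_L2norm he.
Qed.

Lemma bergman_cst (k : C) : bergman (fun=> k : Cplx R).
Proof.
split; first split.
- exact: measurable_cst.
- exact: measurable_cst.
- rewrite /L2norm disc2E integral_cst; last exact: measurable_drad.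
  have fD : lam2 D \is a fin_num by rewrite ge0_fin_numE ?drad_lty.
  have [v ev] : exists v : R, lam2 D = v%:E by exists (fine (lam2 D)); rewrite fineK.
  by rewrite [X in (_ * (_ * X))%E]ev -!EFinM /= ltry.
move=> c _; exists (fun n => if n is 0%N then k else 0), 1; split => // z _.
apply: cvg_of_cvgC; apply: (@cvgC_near_const _ _ _ 1) => -[|n] // _.
rewrite seriesEord /= big_ord_recl big1 ?addr0 => [|i _]; first by rewrite expr0 mulr1.
by rewrite mul0r.
Qed.

Lemma hasPS_subC f a k (r : R) : hasPS f a 0 r ->
  hasPS (fun z => f z - k) (fun n => a n - (if n is 0%N then k else 0)) 0 r.
Proof.
move=> hf h hr; have hk : pcvg (fun n => if n is 0%N then - k else 0) h (- k).
  apply: (@cvgC_near_const _ _ _ 1) => -[|n] // _.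
  rewrite big_ord_recl big1 ?addr0 => [|i _]; first by rewrite expr0 mulr1.
  by rewrite mul0r.
apply: cvgC_ext (cvgCD (hf h hr) hk) => n; rewrite -big_split /=.
by apply: eq_bigr => -[[|i] hi] _ /=; rewrite -mulrDl ?subr0 ?addr0.
Qed.

Lemma sqn_le_psq a (n : nat) (B : R) : (forall N, psq a N <= B) -> sqn (a n) <= n.+1%:R * B.
Proof.
move=> h; have := h n.+1; rewrite /psq big_ord_recr /= => h1.
rewrite mulrC -ler_pdivrMr ?ltr0n //; apply: le_trans h1; rewrite lerDr.
by apply: sumr_ge0 => i _; rewrite divr_ge0 ?sqn_ge0 ?ler0n.
Qed.

Section Symbol.
Variables (gam : C) (c : nat -> C) (t : R) (psi Psi : C -> C).
Hypotheses (t1 : 1 < t) (hpsi : hasPS psi c 0 t) (hPsi : forall z, Psi z = gam * conjc z + psi z).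

Lemma toeplitz_iter f a (B : R) : hasPS f a 0 1 -> (forall N, psq a N <= B) -> forall n,
  hasPS (iter n (toeplitz Psi) f) (iter n (tcoef gam c) a) 0 1 /\
  exists B' : R, forall N, psq (iter n (tcoef gam c) a) N <= B'.
Proof.
move=> hf hB; have [S S0 hS] := hasPS_bounded t1 hpsi.
elim=> [|n [IH1 [B' IH2]]]; first by split => //; exists B.
split; first exact: toeplitz_hasPS t1 hpsi hPsi IH1 IH2.
exists ((normc gam + S) ^+ 2 * B').
apply: (psq_tcoef_le t1 hpsi _ _ IH2); first by rewrite addr_ge0 ?normc_ge0 ?ltW.
move=> z z1; apply: (le_trans (le_normcD _ _)); apply: lerD; last by rewrite hS ?ltW.
by rewrite normcM normc_conj ler_piMr ?normc_ge0 ?ltW.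
Qed.

Lemma contractive_not_hypercyclic : (forall z, normc z < 1 -> normc (Psi z) <= 1) ->
  ~ bergman_hypercyclic (toeplitz Psi).
Proof.
move=> h1 [f bf hf]; have [a ha [B hB]] := bergman_psq bf.
have B0 : 0 <= B by apply: le_trans (hB 0%N); exact: psq_ge0.
have hn n : forall N, psq (iter n (tcoef gam c) a) N <= B.
  elim: n => [//|n IH] N /=; rewrite -[leRHS]mul1r -(expr1n R 2).
  by apply: (psq_tcoef_le t1 hpsi _ _ IH) => // z /h1; rewrite hPsi.
(* All iterates have constant coefficient of modulus at most sqrt B, so they stay at distance at
   least 2 from this constant function. *)
pose k : C := (Num.sqrt B + 2)%:C%C.
have [n hd] := hf _ (bergman_cst k) 1 ltr01.
have [hi _] := toeplitz_iter ha hB n.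
have := sqn_le_psq 0 (psq_of_L2norm (hasPS_subC k hi) ler01 (ltW hd)).
rewrite mul1r -normc_le_sqn // => h2.
have := sqn_le_psq 0 (hn n); rewrite mul1r -{1}(sqr_sqrtr B0) -normc_le_sqn ?sqrtr_ge0 // => h3.
have := normcB_ge k (iter n (tcoef gam c) a 0%N).
rewrite -[X in _ <= X]normcN opprB normc_real ger0_norm ?addr_ge0 ?sqrtr_ge0 //; lra.
Qed.

(** [hback] runs the orbit backwards: a small iterate forces a small starting vector. Approximating
    0 thus forces all coefficients to vanish, and the zero orbit misses the constant 1. *)
Lemma expansive_not_hypercyclic : gam != 0 ->
  (forall z, normc z < 1 -> normc (derive1 (psi : Cplx R -> Cplx R) z) <= normc gam) ->
  (forall z, normc z < 1 -> 1 <= normc (Psi z)) ->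
  ~ bergman_hypercyclic (toeplitz Psi).
Proof.
move=> gam0 hd h1 [f bf hf]; have [a ha [B hB]] := bergman_psq bf.
have hback n (B' : R) : (forall N, psq (iter n (tcoef gam c) a) N <= B') -> forall N, psq a N <= B'.
  elim: n B' => [//|n IH] B' h; apply: IH.
  have [_ [B'' hB'']] := toeplitz_iter ha hB n.
  by apply: (psq_le_tcoef t1 hpsi gam0 hd _ hB'' h) => z /h1; rewrite hPsi.
have small (e : R) : 0 < e -> forall N, psq a N <= e ^+ 2.
  move=> e0; have [n hn] := hf _ (bergman_cst 0) e e0.
  have [hi _] := toeplitz_iter ha hB n.
  apply: (hback n) => N; apply: (psq_of_L2norm hi (ltW e0)).
  apply: le_trans (ltW hn); rewrite le_eqVlt; apply/orP; left; apply/eqP; congr L2norm.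
  by apply/funext => z; rewrite subr0.
have a0 n : a n = 0.
  apply/eq0_normc/eqP; rewrite eq_le normc_ge0 andbT.
  apply: (@le_of_small _ _ _ n.+1%:R) => e /andP[e0 _]; rewrite add0r.
  rewrite normc_le_sqn ?mulr_ge0 ?(ltW e0) //.
  apply: (le_trans (sqn_le_psq n (small e e0))).
  rewrite exprMn mulrC ler_wpM2l ?sqr_ge0 // expr2 ler_peMr ?ler0n // ler1n //.
have it0 n k : iter n (tcoef gam c) a k = 0.
  elim: n k => [//|n IH] k /=; rewrite /tcoef IH !mulr0 add0r big1 // => i _.
  by rewrite IH mulr0.
have half0 : 0 < 1 / 2 :> R by rewrite divr_gt0.
have [n hn] := hf _ (bergman_cst 1) _ half0.
have [hi _] := toeplitz_iter ha hB n.
have := sqn_le_psq 0 (psq_of_L2norm (hasPS_subC 1 hi) (ltW half0) (ltW hn)).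
rewrite /= it0 sub0r sqnN sqn1 expr2; lra.
Qed.

End Symbol.

Lemma closure_disc (z : Cplx R) : normc z <= 1 -> closure (disc R) z.
Proof.
move=> z1 A /nbhs_ballP[e /= e0 hA].
have ee : e = (complex.Re e)%:C%C by rewrite RRe_real // gtr0_real.
have re0 : 0 < complex.Re e by rewrite -ltcR -ee.
pose d := Num.min (1 / 2) (complex.Re e / 2).
have d0 : 0 < d by rewrite lt_min !divr_gt0.
have d1 : d <= 1 / 2 by rewrite ge_min lexx.
have de : d <= complex.Re e / 2 by rewrite ge_min lexx orbT.
exists ((1 - d)%:C%C * z); split.
  rewrite /disc /= normc_normr (ltcR _ 1) normcM normc_real ger0_norm; last lra.
  apply: (@le_lt_trans _ _ ((1 - d) * 1)); last lra.
  by rewrite ler_wpM2l //; lra.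
apply: hA; rewrite -ball_normE /= ee normc_normr ltcR.
have -> : z - (1 - d)%:C%C * z = d%:C%C * z by rewrite rmorphB rmorph1; ring.
rewrite normcM normc_real gtr0_norm //; apply: (@le_lt_trans _ _ (d * 1)); last lra.
by rewrite ler_pM2l.
Qed.

End BergmanOrbits.

Theorem theorem3p4 (R : realType) (gamma : Cplx R) (U : set (Cplx R))
    (psi : Cplx R -> Cplx R) (Psi : Cplx R -> Cplx R)
    (gamma_neq0 : gamma != 0)
    (U_open : open U)
    (disc_sub_U : closure (disc R) `<=` U)
    (psi_analytic : analytic_on U psi)
    (PsiE : forall z, Psi z = gamma * z^* + psi z)
    (sense_reversing : forall z, closure (disc R) z ->
       `|derive1 psi z| < `|gamma|) :
  bergman_hypercyclic (toeplitz Psi) ->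
  disc R `&` (Psi @` disc R) !=set0 /\ disc_ext R `&` (Psi @` disc R) !=set0.
Proof.
move=> hyp.
(* A single Taylor series at 0, valid on a disc of radius t > 1, supplies the uniform polynomial
   approximation on the closed disc. *)
have [z z1|c [t t1 hpsi]] := @analytic_closed_disc_hasPS R psi 1 ler01.
  by apply: psi_analytic; apply: disc_sub_U; exact: closure_disc.
have inD z : normc z < 1 -> disc R z by move=> z1; rewrite /disc /= normc_normr (ltcR _ 1).
(* If the image misses the open disc then |Psi| >= 1 there and T does not decrease norms; if it
   misses the exterior then |Psi| < 1 and T is a contraction. *)
split; apply: contrapT => h.
- apply: (expansive_not_hypercyclic t1 hpsi PsiE gamma_neq0 _ _ hyp) => z z1.
    have /sense_reversing : closure (disc R) z by apply: closure_disc; exact: ltW.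
    by rewrite !normc_normr ltcR => /ltW.
  rewrite leNgt; apply/negP => Pz; apply: h; exists (Psi z); split; first exact: inD.
  by exists z => //; exact: inD.
- apply: (contractive_not_hypercyclic t1 hpsi PsiE _ hyp) => z z1.
  rewrite leNgt; apply/negP => Pz; apply: h; exists (Psi z); split.
    by rewrite /disc_ext /= normc_normr (lecR 1) ltW.
  by exists z => //; exact: inD.
Qed.
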